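(* Let $a,b\in\mathbb{C}$, $r\in\mathbb{N}$, $\mathbf{m}=(m_1,\dots,m_r)\in\mathbb{N}^r$, $m=m_1+\cdots+m_r$, $\mathbf{f}=(f_1,\dots,f_r)\in\mathbb{C}^r$. If $b+1\notin-\mathbb{N}_0$ and $f_j-b\notin\{1-m_j,2-m_j,\ldots,0\}$ for $1\le j\le r$, then $$(1-x)^{a}\,{}_{r+2}F_{r+1}\left(\begin{matrix}a,b,\mathbf{f}+\mathbf{m}\\ b+1,\mathbf{f}\end{matrix}\,\middle|\,x\right)=\sum_{j=0}^{m-1}\frac{(a)_j}{(b+1)_{j}}\left(\frac{x}{x-1}\right)^j\sum_{k=0}^{j}(-1)^k(b)_{k}C_{k,r}$$ $$+\frac{x^{m}(a)_{m}(\mathbf{f}-b)_{\mathbf{m}}}{(x-1)^{m}(b+1)_{m}(\mathbf{f})_{\mathbf{m}}}\,{}_{2}F_{1}\left(\begin{matrix}1,a+m\\ b+m+1\end{matrix}\,\middle|\,\frac{x}{x-1}\right)$$ for $x\in\mathbb{C}\setminus[1,\infty)$, and $$e^{-x}\,{}_{r+1}F_{r+1}\left(\begin{matrix}b,\mathbf{f}+\mathbf{m}\\ b+1,\mathbf{f}\end{matrix}\,\middle|\,x\right)=\sum_{j=0}^{m-1}\frac{(-x)^j}{(b+1)_{j}}\sum_{k=0}^{j}(-1)^k(b)_{k}C_{k,r}+\frac{(-x)^{m}(\mathbf{f}-b)_{\mathbf{m}}}{(b+1)_{m}(\mathbf{f})_{\mathbf{m}}}\,{}_{1}F_{1}\left(\begin{matrix}1\\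 b+m+1\end{matrix}\,\middle|\,-x\right)$$ for all $x\in\mathbb{C}$.
   Context: $\mathbb{N}=\{1,2,\dots\}$, $\mathbb{N}_0=\mathbb{N}\cup\{0\}$; $(z)_k=z(z+1)\cdots(z+k-1)$, $(z)_0=1$; $(\mathbf{f}+s)_{\mathbf{m}}=\prod_{j=1}^r(f_j+s)_{m_j}$. ${}_pF_q$ is the generalized hypergeometric function $\sum_{n\ge0}\frac{(a_1)_n\cdots(a_p)_n}{(b_1)_n\cdots(b_q)_n}\frac{z^n}{n!}$, and for $p=q+1$ it is understood as its analytic continuation to $z\in\mathbb{C}\setminus[1,\infty)$; as usual, no bottom parameter is a nonpositive integer (in particular no $f_j$ is). In parameter lists $\mathbf{f}$ means $f_1,\dots,f_r$ and $\mathbf{f}+\mathbf{m}$ means $f_1+m_1,\dots,f_r+m_r$. $(1-x)^a$ is the principal branch. The coefficients are $C_{k,r}=\frac{(-1)^k}{k!}\,{}_{r+1}F_r\left(\begin{matrix}-k,\mathbf{f}+\mathbf{m}\\ \mathbf{f}\end{matrix}\,\middle|\,1\right)=\frac{(-1)^k}{k!}\sum_{i=0}^k\frac{(-k)_i}{i!}\prod_{j=1}^r\frac{(f_j+m_j)_i}{(f_j)_i}$ for $0\le k\le m$. *)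

(* Defs.v *)
From Stdlib Require Import Reals List Arith ClassicalEpsilon.
From Coquelicot Require Import Coquelicot.

Open Scope R_scope.
Open Scope C_scope.

Definition Cexp (z : C) : C := (exp (Re z) * cos (Im z), exp (Re z) * sin (Im z))%R.

(* Principal argument, with values in (-PI, PI] for w <> 0. *)
Definition Carg (w : C) : R :=
  if Rlt_dec (Im w) 0 then (- acos (Re w / Cmod w))%R else acos (Re w / Cmod w)%R.

Definition Clog (w : C) : C := (ln (Cmod w), Carg w).

(* Principal branch of w^a, meaningful for w <> 0. *)
Definition Cpower (w a : C) : C := Cexp (a * Clog w).

Fixpoint poch (z : C) (k : nat) : C :=
  match k with
  | O => 1
  | S k' => poch z k' * (z + INR k')
  end.

Definition Cprod_list (l : list C) : C := fold_right Cmult 1 l.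

(* A family indexed by 1..r is encoded by a function on nat, of which only the
   values at 0..r-1 are used. *)
Definition params {T : Type} (r : nat) (u : nat -> T) : list T := map u (seq 0 r).

Definition total (r : nat) (m : nat -> nat) : nat := list_sum (params r m).

(* (f+s)_m = prod_j (f_j+s)_{m_j} *)
Definition poch_vec (r : nat) (f : nat -> C) (s : C) (m : nat -> nat) : C :=
  Cprod_list (params r (fun j => poch (f j + s) (m j))).

(* f_1+m_1, ..., f_r+m_r *)
Definition shifted (r : nat) (f : nat -> C) (m : nat -> nat) : list C :=
  params r (fun j => f j + INR (m j)).

Definition pFq_term (A B : list C) (z : C) (n : nat) : C :=
  Cprod_list (map (fun a => poch a n) A) / Cprod_list (map (fun b => poch b n) B)
  * (z ^ n / INR (fact n)).

(* C \ [1, +oo) *)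
Definition slit_plane (z : C) : Prop := ~ (Im z = 0%R /\ (1 <= Re z)%R).

Definition analytic_at (F : C -> C) (z0 : C) : Prop :=
  exists (c : nat -> C) (rho : R), (0 < rho)%R /\
    forall z : C, (Cmod (z - z0) < rho)%R ->
      is_pseries (K := C_AbsRing) (V := C_NormedModule) c (z - z0) (F z).

Definition pFq_continuation (A B : list C) (F : C -> C) : Prop :=
  (forall z : C, slit_plane z -> analytic_at F z) /\
  (forall z : C, (Cmod z < 1)%R ->
     is_series (K := C_AbsRing) (V := C_NormedModule) (pFq_term A B z) (F z)).

(* When p = q+1 the value is that of the analytic continuation of the series to
   the slit plane, which exists and is unique there (it is unspecified on the cut
   [1, +oo)); when p <= q it is the sum of the everywhere convergent series.
   Nothing is intended for p > q+1 or for a nonpositive integer in B. *)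
Definition pFq (A B : list C) : C -> C :=
  if Nat.eq_dec (length A) (S (length B))
  then epsilon (inhabits (fun _ : C => RtoC 0)) (pFq_continuation A B)
  else fun z => iota (T := C_CompleteNormedModule)
                  (is_series (K := C_AbsRing) (V := C_NormedModule) (pFq_term A B z)).

(* C_{k,r}: the series of (r+1)F(r)(-k, f+m; f | 1) terminates at index k, because
   (-k)_i = 0 for i > k, so its value at the point 1 is this finite sum. *)
Definition Ccoef (r : nat) (f : nat -> C) (m : nat -> nat) (k : nat) : C :=
  (-1) ^ k / INR (fact k)
  * sum_n (pFq_term (- RtoC (INR k) :: shifted r f m) (params r f) 1) k.

(* Main.v *)
(* Both left-hand sides are identified with explicit functions by comparing power
   series coefficients. The ratio (f+m)_n / (f)_n is a polynomial P(n) of degree m,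
   whose Newton expansion has the coefficients C_{k,r}, and (b)_n / (b+1)_n = b / (b+n).
   Writing the right-hand side over falling factorials of n, the sums over k
   telescope against the factor b+n, and the remainder is P(-b) = (f-b)_m / (f)_m.

   The analytic continuation of 2F1(1, A; B; y) comes from the first order equation
   y (1-y) G' + (B-1 - A y) G = B-1: in the Koebe coordinate y = 4 w / (1+w)^2, which
   maps the unit disc onto C \ [1, oo), its power series solution converges in the
   whole disc. Cauchy's integral formula turns complex differentiability into local
   power series expansions, and the identity theorem along segments from 0 makes the
   continuation unique. *)
Require Import Defs.
From Stdlib Require Import Reals List Arith Lra Lia ClassicalEpsilon.
From Coquelicot Require Import Coquelicot.
Open Scope R_scope.
Open Scope C_scope.

(** * Complex derivatives *)

(** For p = q + 1 the value of [pFq] is picked by [epsilon], so nothing is known about it until a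
    function analytic on the whole slit plane with the right Taylor series is exhibited. For the
    left-hand function none is built separately: the right-hand side times (1-x)^(-a) is shown to be
    one, so only 2F1(1, A; B; y) needs a genuine continuation. An Euler integral would restrict the
    real parts of the parameters; a differential equation does not. With an upper parameter 1 the
    Gauss equation drops to first order, with singular points 0, 1 and infinity. The Koebe map sends
    w = 1 to y = 1 and w = -1 to infinity, so inside the unit disc only w = 0 is singular, and the
    solution regular there has radius of convergence 1. Transported by x/(x-1) and multiplied by a
    power of 1-x, the same equation becomes x W' + beta W = beta (1-x)^(-A), which is Pfaff's
    transformation read on coefficients; e^x replaces the power in the second formula. Since b = 0
    is allowed, b/(b+n) needs care at n = 0. *)

Notation Cball_space := (AbsRing_UniformSpace C_AbsRing).

(* Complex derivatives are taken with [C] as a normed module over itself through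
   its absolute value, the structure for which Coquelicot has the product and
   chain rules. *)
Definition Cderiv (f : C -> C) (z l : C) : Prop :=
  is_derive (K := C_AbsRing) (V := AbsRing_NormedModule C_AbsRing) f z l.

Definition Ccont (f : C -> C) (z : C) : Prop :=
  continuous (T := Cball_space) (U := Cball_space) f z.

(** The balls of [Cball_space] unfold to discs for [Cmod]. From here on estimates use the modulus
    directly, and the product uniformity of pairs of reals is avoided. *)
Lemma Ccont_eps (f : C -> C) (z : C) :
  Ccont f z <-> forall eps, (0 < eps)%R -> exists d, (0 < d)%R /\
    forall w, (Cmod (w - z) < d)%R -> (Cmod (f w - f z) < eps)%R.
Proof.
  split.
  - intros H eps He.
    destruct (H (fun y => (Cmod (y - f z) < eps)%R)) as [d Hd].
    { exists (mkposreal eps He). intros y Hy. exact Hy. }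
    exists d. split; [apply cond_pos|]. intros w Hw. apply Hd. exact Hw.
  - intros H P [eps HP].
    destruct (H eps (cond_pos eps)) as [d [Hd Hd']].
    exists (mkposreal d Hd). intros y Hy. apply HP. apply (Hd' y Hy).
Qed.

Lemma Cderiv_eps (f : C -> C) (z l : C) :
  Cderiv f z l <-> forall eps, (0 < eps)%R -> exists d, (0 < d)%R /\
    forall w, (Cmod (w - z) < d)%R ->
      (Cmod (f w - f z - (w - z) * l) <= eps * Cmod (w - z))%R.
Proof.
  split.
  - intros [_ H] eps He.
    destruct (H z (fun P HP => HP) (mkposreal eps He)) as [d Hd].
    exists d. split; [apply cond_pos|]. intros w Hw. apply (Hd w Hw).
  - intros H. split.
    + apply (is_linear_scal_l (K := C_AbsRing) (V := AbsRing_NormedModule C_AbsRing)).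
    + intros x Hx eps.
      assert (E : x = z).
      { symmetry. apply (is_filter_lim_locally_unique (K := C_AbsRing) (V := AbsRing_NormedModule C_AbsRing)). exact Hx. }
      subst x.
      destruct (H eps (cond_pos eps)) as [d [Hd Hd']].
      exists (mkposreal d Hd). intros y Hy. apply (Hd' y Hy).
Qed.

Lemma Cderiv_cont (f : C -> C) (z l : C) : Cderiv f z l -> Ccont f z.
Proof.
  intros H. apply (ex_derive_continuous (K := C_AbsRing) (V := AbsRing_NormedModule C_AbsRing)).
  exists l. exact H.
Qed.

(** Both linear approximations are tested at one small real increment [h]. Each error is at most a
    third of |l1 - l2| h, and two thirds do not reach |l1 - l2| h. *)
Lemma Cderiv_unique (f : C -> C) (z l1 l2 : C) :
  Cderiv f z l1 -> Cderiv f z l2 -> l1 = l2.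
Proof.
  intros H1 H2.
  destruct (Ceq_dec l1 l2) as [E|N]; [exact E|exfalso].
  assert (P : (0 < Cmod (l1 - l2))%R) by (apply Cmod_gt_0, Cminus_eq_contra, N).
  destruct (proj1 (Cderiv_eps _ _ _) H1 (Cmod (l1 - l2) / 3)%R ltac:(lra)) as [d1 [D1 K1]].
  destruct (proj1 (Cderiv_eps _ _ _) H2 (Cmod (l1 - l2) / 3)%R ltac:(lra)) as [d2 [D2 K2]].
  set (h := (Rmin d1 d2 / 2)%R).
  assert (Hm : (0 < Rmin d1 d2)%R) by (apply Rmin_glb_lt; assumption).
  assert (L1 := Rmin_l d1 d2). assert (L2 := Rmin_r d1 d2).
  assert (Hh : (Cmod (z + RtoC h - z) = h)%R).
  { replace (z + RtoC h - z) with (RtoC h) by ring. rewrite Cmod_R. apply Rabs_pos_eq. unfold h; lra. }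
  specialize (K1 (z + RtoC h)). specialize (K2 (z + RtoC h)).
  rewrite Hh in K1, K2.
  assert (K1' := K1 ltac:(unfold h; lra)). assert (K2' := K2 ltac:(unfold h; lra)).
  assert (T := Cmod_triangle (f (z + h) - f z - (z + h - z) * l2)
     (- (f (z + h) - f z - (z + h - z) * l1))).
  rewrite Cmod_opp in T.
  replace (f (z + h) - f z - (z + h - z) * l2 + - (f (z + h) - f z - (z + h - z) * l1))
    with (RtoC h * (l1 - l2)) in T by ring.
  rewrite Cmod_mult, Cmod_R, Rabs_pos_eq in T by (unfold h; lra).
  assert (0 < h)%R by (unfold h; lra).
  assert (Q : (h * Cmod (l1 - l2) <= (2/3) * (Cmod (l1 - l2) * h))%R) by lra.
  assert (0 < h * Cmod (l1 - l2))%R by (apply Rmult_lt_0_compat; assumption).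
  lra.
Qed.

(** Continuity of the derivative is included because Cauchy's formula is proved by differentiating
    under the integral sign; this replaces Goursat's argument. *)
Definition Csmooth (f f' : C -> C) (z : C) : Prop := Cderiv f z (f' z) /\ Ccont f' z.

Lemma Cderiv_const (c z : C) : Cderiv (fun _ => c) z 0.
Proof.
  apply Cderiv_eps. intros eps He. exists 1%R. split; [lra|]. intros w _.
  replace (c - c - (w - z) * 0) with (RtoC 0) by ring. rewrite Cmod_0.
  apply Rmult_le_pos; [lra|apply Cmod_ge_0].
Qed.

Lemma Cderiv_id (z : C) : Cderiv (fun w => w) z 1.
Proof.
  apply Cderiv_eps. intros eps He. exists 1%R. split; [lra|]. intros w _.
  replace (w - z - (w - z) * 1) with (RtoC 0) by ring. rewrite Cmod_0.
  apply Rmult_le_pos; [lra|apply Cmod_ge_0].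
Qed.

Lemma Cderiv_plus (f g : C -> C) (z a b : C) :
  Cderiv f z a -> Cderiv g z b -> Cderiv (fun w => f w + g w) z (a + b).
Proof.
  exact (@is_derive_plus C_AbsRing (AbsRing_NormedModule C_AbsRing) f g z a b).
Qed.

Lemma Cderiv_mult (f g : C -> C) (z a b : C) :
  Cderiv f z a -> Cderiv g z b -> Cderiv (fun w => f w * g w) z (a * g z + f z * b).
Proof.
  intros Hf Hg.
  exact (@is_derive_mult C_AbsRing f g z a b Hf Hg Cmult_comm).
Qed.

Lemma Cderiv_comp (f g : C -> C) (z a b : C) :
  Cderiv f (g z) a -> Cderiv g z b -> Cderiv (fun w => f (g w)) z (b * a).
Proof.
  exact (@is_derive_comp C_AbsRing (AbsRing_NormedModule C_AbsRing) f g z a b).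
Qed.

Lemma Cderiv_eq (f : C -> C) (z a b : C) : a = b -> Cderiv f z a -> Cderiv f z b.
Proof. intros ->; trivial. Qed.

Lemma Ccont_plus (f g : C -> C) (z : C) :
  Ccont f z -> Ccont g z -> Ccont (fun w => f w + g w) z.
Proof.
  exact (@continuous_plus Cball_space C_AbsRing (AbsRing_NormedModule C_AbsRing) f g z).
Qed.

Lemma Ccont_mult (f g : C -> C) (z : C) :
  Ccont f z -> Ccont g z -> Ccont (fun w => f w * g w) z.
Proof.
  exact (@continuous_mult Cball_space C_AbsRing f g z).
Qed.

Lemma Ccont_comp (f g : C -> C) (z : C) :
  Ccont g z -> Ccont f (g z) -> Ccont (fun w => f (g w)) z.
Proof.
  exact (@continuous_comp Cball_space Cball_space Cball_space g f z).
Qed.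

Lemma Ccont_const (c z : C) : Ccont (fun _ => c) z.
Proof. apply (Cderiv_cont _ _ 0), Cderiv_const. Qed.

Lemma Ccont_id (z : C) : Ccont (fun w => w) z.
Proof. apply (Cderiv_cont _ _ 1), Cderiv_id. Qed.

Lemma Ccont_inv_id (z : C) : z <> 0 -> Ccont Cinv z.
Proof.
  intros Hz. apply Ccont_eps. intros eps He.
  assert (Pz : (0 < Cmod z)%R) by (apply Cmod_gt_0, Hz).
  (* The first bound keeps |w| above |z|/2, hence |w z| above |z|^2/2; the second then makes |w -
     z|/|w z| smaller than [eps]. *)
  exists (Rmin (Cmod z / 2) (eps * (Cmod z * Cmod z) / 2)).
  assert (0 < Cmod z * Cmod z)%R by (apply Rmult_lt_0_compat; assumption).
  assert (0 < eps * (Cmod z * Cmod z))%R by (apply Rmult_lt_0_compat; assumption).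
  split.
  { apply Rmin_glb_lt; lra. }
  intros w Hw.
  assert (H1 := Rlt_le_trans _ _ _ Hw (Rmin_l _ _)).
  assert (H2 := Rlt_le_trans _ _ _ Hw (Rmin_r _ _)).
  assert (T := Cmod_triangle w (- (w - z))). rewrite Cmod_opp in T.
  replace (w + - (w - z)) with z in T by ring.
  assert (Pw : (Cmod z / 2 < Cmod w)%R) by lra.
  assert (Hw0 : w <> 0) by (apply Cmod_gt_0; lra).
  replace (/ w - / z) with (- (w - z) / (w * z)) by (field; split; assumption).
  rewrite Cmod_div by (apply Cmult_neq_0; assumption).
  rewrite Cmod_opp, Cmod_mult.
  assert (0 < Cmod w * Cmod z)%R by (apply Rmult_lt_0_compat; lra).
  apply (Rmult_lt_reg_r (Cmod w * Cmod z)); [assumption|].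
  unfold Rdiv. rewrite Rmult_assoc, Rinv_l, Rmult_1_r by lra.
  apply Rlt_le_trans with (1 := H2).
  replace (eps * (Cmod z * Cmod z) / 2)%R with (eps * (Cmod z / 2 * Cmod z))%R by field.
  apply Rmult_le_compat_l; [lra|]. apply Rmult_le_compat_r; lra.
Qed.

(** Caratheodory's form of differentiability. It reduces the derivatives of [Cinv] and [Clog] to the
    continuity of a slope function. *)
Lemma Cderiv_caratheodory (f p : C -> C) (z : C) :
  (exists d, (0 < d)%R /\ forall w, (Cmod (w - z) < d)%R -> f w = f z + (w - z) * p w) ->
  Ccont p z -> Cderiv f z (p z).
Proof.
  intros [d [Hd E]] Hp. apply Cderiv_eps. intros eps He.
  destruct (proj1 (Ccont_eps _ _) Hp eps He) as [d' [Hd' K]].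
  exists (Rmin d d'). split; [apply Rmin_glb_lt; assumption|].
  intros w Hw. rewrite (E w) by (apply Rlt_le_trans with (1 := Hw), Rmin_l).
  replace (f z + (w - z) * p w - f z - (w - z) * p z) with ((p w - p z) * (w - z)) by ring.
  rewrite Cmod_mult. apply Rmult_le_compat_r; [apply Cmod_ge_0|].
  apply Rlt_le, K, Rlt_le_trans with (1 := Hw), Rmin_r.
Qed.

Lemma Cderiv_inv_id (z : C) : z <> 0 -> Cderiv Cinv z (- / (z * z)).
Proof.
  intros Hz.
  apply (Cderiv_eq _ _ ((fun w => - / z * / w) z)).
  { field; assumption. }
  apply (Cderiv_caratheodory Cinv (fun w => - / z * / w) z).
  - exists (Cmod z). split; [apply (proj1 (Cmod_gt_0 z)), Hz|]. intros w Hw.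
    assert (w <> 0).
    { intros ->. replace (0 - z) with (- z) in Hw by ring. rewrite Cmod_opp in Hw. lra. }
    field. split; assumption.
  - apply Ccont_mult; [apply Ccont_const|apply Ccont_inv_id, Hz].
Qed.

Lemma Ccont_inv (f : C -> C) (z : C) : f z <> 0 -> Ccont f z -> Ccont (fun w => / f w) z.
Proof. intros H Hf. apply (Ccont_comp Cinv f); [exact Hf|apply Ccont_inv_id, H]. Qed.

Lemma Ccont_opp (f : C -> C) (z : C) : Ccont f z -> Ccont (fun w => - f w) z.
Proof.
  exact (@continuous_opp Cball_space C_AbsRing (AbsRing_NormedModule C_AbsRing) f z).
Qed.

Lemma Cderiv_opp (f : C -> C) (z a : C) : Cderiv f z a -> Cderiv (fun w => - f w) z (- a).
Proof.
  exact (@is_derive_opp C_AbsRing (AbsRing_NormedModule C_AbsRing) f z a).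
Qed.

Lemma Csmooth_cont (f f' : C -> C) (z : C) : Csmooth f f' z -> Ccont f z.
Proof. intros [H _]. exact (Cderiv_cont _ _ _ H). Qed.

(** The differentiation rules produce derivatives in unsimplified form; this replaces them by
    readable ones. Equality is asked everywhere because the functions are exchanged by functional
    extensionality. *)
Lemma Csmooth_ext (f f' g g' : C -> C) (z : C) :
  (forall w, f w = g w) -> (forall w, f' w = g' w) -> Csmooth f f' z -> Csmooth g g' z.
Proof.
  intros E E'.
  rewrite (FunctionalExtensionality.functional_extensionality f g E).
  rewrite (FunctionalExtensionality.functional_extensionality f' g' E'). trivial.
Qed.

Lemma Csmooth_const (c z : C) : Csmooth (fun _ => c) (fun _ => 0) z.
Proof. split; [apply Cderiv_const|apply Ccont_const]. Qed.

Lemma Csmooth_id (z : C) : Csmooth (fun w => w) (fun _ => 1) z.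
Proof. split; [apply Cderiv_id|apply Ccont_const]. Qed.

Lemma Csmooth_plus (f f' g g' : C -> C) (z : C) :
  Csmooth f f' z -> Csmooth g g' z -> Csmooth (fun w => f w + g w) (fun w => f' w + g' w) z.
Proof.
  intros [F F'] [G G']. split; [apply Cderiv_plus|apply Ccont_plus]; assumption.
Qed.

Lemma Csmooth_opp (f f' : C -> C) (z : C) :
  Csmooth f f' z -> Csmooth (fun w => - f w) (fun w => - f' w) z.
Proof.
  intros [F F']. split; [apply Cderiv_opp|apply Ccont_opp]; assumption.
Qed.

Lemma Csmooth_mult (f f' g g' : C -> C) (z : C) :
  Csmooth f f' z -> Csmooth g g' z ->
  Csmooth (fun w => f w * g w) (fun w => f' w * g w + f w * g' w) z.
Proof.
  intros Hf Hg. assert (Cf := Csmooth_cont _ _ _ Hf). assert (Cg := Csmooth_cont _ _ _ Hg).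
  destruct Hf as [F F'], Hg as [G G']. split.
  - apply Cderiv_mult; assumption.
  - apply Ccont_plus; apply Ccont_mult; assumption.
Qed.

Lemma Csmooth_comp (f f' g g' : C -> C) (z : C) :
  Csmooth f f' (g z) -> Csmooth g g' z -> Csmooth (fun w => f (g w)) (fun w => g' w * f' (g w)) z.
Proof.
  intros [F F'] Hg. assert (Cg := Csmooth_cont _ _ _ Hg). destruct Hg as [G G']. split.
  - apply Cderiv_comp; assumption.
  - apply Ccont_mult; [assumption|]. apply (Ccont_comp f' g); assumption.
Qed.

Lemma Csmooth_inv (f f' : C -> C) (z : C) :
  f z <> 0 -> Csmooth f f' z -> Csmooth (fun w => / f w) (fun w => f' w * - / (f w * f w)) z.
Proof.
  intros Hz Hf. apply (Csmooth_comp Cinv (fun w => - / (w * w))); [|exact Hf]. split.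
  - apply Cderiv_inv_id, Hz.
  - apply Ccont_opp. apply (Ccont_inv (fun w => w * w)); [apply Cmult_neq_0; assumption|].
    apply Ccont_mult; apply Ccont_id.
Qed.

(** At n = 0 the truncated exponent n - 1 is 0, which does no harm because the factor n vanishes. *)
Lemma Csmooth_pow (f f' : C -> C) (z : C) (n : nat) :
  Csmooth f f' z -> Csmooth (fun w => f w ^ n) (fun w => INR n * f w ^ (n - 1) * f' w) z.
Proof.
  intros Hf. induction n as [|n IH].
  - apply (Csmooth_ext (fun _ => 1) (fun _ => 0)); [reflexivity| |apply Csmooth_const].
    intros w. simpl. ring.
  - refine (Csmooth_ext _ _ _ _ _ (fun w => eq_refl (f w ^ S n)) _ (Csmooth_mult _ _ _ _ _ Hf IH)).
    intros w. rewrite S_INR, RtoC_plus. replace (S n - 1)%nat with n by lia.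
    destruct n as [|n]; [simpl; ring|].
    replace (S n - 1)%nat with n by lia. simpl. ring.
Qed.

(** * Complex power series *)

Notation Cseries := (is_series (K := C_AbsRing) (V := C_NormedModule)).

Lemma Cseries_eps (a : nat -> C) (l : C) :
  Cseries a l <-> forall eps, (0 < eps)%R -> exists N, forall n, (N <= n)%nat ->
    (Cmod (sum_n a n - l) < eps)%R.
Proof.
  unfold is_series. split.
  - intros H eps He.
    apply (proj1 (filterlim_locally_ball_norm (K := C_AbsRing) (U := C_NormedModule) _ _) H (mkposreal eps He)).
  - intros H. apply (filterlim_locally_ball_norm (K := C_AbsRing) (U := C_NormedModule)).
    intros [eps He]. exact (H eps He).
Qed.

Lemma Cseries_unique (a : nat -> C) (l l' : C) : Cseries a l -> Cseries a l' -> l = l'.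
Proof.
  exact (fun H H' => filterlim_locally_unique (K := C_AbsRing) (V := C_NormedModule) _ l l' H H').
Qed.

Lemma Cseries_ext (a b : nat -> C) (l : C) :
  (forall n, a n = b n) -> Cseries a l -> Cseries b l.
Proof. exact (is_series_ext a b l). Qed.

Lemma Cseries_plus (a b : nat -> C) (l l' : C) :
  Cseries a l -> Cseries b l' -> Cseries (fun n => a n + b n) (l + l').
Proof. exact (is_series_plus a b l l'). Qed.

Lemma Cseries_scal (c : C) (a : nat -> C) (l : C) :
  Cseries a l -> Cseries (fun n => c * a n) (c * l).
Proof. exact (is_series_scal_l (V := C_NormedModule) c a l). Qed.

Lemma Cseries_decr_1 (a : nat -> C) (l : C) :
  Cseries (fun n => a (S n)) (l - a O) -> Cseries a l.
Proof. exact (is_series_decr_1 (V := C_NormedModule) a l). Qed.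

Lemma Cseries_incr_1 (a : nat -> C) (l : C) :
  Cseries a l -> Cseries (fun n => a (S n)) (l - a O).
Proof.
  intros H. apply (is_series_incr_1 (V := C_NormedModule) a).
  assert (E : l - a O + a O = l) by ring.
  change (Cseries a (l - a O + a O)). rewrite E. exact H.
Qed.

Lemma Cseries_zero : Cseries (fun _ => RtoC 0) (RtoC 0).
Proof.
  apply Cseries_eps. intros eps He. exists O. intros n _.
  replace (sum_n (fun _ : nat => RtoC 0) n) with (RtoC 0).
  - replace (0 - 0) with (RtoC 0) by ring. rewrite Cmod_0. exact He.
  - induction n as [|n IH]; [rewrite sum_O; reflexivity|].
    rewrite sum_Sn, <- IH. symmetry. apply Cplus_0_r.
Qed.

Lemma Cseries_first (c : C) (a : nat -> C) :
  a O = c -> (forall n, a (S n) = 0) -> Cseries a c.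
Proof.
  intros H0 H. apply Cseries_decr_1. rewrite H0. replace (c - c) with (RtoC 0) by ring.
  apply (Cseries_ext (fun _ => RtoC 0)); [intros n; symmetry; apply H|apply Cseries_zero].
Qed.

Lemma Cmod_sum_n (a : nat -> C) (n : nat) :
  (Cmod (sum_n a n) <= sum_n (fun k => Cmod (a k)) n)%R.
Proof. exact (norm_sum_n_m (K := C_AbsRing) (V := C_NormedModule) a 0 n). Qed.

Lemma sum_n_le_Series (b : nat -> R) (n : nat) :
  (forall n, 0 <= b n)%R -> ex_series b -> (sum_n b n <= Series b)%R.
Proof.
  intros Hp Hb. apply Series_correct in Hb.
  apply (is_lim_seq_incr_compare (sum_n b)).
  - exact Hb.
  - intros k. rewrite sum_Sn. assert (H := Hp (S k)). unfold plus; simpl. lra.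
Qed.

(** Convergence is the comparison test; the bound passes from the partial sums to the limit, and it
    is what later controls Taylor remainders. *)
Lemma Cseries_dominated (a : nat -> C) (b : nat -> R) :
  (forall n, Cmod (a n) <= b n)%R -> ex_series b ->
  exists l, Cseries a l /\ (Cmod l <= Series b)%R.
Proof.
  intros Hab Hb.
  assert (X : exists l : C, Cseries a l)
    by exact (ex_series_le (K := C_AbsRing) (V := C_CompleteNormedModule) a b Hab Hb).
  destruct X as [l Hl].
  exists l. split; [exact Hl|].
  apply Rnot_lt_le. intros Hlt.
  destruct (proj1 (Cseries_eps _ _) Hl (Cmod l - Series b)%R ltac:(lra)) as [N HN].
  specialize (HN N (Nat.le_refl _)).
  assert (T := Cmod_triangle (sum_n a N) (- (sum_n a N - l))). rewrite Cmod_opp in T.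
  replace (sum_n a N + - (sum_n a N - l)) with l in T by ring.
  assert (B1 := Cmod_sum_n a N).
  assert (B2 : (sum_n (fun k => Cmod (a k)) N <= sum_n b N)%R).
  { apply (sum_n_m_le (fun k => Cmod (a k)) b 0 N Hab). }
  assert (B3 := sum_n_le_Series b N (fun n => Rle_trans _ _ _ (Cmod_ge_0 _) (Hab n)) Hb).
  lra.
Qed.

(** An arbitrary value is taken where the series diverges, so that sums of power series become total
    functions. *)
Definition Csum (a : nat -> C) : C := epsilon (inhabits (RtoC 0)) (Cseries a).

Lemma Csum_correct (a : nat -> C) : (exists l, Cseries a l) -> Cseries a (Csum a).
Proof. intros H. exact (epsilon_spec _ _ H). Qed.

Lemma finite_upper_bound (u : nat -> R) (M : nat) :
  exists K, (0 <= K)%R /\ forall n, (n <= M)%nat -> (u n <= K)%R.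
Proof.
  induction M as [|M [K [HK IH]]].
  - exists (Rmax 0 (u O)). split; [apply Rmax_l|]. intros n Hn.
    replace n with O by lia. apply Rmax_r.
  - exists (Rmax K (u (S M))). split; [apply Rle_trans with (1 := HK), Rmax_l|].
    intros n Hn. destruct (Nat.eq_dec n (S M)) as [->|Ne]; [apply Rmax_r|].
    apply Rle_trans with (2 := Rmax_l _ _), IH. lia.
Qed.

Lemma Cseries_terms_bounded (a : nat -> C) (l : C) :
  Cseries a l -> exists K, (0 <= K)%R /\ forall n, (Cmod (a n) <= K)%R.
Proof.
  intros H.
  destruct (proj1 (Cseries_eps _ _) H 1%R ltac:(lra)) as [N HN].
  destruct (finite_upper_bound (fun n => Cmod (a n)) (S N)) as [K [HK HB]].
  exists (Rmax K 2). split; [apply Rle_trans with (1 := HK), Rmax_l|].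
  intros n. destruct (Compare_dec.le_lt_dec n (S N)) as [Hn|Hn].
  - apply Rle_trans with (2 := Rmax_l _ _), HB, Hn.
  - apply Rle_trans with (2 := Rmax_r _ _).
    destruct n as [|n]; [lia|].
    assert (H1 := HN n ltac:(lia)). assert (H2 := HN (S n) ltac:(lia)).
    assert (E : sum_n a (S n) = sum_n a n + a (S n)) by (rewrite sum_Sn; reflexivity).
    rewrite E in H2.
    assert (T := Cmod_triangle (sum_n a n + a (S n) - l) (- (sum_n a n - l))).
    rewrite Cmod_opp in T.
    replace (sum_n a n + a (S n) - l + - (sum_n a n - l)) with (a (S n)) in T by ring. lra.
Qed.

Definition pser (c : nat -> C) (rho : R) (F : C -> C) : Prop :=
  forall z, (Cmod z < rho)%R -> Cseries (fun n => c n * z ^ n) (F z).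

(** The series converges at the real point r, so its terms there are bounded. *)
Lemma pser_coef_bound (c : nat -> C) (rho r : R) (F : C -> C) :
  pser c rho F -> (0 <= r < rho)%R ->
  exists K, (0 <= K)%R /\ forall n, (Cmod (c n) * r ^ n <= K)%R.
Proof.
  intros H Hr.
  assert (E : Cmod (RtoC r) = r) by (rewrite Cmod_R; apply Rabs_pos_eq; lra).
  destruct (Cseries_terms_bounded _ _ (H (RtoC r) ltac:(rewrite E; lra))) as [K [HK B]].
  exists K. split; [exact HK|]. intros n. specialize (B n).
  rewrite Cmod_mult, Cmod_pow, E in B. exact B.
Qed.

(** The weight (n+1)^2 dominates both the factor n+1 of the derived series and the factor n^2 of
    second-order Taylor remainders. *)
Lemma ex_series_sq_geom (q : R) : (0 < q < 1)%R ->
  ex_series (fun n => (INR (S n) * INR (S n)) * q ^ n)%R.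
Proof.
  intros Hq.
  assert (P : forall n, (0 < INR (S n))%R) by (intros n; apply lt_0_INR; lia).
  apply ex_series_Rabs, (ex_series_DAlembert _ q).
  - lra.
  - intros n. apply Rmult_integral_contrapositive_currified.
    + assert (H := P n). nra.
    + apply pow_nonzero. lra.
  - apply (is_lim_seq_ext (fun n => (1 + / INR (S n)) * (1 + / INR (S n)) * q)%R).
    + intros n. rewrite Rabs_pos_eq.
      * rewrite (S_INR (S n)). simpl pow. assert (H := P n). field. split; [apply pow_nonzero; lra|lra].
      * assert (H := P n). assert (H' := P (S n)). assert (0 < q ^ n)%R by (apply pow_lt; lra).
        assert (0 < q ^ S n)%R by (apply pow_lt; lra).
        apply Rlt_le, Rdiv_lt_0_compat; apply Rmult_lt_0_compat; nra.
    + assert (L : is_lim_seq (fun n => / INR (S n))%R 0).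
      { apply (is_lim_seq_incr_1 (fun n => / INR n)%R).
        apply (is_lim_seq_inv INR p_infty); [apply is_lim_seq_INR|discriminate]. }
      assert (LL : is_lim_seq (fun n => (1 + / INR (S n)) * (1 + / INR (S n)) * q)%R ((1 + 0) * (1 + 0) * q)%R).
      { apply is_lim_seq_mult'; [|apply is_lim_seq_const].
        apply is_lim_seq_mult'; (apply is_lim_seq_plus'; [apply is_lim_seq_const|exact L]). }
      replace ((1 + 0) * (1 + 0) * q)%R with q in LL by ring. exact LL.
Qed.

(** Induction through e_(n+1) = (z+h) e_n + n z^(n-1) h^2 for the remainder e_n, with n^2 + n <=
    (n+1)^2. The factor r^2 stands on the left because r^(n-2) would involve a truncated
    exponent. *)
Lemma Cpow_taylor_bound (z h : C) (r : R) (n : nat) :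
  (0 < r)%R -> (Cmod z <= r)%R -> (Cmod (z + h) <= r)%R ->
  (Cmod ((z + h) ^ n - z ^ n - h * (INR n * z ^ (n - 1))) * (r * r)
   <= INR n * INR n * r ^ n * (Cmod h * Cmod h))%R.
Proof.
  intros Hr Hz Hzh. induction n as [|n IH].
  - simpl. replace (1 - 1 - h * (0 * 1)) with (RtoC 0) by ring. rewrite Cmod_0. lra.
  - assert (E : (z + h) ^ S n - z ^ S n - h * (INR (S n) * z ^ (S n - 1))
       = (z + h) * ((z + h) ^ n - z ^ n - h * (INR n * z ^ (n - 1))) + INR n * z ^ (n - 1) * (h * h)).
    { rewrite S_INR, RtoC_plus. replace (S n - 1)%nat with n by lia.
      destruct n as [|n]; [simpl; ring|]. replace (S n - 1)%nat with n by lia. simpl. ring. }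
    rewrite E. clear E.
    set (e := (z + h) ^ n - z ^ n - h * (INR n * z ^ (n - 1))) in *.
    assert (T := Cmod_triangle ((z + h) * e) (INR n * z ^ (n - 1) * (h * h))).
    rewrite !Cmod_mult, Cmod_pow, Cmod_R, (Rabs_pos_eq (INR n)) in T by apply pos_INR.
    assert (Pe := Cmod_ge_0 e). assert (Ph := Cmod_ge_0 h). assert (Pz := Cmod_ge_0 z).
    assert (Pn := pos_INR n).
    assert (Hpow : (INR n * Cmod z ^ (n - 1) * (r * r) <= INR n * r ^ S n)%R).
    { destruct n as [|n]; [simpl; lra|]. replace (S n - 1)%nat with n by lia.
      rewrite Rmult_assoc. apply Rmult_le_compat_l; [lra|].
      simpl. replace (r * (r * r ^ n))%R with (r ^ n * (r * r))%R by ring.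
      apply Rmult_le_compat_r; [nra|]. apply pow_incr. lra. }
    assert (0 <= r ^ n)%R by (apply pow_le; lra).
    assert (Q0 : (0 <= Cmod h * Cmod h)%R) by nra.
    apply Rle_trans with (Cmod (z + h) * Cmod e * (r * r) + (INR n * Cmod z ^ (n - 1) * (r * r)) * (Cmod h * Cmod h))%R.
    { apply Rle_trans with ((Cmod (z + h) * Cmod e + INR n * Cmod z ^ (n - 1) * (Cmod h * Cmod h)) * (r * r))%R; [|right; ring].
      apply Rmult_le_compat_r; [nra|exact T]. }
    apply Rle_trans with (r * (INR n * INR n * r ^ n * (Cmod h * Cmod h)) + (INR n * r ^ S n) * (Cmod h * Cmod h))%R.
    { apply Rplus_le_compat.
      - rewrite Rmult_assoc. apply Rmult_le_compat; [apply Cmod_ge_0|nra|exact Hzh|exact IH].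
      - apply Rmult_le_compat_r; [exact Q0|exact Hpow]. }
    rewrite S_INR. simpl pow.
    apply Rle_trans with ((INR n * INR n + INR n) * (r * r ^ n * (Cmod h * Cmod h)))%R; [right; ring|].
    apply Rle_trans with ((INR n + 1) * (INR n + 1) * (r * r ^ n * (Cmod h * Cmod h)))%R; [|right; ring].
    apply Rmult_le_compat_r; [|nra].
    apply Rmult_le_pos; [|exact Q0]. apply Rmult_le_pos; lra.
Qed.

Definition dcoef (c : nat -> C) (n : nat) : C := INR (S n) * c (S n).

Lemma pser_deriv_converges (c : nat -> C) (rho : R) (F : C -> C) (z : C) :
  pser c rho F -> (Cmod z < rho)%R -> exists l, Cseries (fun n => dcoef c n * z ^ n) l.
Proof.
  intros H Hz. assert (Pz := Cmod_ge_0 z).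
  (* Three radii |z| < r1 < r < rho: the coefficients are bounded by K / r^n, the powers of z by
     r1^n, and the gap makes r1/r < 1. *)
  set (r := ((2 * rho + Cmod z) / 3)%R).
  set (r1 := ((rho + Cmod z) / 2)%R).
  assert (Hr : (0 < r1 < r /\ r < rho /\ Cmod z <= r1)%R) by (unfold r, r1; lra).
  destruct (pser_coef_bound c rho r F H ltac:(lra)) as [K [HK B]].
  assert (Hq : (0 < r1 / r < 1)%R).
  { split; [apply Rdiv_lt_0_compat; lra|]. apply (Rmult_lt_reg_r r); [lra|].
    unfold Rdiv. rewrite Rmult_assoc, Rinv_l by lra. lra. }
  destruct (Cseries_dominated (fun n => dcoef c n * z ^ n)
    (fun n => (K / r) * (INR (S n) * INR (S n) * (r1 / r) ^ n))%R) as [l [Hl _]].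
  - intros n. unfold dcoef. rewrite !Cmod_mult, Cmod_pow, Cmod_R, Rabs_pos_eq by apply pos_INR.
    specialize (B (S n)). assert (Pn : (1 <= INR (S n))%R) by (rewrite S_INR; assert (P := pos_INR n); lra).
    assert (Hc : (Cmod (c (S n)) <= K / r ^ S n)%R).
    { apply (Rmult_le_reg_r (r ^ S n)); [apply pow_lt; lra|].
      unfold Rdiv. rewrite Rmult_assoc, Rinv_l by (apply pow_nonzero; lra). lra. }
    assert (Hp : (Cmod z ^ n <= r1 ^ n)%R) by (apply pow_incr; lra).
    apply Rle_trans with (INR (S n) * (K / r ^ S n) * r1 ^ n)%R.
    { apply Rmult_le_compat; [apply Rmult_le_pos; [lra|apply Cmod_ge_0]|apply pow_le; lra| |exact Hp].
      apply Rmult_le_compat_l; [lra|exact Hc]. }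
    assert (E : (INR (S n) * (K / r ^ S n) * r1 ^ n = INR (S n) * (K / r * (r1 / r) ^ n))%R).
    { unfold Rdiv. rewrite Rpow_mult_distr, pow_inv. simpl pow. field. split; [apply pow_nonzero; lra|lra]. }
    rewrite E.
    replace (K / r * (INR (S n) * INR (S n) * (r1 / r) ^ n))%R
      with (INR (S n) * (INR (S n) * (K / r * (r1 / r) ^ n)))%R by ring.
    apply Rmult_le_compat_l; [lra|].
    assert (0 <= K / r * (r1 / r) ^ n)%R.
    { apply Rmult_le_pos; [apply Rdiv_le_0_compat; lra|apply pow_le; lra]. }
    nra.
  - apply (ex_series_scal_l (V := R_NormedModule)), ex_series_sq_geom, Hq.
  - exists l. exact Hl.
Qed.

Definition dsum (c : nat -> C) (z : C) : C := Csum (fun n => dcoef c n * z ^ n).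

Lemma pser_dsum (c : nat -> C) (rho : R) (F : C -> C) :
  pser c rho F -> pser (dcoef c) rho (dsum c).
Proof.
  intros H z Hz. apply Csum_correct. exact (pser_deriv_converges c rho F z H Hz).
Qed.

(** The second-order remainders of the single terms, summed against the majorant (n+1)^2 (r1/r)^n,
    leave an error of at most L |h|^2. *)
Lemma pser_Cderiv (c : nat -> C) (rho : R) (F : C -> C) (z : C) :
  pser c rho F -> (Cmod z < rho)%R -> Cderiv F z (dsum c z).
Proof.
  intros H Hz. assert (Pz := Cmod_ge_0 z).
  set (r := ((2 * rho + Cmod z) / 3)%R).
  set (r1 := ((rho + Cmod z) / 2)%R).
  assert (Hr : (0 < r1 < r /\ r < rho /\ Cmod z < r1)%R) by (unfold r, r1; lra).
  destruct (pser_coef_bound c rho r F H ltac:(lra)) as [K [HK B]].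
  assert (Hq : (0 < r1 / r < 1)%R).
  { split; [apply Rdiv_lt_0_compat; lra|]. apply (Rmult_lt_reg_r r); [lra|].
    unfold Rdiv. rewrite Rmult_assoc, Rinv_l by lra. lra. }
  set (b := fun n => (INR (S n) * INR (S n) * (r1 / r) ^ n)%R).
  set (S2 := Series b).
  assert (ES := ex_series_sq_geom _ Hq). fold b in ES.
  assert (PS2 : (0 <= S2)%R).
  { apply Rle_trans with (2 := sum_n_le_Series b O (fun n => ltac:(unfold b; apply Rmult_le_pos; [apply Rmult_le_pos; apply pos_INR|apply pow_le; lra])) ES).
    rewrite sum_O. unfold b. simpl. lra. }
  set (L := (K / (r1 * r1) * S2)%R).
  assert (PL : (0 <= L)%R).
  { apply Rmult_le_pos; [apply Rdiv_le_0_compat; [lra|nra]|exact PS2]. }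
  assert (Main : forall h, (Cmod h < r1 - Cmod z)%R ->
    (Cmod (F (z + h)%C - F z - h * dsum c z) <= L * (Cmod h * Cmod h))%R).
  { intros h Hh.
    assert (Hzh : (Cmod (z + h) <= r1)%R).
    { apply Rle_trans with (1 := Cmod_triangle z h). lra. }
    assert (S0 := H (z + h) ltac:(lra)). assert (S1 := H z Hz).
    assert (SD := pser_dsum c rho F H z Hz).
    assert (SD' : Cseries (fun n => c n * (INR n * z ^ (n - 1))) (dsum c z)).
    { apply Cseries_decr_1. replace (dsum c z - c O * (INR O * z ^ (0 - 1))) with (dsum c z)
        by (simpl; ring).
      apply (Cseries_ext (fun n => dcoef c n * z ^ n)); [|exact SD].
      intros n. unfold dcoef. replace (S n - 1)%nat with n by lia. ring. }
    assert (ST := Cseries_plus _ _ _ _ S0 (Cseries_plus _ _ _ _ (Cseries_scal (-1) _ _ S1) (Cseries_scal (- h) _ _ SD'))).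
    cbv beta in ST.
    destruct (Cseries_dominated (fun n => c n * (z + h) ^ n + (-1 * (c n * z ^ n) + - h * (c n * (INR n * z ^ (n - 1)))))
      (fun n => (K / (r1 * r1) * (Cmod h * Cmod h)) * b n)%R) as [l [Hl Bl]].
    - intros n.
      replace (c n * (z + h) ^ n + (-1 * (c n * z ^ n) + - h * (c n * (INR n * z ^ (n - 1)))))
        with (c n * ((z + h) ^ n - z ^ n - h * (INR n * z ^ (n - 1)))) by ring.
      rewrite Cmod_mult.
      assert (T := Cpow_taylor_bound z h r1 n ltac:(lra) ltac:(lra) Hzh).
      set (e := Cmod ((z + h) ^ n - z ^ n - h * (INR n * z ^ (n - 1)))) in *.
      assert (Pe : (0 <= e)%R) by apply Cmod_ge_0.
      assert (Ph := Cmod_ge_0 h).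
      assert (Hc : (Cmod (c n) <= K / r ^ n)%R).
      { apply (Rmult_le_reg_r (r ^ n)); [apply pow_lt; lra|].
        unfold Rdiv. rewrite Rmult_assoc, Rinv_l by (apply pow_nonzero; lra).
        specialize (B n). lra. }
      assert (He : (e <= INR n * INR n * r1 ^ n * (Cmod h * Cmod h) / (r1 * r1))%R).
      { apply (Rmult_le_reg_r (r1 * r1)); [nra|].
        unfold Rdiv. rewrite Rmult_assoc, Rinv_l by nra. lra. }
      apply Rle_trans with (K / r ^ n * (INR n * INR n * r1 ^ n * (Cmod h * Cmod h) / (r1 * r1)))%R.
      { apply Rmult_le_compat; [apply Cmod_ge_0|exact Pe|exact Hc|exact He]. }
      unfold b.
      assert (E : (K / r ^ n * (INR n * INR n * r1 ^ n * (Cmod h * Cmod h) / (r1 * r1))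
        = (K / (r1 * r1) * (Cmod h * Cmod h)) * (INR n * INR n * (r1 / r) ^ n))%R).
      { unfold Rdiv. rewrite Rpow_mult_distr, pow_inv. field. repeat split; first [lra|apply pow_nonzero; lra]. }
      rewrite E. apply Rmult_le_compat_l.
      { apply Rmult_le_pos; [apply Rdiv_le_0_compat; [lra|apply Rmult_lt_0_compat; lra]|apply Rmult_le_pos; lra]. }
      apply Rmult_le_compat_r; [apply pow_le; lra|].
      rewrite S_INR. assert (P := pos_INR n). nra.
    - apply (ex_series_scal_l (V := R_NormedModule)), ES.
    - rewrite (Cseries_unique _ _ _ Hl ST) in Bl.
      rewrite Series_scal_l in Bl. fold S2 in Bl.
      replace (F (z + h) - F z - h * dsum c z) with (F (z + h) + (-1 * F z + - h * dsum c z)) by ring.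
      apply Rle_trans with (1 := Bl). unfold L. right. ring. }
  apply Cderiv_eps. intros eps He.
  (* For |h| < eps/(L+1) the quadratic error L |h|^2 is at most eps |h|; the summand 1 covers L =
     0. *)
  exists (Rmin (r1 - Cmod z) (eps / (L + 1))).
  split; [apply Rmin_glb_lt; [lra|apply Rdiv_lt_0_compat; lra]|].
  intros w Hw. specialize (Main (w - z) (Rlt_le_trans _ _ _ Hw (Rmin_l _ _))).
  replace (z + (w - z)) with w in Main by ring.
  apply Rle_trans with (1 := Main). rewrite <- Rmult_assoc.
  apply Rmult_le_compat_r; [apply Cmod_ge_0|].
  assert (Hw2 := Rlt_le_trans _ _ _ Hw (Rmin_r _ _)).
  assert (Pw := Cmod_ge_0 (w - z)).
  apply Rle_trans with ((L + 1) * (eps / (L + 1)))%R; [|right; field; lra].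
  apply Rmult_le_compat; lra.
Qed.

Lemma pser_Csmooth (c : nat -> C) (rho : R) (F : C -> C) (z : C) :
  pser c rho F -> (Cmod z < rho)%R -> Csmooth F (dsum c) z.
Proof.
  intros H Hz. split; [exact (pser_Cderiv c rho F z H Hz)|].
  apply (Cderiv_cont _ _ (dsum (dcoef c) z)).
  apply (pser_Cderiv (dcoef c) rho); [exact (pser_dsum c rho F H)|exact Hz].
Qed.

Lemma pser_at_0 (c : nat -> C) (rho : R) (F : C -> C) :
  pser c rho F -> (0 < rho)%R -> F 0 = c O.
Proof.
  intros H Hr. apply (Cseries_unique (fun n => c n * 0 ^ n)).
  - apply H. rewrite Cmod_0. exact Hr.
  - apply Cseries_first; intros; simpl; ring.
Qed.

(** * Uniqueness of power series coefficients *)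

Definition zeros_near_0 (F : C -> C) : Prop :=
  forall d, (0 < d)%R -> exists z : C, z <> 0 /\ (Cmod z < d)%R /\ F z = 0.

Lemma zeros_near_0_value (F : C -> C) : Ccont F 0 -> zeros_near_0 F -> F 0 = 0.
Proof.
  intros HC HZ. destruct (Ceq_dec (F 0) 0) as [E|N]; [exact E|exfalso].
  assert (P : (0 < Cmod (F 0))%R) by (apply Cmod_gt_0, N).
  destruct (proj1 (Ccont_eps _ _) HC _ P) as [d [Hd K]].
  destruct (HZ d Hd) as [z [_ [Hz E]]].
  specialize (K z). rewrite E in K.
  replace (z - 0) with z in K by ring. replace (0 - F 0) with (- F 0) in K by ring.
  rewrite Cmod_opp in K. specialize (K Hz). lra.
Qed.

(** The zeros differ from 0, so they survive division by z. Once the constant coefficient is known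
    to vanish, F z / z, completed by c 1 at 0, has the shifted coefficients; the induction therefore
    runs over all series at once. *)
Lemma pser_zeros_coef (n : nat) : forall (c : nat -> C) (rho : R) (F : C -> C),
  (0 < rho)%R -> pser c rho F -> zeros_near_0 F -> c n = 0.
Proof.
  assert (H0 : forall (c : nat -> C) (rho : R) (F : C -> C),
    (0 < rho)%R -> pser c rho F -> zeros_near_0 F -> c O = 0).
  { intros c rho F Hr H HZ. rewrite <- (pser_at_0 c rho F H Hr).
    apply zeros_near_0_value; [|exact HZ].
    apply (Cderiv_cont _ _ (dsum c 0)), (pser_Cderiv c rho F); [exact H|rewrite Cmod_0; exact Hr]. }
  induction n as [|n IH]; intros c rho F Hr H HZ; [exact (H0 c rho F Hr H HZ)|].
  apply (IH (fun n => c (S n)) rho (fun z => if Ceq_dec z 0 then c 1%nat else F z / z) Hr).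
  - intros z Hz. destruct (Ceq_dec z 0) as [->|Nz].
    + apply Cseries_first; [|intros k]; simpl; ring.
    + assert (S1 := Cseries_scal (/ z) _ _ (Cseries_incr_1 _ _ (H z Hz))).
      cbv beta in S1. rewrite (H0 c rho F Hr H HZ) in S1.
      replace (F z / z) with (/ z * (F z - 0 * z ^ 0)) by (field; exact Nz).
      apply (Cseries_ext (fun n => / z * (c (S n) * z ^ S n))); [|exact S1].
      intros k. simpl. field. exact Nz.
  - intros d Hd. destruct (HZ d Hd) as [z [Nz [Hz E]]]. exists z.
    split; [exact Nz|split; [exact Hz|]].
    destruct (Ceq_dec z 0) as [E0|_]; [contradiction|]. rewrite E. field. exact Nz.
Qed.

Lemma pser_plus (c c' : nat -> C) (rho : R) (F F' : C -> C) :
  pser c rho F -> pser c' rho F' -> pser (fun n => c n + c' n) rho (fun z => F z + F' z).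
Proof.
  intros H H' z Hz. apply (Cseries_ext (fun n => c n * z ^ n + c' n * z ^ n)).
  - intros n. ring.
  - apply Cseries_plus; [apply H|apply H']; exact Hz.
Qed.

Lemma pser_scal (k : C) (c : nat -> C) (rho : R) (F : C -> C) :
  pser c rho F -> pser (fun n => k * c n) rho (fun z => k * F z).
Proof.
  intros H z Hz. apply (Cseries_ext (fun n => k * (c n * z ^ n))).
  - intros n. ring.
  - apply Cseries_scal, H, Hz.
Qed.

Definition shift1 (c : nat -> C) (n : nat) : C :=
  match n with O => 0 | S n => c n end.

Lemma pser_mulX (c : nat -> C) (rho : R) (F : C -> C) :
  pser c rho F -> pser (shift1 c) rho (fun z => z * F z).
Proof.
  intros H z Hz. apply Cseries_decr_1.
  replace (z * F z - shift1 c O * z ^ 0) with (z * F z) by (simpl; ring).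
  apply (Cseries_ext (fun n => z * (c n * z ^ n))).
  - intros n. simpl. ring.
  - apply Cseries_scal, H, Hz.
Qed.

Lemma pser_ext (c c' : nat -> C) (rho : R) (F F' : C -> C) :
  (forall n, c n = c' n) -> (forall z, (Cmod z < rho)%R -> F z = F' z) ->
  pser c rho F -> pser c' rho F'.
Proof.
  intros Ec EF H z Hz. rewrite <- (EF z Hz).
  apply (Cseries_ext (fun n => c n * z ^ n)); [intros n; rewrite Ec; reflexivity|exact (H z Hz)].
Qed.

Lemma pser_shrink (c : nat -> C) (rho rho' : R) (F : C -> C) :
  (rho' <= rho)%R -> pser c rho F -> pser c rho' F.
Proof. intros Hr H z Hz. apply H. lra. Qed.

(** The difference F - F is a power series that vanishes everywhere, in particular at points
    accumulating at 0. *)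
Lemma pser_unique (c c' : nat -> C) (rho : R) (F : C -> C) :
  (0 < rho)%R -> pser c rho F -> pser c' rho F -> forall n, c n = c' n.
Proof.
  intros Hr H H' n.
  assert (E : c n + -1 * c' n = 0).
  { apply (pser_zeros_coef n (fun n => c n + -1 * c' n) rho (fun z => F z + -1 * F z) Hr).
    - apply (pser_plus c (fun n => -1 * c' n) rho F (fun z => -1 * F z)); [exact H|].
      apply pser_scal, H'.
    - intros d Hd. exists (RtoC (d / 2)). split; [|split].
      + intros E. apply RtoC_inj in E. lra.
      + rewrite Cmod_R, Rabs_pos_eq by lra. lra.
      + ring. }
  replace (c n) with (c n + -1 * c' n + c' n) by ring. rewrite E. ring.
Qed.

Lemma pser_const (k : C) (rho : R) :
  pser (fun n => match n with O => k | S _ => 0 end) rho (fun _ => k).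
Proof. intros z _. apply Cseries_first; intros; simpl; ring. Qed.

(** Lets a differential equation for F be read as a recurrence for its coefficients. *)
Lemma pser_deriv (c : nat -> C) (rho : R) (F F' : C -> C) :
  pser c rho F -> (forall z, (Cmod z < rho)%R -> Cderiv F z (F' z)) ->
  pser (dcoef c) rho F'.
Proof.
  intros H HD. apply (pser_ext (dcoef c) _ rho (dsum c)); [reflexivity| |apply (pser_dsum c rho F H)].
  intros z Hz. apply (Cderiv_unique F z); [exact (pser_Cderiv c rho F z H Hz)|exact (HD z Hz)].
Qed.

(** The action of the Euler operator z d/dz on coefficients. *)
Lemma shift1_dcoef (c : nat -> C) (n : nat) : shift1 (dcoef c) n = INR n * c n.
Proof. destruct n as [|n]; simpl shift1; [simpl; ring|reflexivity]. Qed.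

(** * Identity theorem in the slit plane *)

Lemma analytic_at_pser (F : C -> C) (z0 : C) :
  analytic_at F z0 <-> exists c rho, (0 < rho)%R /\ pser c rho (fun h => F (z0 + h)).
Proof.
  assert (P : forall (h : C) n, pow_n (K := C_Ring) h n = h ^ n).
  { intros h n. induction n as [|n IH]; [reflexivity|]. simpl. rewrite IH. reflexivity. }
  split.
  - intros [c [rho [Hr H]]]. exists c, rho. split; [exact Hr|]. intros h Hh.
    specialize (H (z0 + h)). replace (z0 + h - z0) with h in H by ring.
    specialize (H Hh).
    apply (Cseries_ext (fun n => scal (pow_n (K := C_Ring) h n) (c n))); [|exact H].
    intros n. rewrite P. apply Cmult_comm.
  - intros [c [rho [Hr H]]]. exists c, rho. split; [exact Hr|]. intros z Hz.
    specialize (H (z - z0) Hz). cbv beta in H.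
    replace (z0 + (z - z0)) with z in H by ring.
    apply (Cseries_ext (fun n => c n * (z - z0) ^ n)); [|exact H].
    intros n. rewrite <- P. apply Cmult_comm.
Qed.

(** Star-shapedness about 0: if t z lies on the cut with 0 < t <= 1, then so does z. *)
Lemma slit_segment (z : C) (t : R) :
  slit_plane z -> (0 <= t <= 1)%R -> slit_plane (RtoC t * z).
Proof.
  intros Hz Ht [H1 H2]. rewrite im_scal_l in H1. rewrite re_scal_l in H2.
  apply Hz. destruct (Rmult_integral _ _ H1) as [E|E]; [subst t; lra|].
  split; [exact E|].
  apply Rnot_lt_le. intros L. assert (t * Re z <= 1 * Re z \/ Re z <= 0)%R; [|nra].
  destruct (Rle_dec (Re z) 0); [right; assumption|left; apply Rmult_le_compat_r; lra].
Qed.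

Lemma analytic_slit_unique (F G : C -> C) (d : R) :
  (0 < d)%R ->
  (forall z, slit_plane z -> analytic_at F z) -> (forall z, slit_plane z -> analytic_at G z) ->
  (forall z, (Cmod z < d)%R -> F z = G z) ->
  forall z, slit_plane z -> F z = G z.
Proof.
  intros Hd HF HG E0 z Hz.
  destruct (Ceq_dec z 0) as [->|Nz]; [apply E0; rewrite Cmod_0; exact Hd|].
  assert (Pz : (0 < Cmod z)%R) by (apply Cmod_gt_0, Nz).
  (* By uniqueness of power series coefficients, agreement accumulating at a point
     of the segment spreads to a neighbourhood of that point. *)
  assert (Loc : forall t, (0 <= t <= 1)%R ->
    (forall e, (0 < e)%R -> exists s, s <> t /\ (Rabs (s - t) < e)%R /\ F (RtoC s * z) = G (RtoC s * z)) ->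
    exists e, (0 < e)%R /\ forall s, (Rabs (s - t) < e)%R -> F (RtoC s * z) = G (RtoC s * z)).
  { intros t Ht Acc.
    assert (St := slit_segment z t Hz Ht).
    destruct (proj1 (analytic_at_pser _ _) (HF _ St)) as [c [r [Hr HP]]].
    destruct (proj1 (analytic_at_pser _ _) (HG _ St)) as [c' [r' [Hr' HP']]].
    set (q := Rmin r r'). assert (Hq : (0 < q)%R) by (apply Rmin_glb_lt; assumption).
    assert (HD := pser_plus _ _ q _ _ (pser_shrink _ r q _ (Rmin_l _ _) HP)
      (pser_scal (-1) _ _ _ (pser_shrink _ r' q _ (Rmin_r _ _) HP'))).
    cbv beta in HD.
    assert (Mod : forall s, Cmod ((RtoC s - RtoC t) * z) = (Rabs (s - t) * Cmod z)%R).
    { intros s. rewrite Cmod_mult, <- RtoC_minus, Cmod_R. reflexivity. }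
    assert (Eq0 := fun n => pser_zeros_coef n _ q _ Hq HD). cbv beta in Eq0.
    assert (Z : zeros_near_0 (fun h => F (RtoC t * z + h) + -1 * G (RtoC t * z + h))).
    { intros e He. destruct (Acc (e / Cmod z)%R ltac:(apply Rdiv_lt_0_compat; lra)) as [s [Ns [Hs E]]].
      exists ((RtoC s - RtoC t) * z). split; [|split].
      - apply Cmult_neq_0; [|exact Nz]. apply Cminus_eq_contra. intros X. apply Ns, RtoC_inj, X.
      - rewrite Mod. apply (Rmult_lt_reg_r (/ Cmod z)); [apply Rinv_0_lt_compat, Pz|].
        rewrite Rmult_assoc, Rinv_r by lra. rewrite Rmult_1_r. exact Hs.
      - replace (RtoC t * z + (RtoC s - RtoC t) * z) with (RtoC s * z) by ring. rewrite E. ring. }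
    exists (q / Cmod z)%R. split; [apply Rdiv_lt_0_compat; lra|].
    intros s Hs.
    assert (Hm : (Cmod ((RtoC s - RtoC t) * z) < q)%R).
    { rewrite Mod. apply (Rmult_lt_reg_r (/ Cmod z)); [apply Rinv_0_lt_compat, Pz|].
      rewrite Rmult_assoc, Rinv_r by lra. rewrite Rmult_1_r. exact Hs. }
    assert (V := Cseries_unique _ _ _ (HD _ Hm)
      (Cseries_ext (fun _ => RtoC 0) _ _ (fun n => eq_sym (eq_trans (f_equal (fun u => u * _) (Eq0 n Z)) (Cmult_0_l _))) Cseries_zero)).
    cbv beta in V. replace (RtoC t * z + (RtoC s - RtoC t) * z) with (RtoC s * z) in V by ring.
    replace (F (RtoC s * z)) with (F (RtoC s * z) + -1 * G (RtoC s * z) + G (RtoC s * z)) by ring.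
    rewrite V. ring. }
  (* Continuity argument along the segment from 0 to z, with T the supremum of the parameters up to
     which F and G agree. The start [t0] is small enough for the initial piece to lie in the disc of
     radius d. *)
  set (A := fun t => (0 <= t <= 1)%R /\ forall s, (0 <= s <= t)%R -> F (RtoC s * z) = G (RtoC s * z)).
  set (t0 := Rmin 1 (d / Cmod z / 2)).
  assert (Pt : (0 < d / Cmod z)%R) by (apply Rdiv_lt_0_compat; assumption).
  assert (Ht0 : (0 < t0)%R) by (apply Rmin_glb_lt; lra).
  assert (A0 : A t0).
  { split; [split; [lra|apply Rmin_l]|]. intros s Hs. apply E0.
    rewrite Cmod_mult, Cmod_R, Rabs_pos_eq by lra.
    assert (t0 <= d / Cmod z / 2)%R by apply Rmin_r.
    apply Rle_lt_trans with (d / Cmod z / 2 * Cmod z)%R; [apply Rmult_le_compat_r; lra|].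
    replace (d / Cmod z / 2 * Cmod z)%R with (d / 2)%R by (field; lra). lra. }
  destruct (completeness A) as [T [UB LUB]].
  { exists 1%R. intros t [Ht _]. lra. }
  { exists t0. exact A0. }
  assert (HT0 : (t0 <= T)%R) by (apply UB, A0).
  assert (HT1 : (T <= 1)%R) by (apply LUB; intros t [Ht _]; lra).
  assert (Below : forall s, (0 <= s < T)%R -> F (RtoC s * z) = G (RtoC s * z)).
  { intros s Hs. apply NNPP. intros N.
    assert (T <= s)%R; [|lra]. apply LUB. intros t [Ht Ht'].
    apply Rnot_lt_le. intros L. apply N, Ht'. lra. }
  (* Points of agreement just below T accumulate at T, so [Loc] applies there and carries the
     agreement beyond T. *)
  destruct (Loc T) as [e [He HL]]; [lra| |].
  { intros e He. exists (T - Rmin (T / 2) (e / 2))%R.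
    assert (0 < Rmin (T / 2) (e / 2))%R by (apply Rmin_glb_lt; lra).
    assert (L1 := Rmin_l (T / 2) (e / 2)). assert (L2 := Rmin_r (T / 2) (e / 2)).
    split; [lra|]. split; [|apply Below; lra].
    replace (T - Rmin (T / 2) (e / 2) - T)%R with (- Rmin (T / 2) (e / 2))%R by ring.
    rewrite Rabs_Ropp, Rabs_pos_eq by lra. lra. }
  assert (Near : forall s, (0 <= s < T + e)%R -> F (RtoC s * z) = G (RtoC s * z)).
  { intros s Hs. destruct (Rlt_le_dec s T) as [L|L]; [apply Below; lra|].
    apply HL. rewrite Rabs_pos_eq; lra. }
  assert (T1 : T = 1%R).
  { apply NNPP. intros N. set (t := Rmin 1 (T + e / 2)).
    assert (L1 := Rmin_l 1 (T + e / 2)). assert (L2 := Rmin_r 1 (T + e / 2)).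
    assert (T < t)%R by (apply Rmin_glb_lt; lra).
    assert (t <= T)%R; [|lra]. apply UB. split; [unfold t in *; lra|].
    intros s Hs. apply Near. unfold t in *; lra. }
  replace z with (RtoC 1 * z) by ring. apply Near. lra.
Qed.

(** * Exponential and logarithm *)

Lemma Rabs_Re_le (z : C) : (Rabs (Re z) <= Cmod z)%R.
Proof. apply Rle_trans with (2 := Rmax_Cmod z), Rmax_l. Qed.

Lemma Rabs_Im_le (z : C) : (Rabs (Im z) <= Cmod z)%R.
Proof. apply Rle_trans with (2 := Rmax_Cmod z), Rmax_r. Qed.

Lemma Cmod_le_add (z : C) : (Cmod z <= Rabs (Re z) + Rabs (Im z))%R.
Proof.
  replace z with (RtoC (Re z) + Ci * RtoC (Im z)) at 1.
  - apply Rle_trans with (1 := Cmod_triangle _ _).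
    rewrite Cmod_mult, Cmod_Ci, !Cmod_R. lra.
  - destruct z as [x y]. apply injective_projections; simpl; ring.
Qed.

Lemma Re_minus (z w : C) : Re (z - w) = (Re z - Re w)%R.
Proof. destruct z, w; reflexivity. Qed.

Lemma Im_minus (z w : C) : Im (z - w) = (Im z - Im w)%R.
Proof. destruct z, w; reflexivity. Qed.

Lemma Ccont_2d (u v : R -> R -> R) (z : C) :
  continuity_2d_pt u (Re z) (Im z) -> continuity_2d_pt v (Re z) (Im z) ->
  Ccont (fun w => (u (Re w) (Im w), v (Re w) (Im w))) z.
Proof.
  intros Hu Hv. apply Ccont_eps. intros eps He.
  assert (He2 : (0 < eps / 2)%R) by lra.
  destruct (Hu (mkposreal _ He2)) as [d1 D1]. destruct (Hv (mkposreal _ He2)) as [d2 D2].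
  exists (Rmin d1 d2). split; [apply Rmin_glb_lt; apply cond_pos|].
  intros w Hw.
  assert (A := Rabs_Re_le (w - z)). assert (B := Rabs_Im_le (w - z)).
  rewrite Re_minus in A. rewrite Im_minus in B.
  assert (L1 := Rmin_l d1 d2). assert (L2 := Rmin_r d1 d2).
  specialize (D1 (Re w) (Im w) ltac:(lra) ltac:(lra)).
  specialize (D2 (Re w) (Im w) ltac:(lra) ltac:(lra)).
  simpl in D1, D2.
  apply Rle_lt_trans with (1 := Cmod_le_add _).
  rewrite Re_minus, Im_minus. simpl. lra.
Qed.

(** The partial derivatives (p, -q) and (q, p) satisfy the Cauchy-Riemann equations, so the real
    differential is multiplication by p + i q. Each component receives half of [eps], as the modulus
    is at most |Re| + |Im|. *)
Lemma Cderiv_cauchy_riemann (u v : R -> R -> R) (z : C) (p q : R) :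
  differentiable_pt_lim u (Re z) (Im z) p (- q) ->
  differentiable_pt_lim v (Re z) (Im z) q p ->
  Cderiv (fun w => (u (Re w) (Im w), v (Re w) (Im w))) z (p, q).
Proof.
  intros Hu Hv. apply Cderiv_eps. intros eps He.
  assert (He2 : (0 < eps / 2)%R) by lra.
  destruct (Hu (mkposreal _ He2)) as [d1 D1]. destruct (Hv (mkposreal _ He2)) as [d2 D2].
  exists (Rmin d1 d2). split; [apply Rmin_glb_lt; apply cond_pos|].
  intros w Hw.
  assert (A := Rabs_Re_le (w - z)). assert (B := Rabs_Im_le (w - z)).
  assert (M := Rmax_Cmod (w - z)). change (fst (w - z)) with (Re (w - z)) in M.
  change (snd (w - z)) with (Im (w - z)) in M.
  rewrite Re_minus in A, M. rewrite Im_minus in B, M.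
  assert (L1 := Rmin_l d1 d2). assert (L2 := Rmin_r d1 d2).
  specialize (D1 (Re w) (Im w) ltac:(lra) ltac:(lra)).
  specialize (D2 (Re w) (Im w) ltac:(lra) ltac:(lra)).
  simpl in D1, D2.
  apply Rle_trans with (1 := Cmod_le_add _).
  replace (Re ((u (Re w) (Im w), v (Re w) (Im w)) - (u (Re z) (Im z), v (Re z) (Im z)) - (w - z) * (p, q)))
    with (u (Re w) (Im w) - u (Re z) (Im z) - (p * (Re w - Re z) + - q * (Im w - Im z)))%R
    by (unfold Re, Im; simpl; ring).
  replace (Im ((u (Re w) (Im w), v (Re w) (Im w)) - (u (Re z) (Im z), v (Re z) (Im z)) - (w - z) * (p, q)))
    with (v (Re w) (Im w) - v (Re z) (Im z) - (q * (Re w - Re z) + p * (Im w - Im z)))%R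
    by (unfold Re, Im; simpl; ring).
  assert (eps / 2 * Rmax (Rabs (Re w - Re z)) (Rabs (Im w - Im z)) <= eps / 2 * Cmod (w - z))%R
    by (apply Rmult_le_compat_l; lra).
  lra.
Qed.

Lemma differentiable_pt_lim_Rmult (x y : R) : differentiable_pt_lim Rmult x y y x.
Proof.
  intros eps. exists eps. intros u v Hu Hv.
  replace (u * v - x * y - (y * (u - x) + x * (v - y)))%R with ((u - x) * (v - y))%R by ring.
  rewrite Rabs_mult. apply Rmult_le_compat; try apply Rabs_pos; [lra|apply Rmax_r].
Qed.

Lemma differentiable_pt_lim_proj2_0 (f : R -> R) (x y l : R) :
  derivable_pt_lim f y l -> differentiable_pt_lim (fun _ v => f v) x y 0 l.
Proof.
  intros H eps. destruct (differentiable_pt_lim_proj1_0 f y x l H eps) as [d D].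
  exists d. intros u v Hu Hv. specialize (D v u Hv Hu).
  rewrite Rmax_comm. replace (0 * (u - x) + l * (v - y))%R with (l * (v - y) + 0 * (u - x))%R by ring.
  exact D.
Qed.

Lemma Cexp_add (z w : C) : Cexp (z + w) = Cexp z * Cexp w.
Proof.
  unfold Cexp. rewrite re_plus, im_plus, exp_plus, cos_plus, sin_plus.
  apply injective_projections; simpl; ring.
Qed.

Lemma Cexp_0 : Cexp 0 = 1.
Proof. unfold Cexp. simpl. rewrite exp_0, cos_0, sin_0. apply injective_projections; simpl; ring. Qed.

Lemma Cexp_neq_0 (z : C) : Cexp z <> 0.
Proof.
  intros E. apply C1_nz. rewrite <- Cexp_0. replace (RtoC 0) with (z + - z) by ring.
  rewrite Cexp_add, E. ring.
Qed.

Lemma Cderiv_Cexp (z : C) : Cderiv Cexp z (Cexp z).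
Proof.
  apply (Cderiv_cauchy_riemann (fun x y => exp x * cos y)%R (fun x y => exp x * sin y)%R).
  - assert (H := differentiable_pt_lim_comp Rmult (fun x _ => exp x) (fun _ y => cos y) (Re z) (Im z) _ _ _ _ _ _
      (differentiable_pt_lim_Rmult _ _)
      (differentiable_pt_lim_proj1_0 _ _ _ _ (derivable_pt_lim_exp (Re z)))
      (differentiable_pt_lim_proj2_0 _ _ _ _ (derivable_pt_lim_cos (Im z)))).
    replace (cos (Im z) * exp (Re z) + exp (Re z) * 0)%R with (exp (Re z) * cos (Im z))%R in H by ring.
    replace (cos (Im z) * 0 + exp (Re z) * - sin (Im z))%R with (- (exp (Re z) * sin (Im z)))%R in H by ring.
    exact H.
  - assert (H := differentiable_pt_lim_comp Rmult (fun x _ => exp x) (fun _ y => sin y) (Re z) (Im z) _ _ _ _ _ _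
      (differentiable_pt_lim_Rmult _ _)
      (differentiable_pt_lim_proj1_0 _ _ _ _ (derivable_pt_lim_exp (Re z)))
      (differentiable_pt_lim_proj2_0 _ _ _ _ (derivable_pt_lim_sin (Im z)))).
    replace (sin (Im z) * exp (Re z) + exp (Re z) * 0)%R with (exp (Re z) * sin (Im z))%R in H by ring.
    replace (sin (Im z) * 0 + exp (Re z) * cos (Im z))%R with (exp (Re z) * cos (Im z))%R in H by ring.
    exact H.
Qed.

Lemma Csmooth_Cexp (z : C) : Csmooth Cexp Cexp z.
Proof. split; [|apply (Cderiv_cont _ _ (Cexp z))]; apply Cderiv_Cexp. Qed.

(** * Principal logarithm and powers *)

Definition off_cut (w : C) : Prop := ~ (Im w = 0%R /\ (Re w <= 0)%R).

Lemma slit_off_cut (z : C) : slit_plane z -> off_cut (1 - z).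
Proof.
  intros H [H1 H2]. apply H. rewrite Im_minus in H1. rewrite Re_minus in H2.
  simpl in H1, H2. split; lra.
Qed.

Lemma slit_open (z : C) : slit_plane z ->
  exists d, (0 < d)%R /\ forall w, (Cmod (w - z) < d)%R -> slit_plane w.
Proof.
  intros H. destruct (Req_dec (Im z) 0) as [E|N].
  - exists (1 - Re z)%R. assert (~ (1 <= Re z)%R) by (intros X; apply H; split; assumption).
    split; [lra|]. intros w Hw [_ X]. assert (A := Rabs_Re_le (w - z)).
    rewrite Re_minus in A. assert (B := Rle_abs (Re w - Re z)). lra.
  - exists (Rabs (Im z)). split; [apply Rabs_pos_lt, N|]. intros w Hw [X _].
    assert (A := Rabs_Im_le (w - z)). rewrite Im_minus, X in A.
    replace (0 - Im z)%R with (- Im z)%R in A by ring. rewrite Rabs_Ropp in A. lra.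
Qed.

Lemma disc_slit (z : C) : (Cmod z < 1)%R -> slit_plane z.
Proof. intros H [_ X]. assert (A := Rabs_Re_le z). assert (B := Rle_abs (Re z)). lra. Qed.

Lemma slit_neq_1 (z : C) : slit_plane z -> 1 - z <> 0.
Proof.
  intros H E. apply H. replace z with (RtoC 1) by (replace z with (1 - (1 - z)) by ring; rewrite E; ring).
  simpl. split; lra.
Qed.

Lemma slit_minus_1_neq_0 (z : C) : slit_plane z -> z - 1 <> 0.
Proof.
  intros H E. apply (slit_neq_1 z H). replace (1 - z) with (- (z - 1)) by ring. rewrite E. ring.
Qed.

Lemma off_cut_neq_0 (w : C) : off_cut w -> w <> 0.
Proof. intros H ->. apply H. simpl. split; lra. Qed.

Lemma off_cut_open (w : C) : off_cut w ->
  exists d, (0 < d)%R /\ forall w', (Cmod (w' - w) < d)%R -> off_cut w'.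
Proof.
  intros H.
  assert (S : slit_plane (1 - w)).
  { intros [A B]. rewrite Im_minus in A. rewrite Re_minus in B. simpl in A, B. apply H. split; lra. }
  destruct (slit_open _ S) as [d [Hd D]]. exists d. split; [exact Hd|].
  intros w' Hw. replace w' with (1 - (1 - w')) by ring. apply slit_off_cut, D.
  replace (1 - w' - (1 - w)) with (- (w' - w)) by ring. rewrite Cmod_opp. exact Hw.
Qed.

(** The tangent of half the argument of x + i y, from tan(t/2) = sin t / (1 + cos t). *)
Definition half_tan (x y : R) : R := (y * / (sqrt (x * x + y * y) + x))%R.

Lemma Cmod_sqr (w : C) : (Cmod w * Cmod w = Re w * Re w + Im w * Im w)%R.
Proof. assert (H := Cmod2_alt w). simpl in H. lra. Qed.

Lemma Cmod_sqrt (w : C) : Cmod w = sqrt (Re w * Re w + Im w * Im w)%R.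
Proof. unfold Cmod, Re, Im. f_equal. ring. Qed.

(** Equality |w| = - Re w would force Im w = 0 and Re w <= 0, which is the cut. *)
Lemma off_cut_denominator (w : C) : off_cut w -> (0 < Cmod w + Re w)%R.
Proof.
  intros H. assert (A := Rabs_Re_le w). assert (P := Cmod_ge_0 w).
  assert (Q := Cmod_sqr w).
  assert (B : (- Re w <= Cmod w)%R).
  { apply Rle_trans with (2 := A). rewrite <- Rabs_Ropp. apply Rle_abs. }
  destruct (Rle_lt_or_eq_dec _ _ B) as [L|E]; [lra|exfalso].
  apply H. rewrite <- E in Q. split; [nra|lra].
Qed.

(** Double-angle formulas for [atan]; the simplification rests on (|w| + Re w)^2 + (Im w)^2 = 2 |w|
    (|w| + Re w). *)
Lemma half_tan_angle (w : C) : off_cut w ->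
  let t := half_tan (Re w) (Im w) in
  cos (2 * atan t) = (Re w / Cmod w)%R /\ sin (2 * atan t) = (Im w / Cmod w)%R.
Proof.
  intros H t.
  assert (D := off_cut_denominator w H). assert (Q := Cmod_sqr w).
  assert (P : (0 < Cmod w)%R) by (apply Cmod_gt_0, off_cut_neq_0, H).
  assert (Ht : t = (Im w / (Cmod w + Re w))%R).
  { unfold t, half_tan. rewrite Cmod_sqrt. reflexivity. }
  assert (Pt : (0 < 1 + t ^ 2)%R) by nra.
  assert (C2 : (cos (atan t) * cos (atan t) = / (1 + t ^ 2))%R).
  { rewrite cos_atan. replace (1 + t²)%R with (1 + t ^ 2)%R by (unfold Rsqr; ring).
    unfold Rdiv. rewrite !Rmult_1_l, <- Rinv_mult, sqrt_sqrt by lra. reflexivity. }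
  assert (SC : (sin (atan t) = t * cos (atan t))%R).
  { rewrite sin_atan, cos_atan. unfold Rdiv. ring. }
  assert (N : ((Cmod w + Re w) ^ 2 + Im w ^ 2 = 2 * Cmod w * (Cmod w + Re w))%R) by lra.
  assert (0 < (Cmod w + Re w) ^ 2 + Im w ^ 2)%R.
  { rewrite N. apply Rmult_lt_0_compat; lra. }
  split.
  - rewrite cos_2a, SC.
    replace (cos (atan t) * cos (atan t) - t * cos (atan t) * (t * cos (atan t)))%R
      with ((1 - t ^ 2) * (cos (atan t) * cos (atan t)))%R by ring.
    rewrite C2, Ht.
    replace (/ (1 + (Im w / (Cmod w + Re w)) ^ 2))%R with ((Cmod w + Re w) ^ 2 / (2 * Cmod w * (Cmod w + Re w)))%R.
    + assert (N2 : ((Cmod w + Re w) ^ 2 - Im w ^ 2 = 2 * Re w * (Cmod w + Re w))%R) by lra.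
      replace ((1 - (Im w / (Cmod w + Re w)) ^ 2) * ((Cmod w + Re w) ^ 2 / (2 * Cmod w * (Cmod w + Re w))))%R
        with (((Cmod w + Re w) ^ 2 - Im w ^ 2) / (2 * Cmod w * (Cmod w + Re w)))%R by (field; lra).
      rewrite N2. field. lra.
    + rewrite <- N. field. split; lra.
  - rewrite sin_2a, SC.
    replace (2 * (t * cos (atan t)) * cos (atan t))%R with (2 * t * (cos (atan t) * cos (atan t)))%R by ring.
    rewrite C2, Ht.
    replace (/ (1 + (Im w / (Cmod w + Re w)) ^ 2))%R with ((Cmod w + Re w) ^ 2 / (2 * Cmod w * (Cmod w + Re w)))%R.
    + field. split; lra.
    + rewrite <- N. field. split; lra.
Qed.

(* The half-angle form has no case distinction on the sign of [Im w], hence is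
   visibly continuous off the cut. *)
Lemma Carg_half_tan (w : C) : off_cut w -> Carg w = (2 * atan (half_tan (Re w) (Im w)))%R.
Proof.
  intros H. destruct (half_tan_angle w H) as [HC HS].
  set (t := half_tan (Re w) (Im w)) in *.
  assert (B := atan_bound t).
  assert (D := off_cut_denominator w H).
  assert (Ht : t = (Im w / (Cmod w + Re w))%R).
  { unfold t, half_tan. rewrite Cmod_sqrt. reflexivity. }
  unfold Carg. rewrite <- HC. destruct (Rlt_dec (Im w) 0) as [L|L].
  - assert (t < 0)%R.
    { rewrite Ht. apply Ropp_lt_cancel. rewrite Ropp_0, <- Rdiv_opp_l. apply Rdiv_lt_0_compat; lra. }
    assert (atan t < 0)%R by (rewrite <- atan_0; apply atan_increasing; assumption).
    rewrite <- cos_neg, acos_cos by lra. ring.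
  - assert (0 <= t)%R by (rewrite Ht; apply Rdiv_le_0_compat; lra).
    assert (0 <= atan t)%R.
    { rewrite <- atan_0. destruct (Req_dec t 0) as [->|N]; [lra|]. apply Rlt_le, atan_increasing. lra. }
    apply acos_cos. lra.
Qed.

Lemma Cexp_Clog (w : C) : off_cut w -> Cexp (Clog w) = w.
Proof.
  intros H. destruct (half_tan_angle w H) as [HC HS].
  assert (P : (0 < Cmod w)%R) by (apply Cmod_gt_0, off_cut_neq_0, H).
  unfold Cexp, Clog. simpl. rewrite Carg_half_tan, HC, HS, exp_ln by assumption.
  destruct w as [x y]. apply injective_projections; simpl; field; lra.
Qed.

Lemma Clog_Im_bound (w : C) : off_cut w -> (- PI < Im (Clog w) < PI)%R.
Proof.
  intros H. simpl. rewrite Carg_half_tan by exact H.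
  assert (B := atan_bound (half_tan (Re w) (Im w))). lra.
Qed.

Lemma Ccont_ext_loc (f g : C -> C) (z : C) (d : R) :
  (0 < d)%R -> (forall w, (Cmod (w - z) < d)%R -> f w = g w) -> Ccont f z -> Ccont g z.
Proof.
  intros Hd E H. apply Ccont_eps. intros eps He.
  destruct (proj1 (Ccont_eps _ _) H eps He) as [e [Pe K]].
  exists (Rmin d e). split; [apply Rmin_glb_lt; assumption|]. intros w Hw.
  rewrite <- !E.
  - apply K, Rlt_le_trans with (1 := Hw), Rmin_r.
  - replace (z - z) with (RtoC 0) by ring. rewrite Cmod_0. exact Hd.
  - apply Rlt_le_trans with (1 := Hw), Rmin_l.
Qed.

Lemma Ccont_Clog (w : C) : off_cut w -> Ccont Clog w.
Proof.
  intros H. destruct (off_cut_open w H) as [d [Hd D]].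
  apply (Ccont_ext_loc (fun w => (ln (sqrt (Re w * Re w + Im w * Im w)), 2 * atan (half_tan (Re w) (Im w)))%R) _ w d Hd).
  { intros w' Hw. unfold Clog. rewrite Cmod_sqrt, Carg_half_tan by (apply D, Hw). reflexivity. }
  assert (P : (0 < Cmod w)%R) by (apply Cmod_gt_0, off_cut_neq_0, H).
  assert (P2 : (0 < Re w * Re w + Im w * Im w)%R) by (rewrite <- Cmod_sqr; apply Rmult_lt_0_compat; assumption).
  assert (X : continuity_2d_pt (fun x y => x * x + y * y)%R (Re w) (Im w)).
  { apply continuity_2d_pt_plus; apply continuity_2d_pt_mult;
      first [apply continuity_2d_pt_id1|apply continuity_2d_pt_id2]. }
  assert (S : continuity_2d_pt (fun x y => sqrt (x * x + y * y))%R (Re w) (Im w)).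
  { apply (continuity_1d_2d_pt_comp sqrt (fun x y => x * x + y * y)%R); [|exact X].
    apply continuity_pt_sqrt. lra. }
  apply (Ccont_2d (fun x y => ln (sqrt (x * x + y * y))) (fun x y => 2 * atan (half_tan x y))%R).
  - apply (continuity_1d_2d_pt_comp ln (fun x y => sqrt (x * x + y * y))%R); [|exact S].
    apply derivable_continuous_pt. exists (/ sqrt (Re w * Re w + Im w * Im w))%R.
    apply derivable_pt_lim_ln. apply sqrt_lt_R0, P2.
  - apply continuity_2d_pt_mult; [apply continuity_2d_pt_const|].
    apply (continuity_1d_2d_pt_comp atan half_tan).
    { apply derivable_continuous_pt, derivable_pt_atan. }
    apply continuity_2d_pt_mult; [apply continuity_2d_pt_id2|].
    apply continuity_2d_pt_inv.
    + apply continuity_2d_pt_plus; [exact S|apply continuity_2d_pt_id1].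
    + rewrite <- Cmod_sqrt. assert (Y := off_cut_denominator w H). lra.
Qed.

(** The converse direction of Caratheodory's criterion, needed to invert [Cexp]. *)
Lemma Cderiv_slope (f : C -> C) (z l : C) : Cderiv f z l ->
  Ccont (fun w => if Ceq_dec w z then l else (f w - f z) / (w - z)) z.
Proof.
  intros H. apply Ccont_eps. intros eps He.
  destruct (proj1 (Cderiv_eps _ _ _) H (eps / 2)%R ltac:(lra)) as [d [Hd D]].
  exists d. split; [exact Hd|]. intros w Hw.
  destruct (Ceq_dec z z) as [_|N]; [|contradiction].
  destruct (Ceq_dec w z) as [E|N].
  - replace (l - l) with (RtoC 0) by ring. rewrite Cmod_0. exact He.
  - assert (Nz := Cminus_eq_contra _ _ N).
    replace ((f w - f z) / (w - z) - l) with ((f w - f z - (w - z) * l) / (w - z)) by (field; exact Nz).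
    assert (P : (0 < Cmod (w - z))%R) by (apply Cmod_gt_0, Nz).
    rewrite Cmod_div by exact Nz. specialize (D w Hw).
    apply (Rmult_lt_reg_r (Cmod (w - z))); [exact P|].
    unfold Rdiv. rewrite Rmult_assoc, Rinv_l by lra. nra.
Qed.

(** Inverse function argument: if p is the slope function of [Cexp] at [Clog w], then the increment
    of [Clog] from w to w' is w' - w divided by p at [Clog w'], and continuity of [Clog] makes this
    divisor continuous. *)
Lemma Cderiv_Clog (w : C) : off_cut w -> Cderiv Clog w (/ w).
Proof.
  intros H.
  assert (CL := Ccont_Clog w H).
  assert (SL := Cderiv_slope _ _ _ (Cderiv_Cexp (Clog w))).
  set (p := fun l => if Ceq_dec l (Clog w) then Cexp (Clog w) else (Cexp l - Cexp (Clog w)) / (l - Clog w)) in SL.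
  assert (Pw : p (Clog w) = w).
  { unfold p. destruct (Ceq_dec _ _) as [_|N]; [apply Cexp_Clog, H|contradiction]. }
  assert (X : Ccont (fun w' => / p (Clog w')) w).
  { apply (Ccont_inv (fun w' => p (Clog w'))).
    - rewrite Pw. apply off_cut_neq_0, H.
    - apply (Ccont_comp p Clog); assumption. }
  rewrite <- Pw at 2.
  apply (Cderiv_caratheodory Clog (fun w' => / p (Clog w')) w); [|exact X].
  destruct (off_cut_open w H) as [d [Hd D]]. exists d. split; [exact Hd|]. intros w' Hw.
  unfold p. destruct (Ceq_dec (Clog w') (Clog w)) as [E|N].
  - rewrite E. assert (E' : w' = w).
    { rewrite <- (Cexp_Clog w' (D _ Hw)), <- (Cexp_Clog w H), E. reflexivity. }
    rewrite E'. ring.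
  - rewrite !Cexp_Clog by (first [exact H|apply D, Hw]).
    assert (w' - w <> 0).
    { apply Cminus_eq_contra. intros E. apply N. rewrite E. reflexivity. }
    assert (Clog w' - Clog w <> 0) by (apply Cminus_eq_contra, N).
    field. split; assumption.
Qed.

Lemma Csmooth_Clog (w : C) : off_cut w -> Csmooth Clog Cinv w.
Proof.
  intros H. split; [apply Cderiv_Clog, H|apply Ccont_inv_id, off_cut_neq_0, H].
Qed.

Lemma Cpower_add (w a b : C) : Cpower w (a + b) = Cpower w a * Cpower w b.
Proof. unfold Cpower. rewrite <- Cexp_add. f_equal. ring. Qed.

Lemma Cpower_0 (w : C) : Cpower w 0 = 1.
Proof. unfold Cpower. rewrite <- Cexp_0. f_equal. ring. Qed.

Lemma Cpower_neq_0 (w a : C) : Cpower w a <> 0.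
Proof. apply Cexp_neq_0. Qed.

Lemma Cpower_1 (w : C) : off_cut w -> Cpower w 1 = w.
Proof. intros H. unfold Cpower. rewrite Cmult_1_l. apply Cexp_Clog, H. Qed.

Lemma Cpower_INR (w : C) (n : nat) : off_cut w -> Cpower w (INR n) = w ^ n.
Proof.
  intros H. induction n as [|n IH].
  - apply Cpower_0.
  - rewrite S_INR, RtoC_plus, Cpower_add, IH, Cpower_1 by exact H. simpl. ring.
Qed.

Lemma Cpower_one_base (a : C) : Cpower 1 a = 1.
Proof.
  unfold Cpower, Clog. assert (O : off_cut 1) by (intros [_ X]; simpl in X; lra).
  rewrite Carg_half_tan by exact O. rewrite Cmod_1, ln_1.
  unfold half_tan. simpl. rewrite Rmult_0_l, atan_0, Rmult_0_r.
  replace (a * (0%R, 0%R)) with (RtoC 0); [apply Cexp_0|].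
  apply injective_projections; simpl; ring.
Qed.

Lemma Csmooth_Cpower (w a : C) : off_cut w ->
  Csmooth (fun w => Cpower w a) (fun w => a * / w * Cpower w a) w.
Proof.
  intros H.
  refine (Csmooth_ext _ _ _ _ _ (fun w => eq_refl (Cpower w a)) _
    (Csmooth_comp Cexp Cexp (fun w => a * Clog w) (fun w => 0 * Clog w + a * / w) w
      (Csmooth_Cexp _) (Csmooth_mult _ _ _ _ _ (Csmooth_const a w) (Csmooth_Clog w H)))).
  intros v. unfold Cpower. ring.
Qed.

(** Halving the logarithm confines its imaginary part to (-PI/2, PI/2), where the cosine is
    positive. *)
Lemma Re_sqrt_pos (w : C) : off_cut w -> (0 < Re (Cpower w (RtoC (/ 2))))%R.
Proof.
  intros H. unfold Cpower, Cexp. simpl. apply Rmult_lt_0_compat; [apply exp_pos|].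
  assert (B := Clog_Im_bound w H). simpl in B.
  apply cos_gt_0; lra.
Qed.

Lemma sqrt_sqr (w : C) : off_cut w -> Cpower w (RtoC (/ 2)) * Cpower w (RtoC (/ 2)) = w.
Proof.
  intros H. rewrite <- Cpower_add. rewrite <- RtoC_plus.
  replace (/ 2 + / 2)%R with 1%R by field. apply Cpower_1, H.
Qed.

(** * Cauchy's formula *)

Lemma Ccont_Re (z : C) : Ccont (fun w => RtoC (Re w)) z.
Proof.
  apply (Ccont_2d (fun x _ => x) (fun _ _ => 0%R)); [apply continuity_2d_pt_id1|apply continuity_2d_pt_const].
Qed.

Lemma Ccont_Im (z : C) : Ccont (fun w => RtoC (Im w)) z.
Proof.
  apply (Ccont_2d (fun _ y => y) (fun _ _ => 0%R)); [apply continuity_2d_pt_id2|apply continuity_2d_pt_const].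
Qed.

Lemma Ccont_continuity_2d_Re (F : C -> C) (x y : R) :
  Ccont F (x, y) -> continuity_2d_pt (fun u v => Re (F (u, v))) x y.
Proof.
  intros H eps. destruct (proj1 (Ccont_eps _ _) H eps (cond_pos eps)) as [d [Hd K]].
  assert (Hd2 : (0 < d / 2)%R) by lra.
  exists (mkposreal _ Hd2). simpl. intros u v Hu Hv.
  rewrite <- Re_minus. apply Rle_lt_trans with (1 := Rabs_Re_le _), K.
  apply Rle_lt_trans with (1 := Cmod_le_add _). rewrite Re_minus, Im_minus. simpl. lra.
Qed.

Lemma Ccont_continuous_Re (F : C -> C) (t : R) :
  Ccont F (RtoC t) -> continuous (fun s => Re (F (RtoC s))) t.
Proof.
  intros H. apply continuity_pt_filterlim. intros eps He.
  destruct (proj1 (Ccont_eps _ _) H eps He) as [d [Hd K]].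
  exists d. split; [exact Hd|]. intros s [_ Hs]. unfold Rdist in *. simpl in Hs |- *.
  unfold Rdist in *. rewrite <- Re_minus. apply Rle_lt_trans with (1 := Rabs_Re_le _), K.
  rewrite <- RtoC_minus, Cmod_R. exact Hs.
Qed.

Lemma Cderiv_is_derive_Re (F : C -> C) (t : R) (l : C) :
  Cderiv F (RtoC t) l -> is_derive (fun s => Re (F (RtoC s))) t (Re l).
Proof.
  intros H. apply is_derive_Reals. intros eps He.
  destruct (proj1 (Cderiv_eps _ _ _) H (eps / 2)%R ltac:(lra)) as [d [Hd K]].
  exists (mkposreal d Hd). intros h Nh Hh. simpl in Hh.
  specialize (K (RtoC (t + h))).
  replace (RtoC (t + h) - RtoC t) with (RtoC h) in K by (rewrite RtoC_plus; ring).
  rewrite Cmod_R in K. specialize (K Hh).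
  assert (P : (0 < Rabs h)%R) by (apply Rabs_pos_lt, Nh).
  replace ((Re (F (RtoC (t + h))) - Re (F (RtoC t))) / h - Re l)%R
    with (Re (F (RtoC (t + h)) - F (RtoC t) - RtoC h * l) / h)%R
    by (rewrite !Re_minus, re_scal_l; field; exact Nh).
  unfold Rdiv. rewrite Rabs_mult, Rabs_inv.
  apply (Rmult_lt_reg_r (Rabs h)); [exact P|]. rewrite Rmult_assoc, Rinv_l by lra.
  assert (A := Rabs_Re_le (F (RtoC (t + h)) - F (RtoC t) - RtoC h * l)). nra.
Qed.

(* Integral over [0, 2 pi] of a function given on the complex plane, of which
   only the restriction to the real line matters. *)
Definition period_int_Re (G : C -> C) : R := RInt (fun t => Re (G (RtoC t))) 0 (2 * PI).

(** The imaginary part is obtained as the real part of -i G, so that every fact about the real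
    integral serves both components. *)
Definition period_int (G : C -> C) : C := (period_int_Re G, period_int_Re (fun t => - Ci * G t)).

Definition cont_on_reals (G : C -> C) : Prop := forall t : R, Ccont G (RtoC t).

Lemma two_PI_pos : (0 < 2 * PI)%R.
Proof. assert (H := PI_RGT_0). lra. Qed.

Lemma period_int_Re_ex (G : C -> C) : cont_on_reals G ->
  ex_RInt (fun t => Re (G (RtoC t))) 0 (2 * PI).
Proof.
  intros H. apply (ex_RInt_continuous (V := R_CompleteNormedModule)). intros t _.
  apply Ccont_continuous_Re, H.
Qed.

Lemma period_int_Re_ext (G H : C -> C) : (forall t : R, G (RtoC t) = H (RtoC t)) ->
  period_int_Re G = period_int_Re H.
Proof. intros E. apply RInt_ext. intros t _. rewrite E. reflexivity. Qed.

Lemma period_int_ext (G H : C -> C) : (forall t : R, G (RtoC t) = H (RtoC t)) ->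
  period_int G = period_int H.
Proof.
  intros E. unfold period_int. f_equal; apply period_int_Re_ext; [exact E|].
  intros t. rewrite E. reflexivity.
Qed.

Lemma period_int_Re_plus (G H : C -> C) : cont_on_reals G -> cont_on_reals H ->
  period_int_Re (fun t => G t + H t) = (period_int_Re G + period_int_Re H)%R.
Proof.
  intros HG HH. unfold period_int_Re.
  rewrite <- (RInt_plus (V := R_CompleteNormedModule)) by (apply period_int_Re_ex; assumption).
  apply RInt_ext. intros t _. apply re_plus.
Qed.

Lemma cont_on_reals_scal (c : C) (G : C -> C) : cont_on_reals G -> cont_on_reals (fun t => c * G t).
Proof. intros H t. apply Ccont_mult; [apply Ccont_const|apply H]. Qed.

Lemma period_int_plus (G H : C -> C) : cont_on_reals G -> cont_on_reals H ->
  period_int (fun t => G t + H t) = period_int G + period_int H.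
Proof.
  intros HG HH. unfold period_int. rewrite period_int_Re_plus by assumption.
  rewrite (period_int_Re_ext (fun t => - Ci * (G t + H t)) (fun t => - Ci * G t + - Ci * H t))
    by (intros t; ring).
  rewrite period_int_Re_plus by (apply cont_on_reals_scal; assumption). reflexivity.
Qed.

Lemma period_int_Re_scal (x y : R) (G : C -> C) : cont_on_reals G ->
  period_int_Re (fun t => (x, y) * G t) = (x * period_int_Re G - y * period_int_Re (fun t => - Ci * G t)%C)%R.
Proof.
  intros HG. unfold period_int_Re.
  rewrite <- (RInt_scal (V := R_CompleteNormedModule)) by (apply period_int_Re_ex, HG).
  rewrite <- (RInt_scal (V := R_CompleteNormedModule)) by (apply (period_int_Re_ex (fun t => - Ci * G t)), cont_on_reals_scal, HG).
  rewrite <- (RInt_minus (V := R_CompleteNormedModule)).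
  - apply RInt_ext. intros t _. destruct (G (RtoC t)) as [p q].
    unfold scal, minus, plus, opp; simpl. unfold mult; simpl. ring.
  - apply (ex_RInt_scal (V := R_NormedModule)), period_int_Re_ex, HG.
  - apply (ex_RInt_scal (V := R_NormedModule)), (period_int_Re_ex (fun t => - Ci * G t)), cont_on_reals_scal, HG.
Qed.

Lemma period_int_scal (c : C) (G : C -> C) : cont_on_reals G ->
  period_int (fun t => c * G t) = c * period_int G.
Proof.
  intros HG. destruct c as [x y]. unfold period_int.
  rewrite period_int_Re_scal by exact HG.
  rewrite (period_int_Re_ext (fun t => - Ci * ((x, y) * G t)) (fun t => (y, - x)%R * G t)).
  - rewrite period_int_Re_scal by exact HG. apply injective_projections; simpl; ring.
  - intros t. apply injective_projections; simpl; ring.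
Qed.

Lemma period_int_const (c : C) : period_int (fun _ => c) = RtoC (2 * PI) * c.
Proof.
  unfold period_int, period_int_Re. rewrite !RInt_const.
  destruct c as [x y]. apply injective_projections; simpl; unfold scal; simpl; unfold mult; simpl; ring.
Qed.

Lemma period_int_Re_bound (G : C -> C) (K : R) : cont_on_reals G ->
  (forall t : R, (0 <= t <= 2 * PI)%R -> (Cmod (G (RtoC t)) <= K)%R) ->
  (Rabs (period_int_Re G) <= 2 * PI * K)%R.
Proof.
  intros HG B. replace (2 * PI * K)%R with ((2 * PI - 0) * K)%R by ring.
  apply abs_RInt_le_const; [apply Rlt_le, two_PI_pos|apply period_int_Re_ex, HG|].
  intros t Ht. apply Rle_trans with (1 := Rabs_Re_le _), B, Ht.
Qed.

(** The constant 4 PI instead of 2 PI comes from bounding the two components separately; any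
    constant would do. *)
Lemma period_int_bound (G : C -> C) (K : R) : cont_on_reals G ->
  (forall t : R, (0 <= t <= 2 * PI)%R -> (Cmod (G (RtoC t)) <= K)%R) ->
  (Cmod (period_int G) <= 4 * PI * K)%R.
Proof.
  intros HG B. apply Rle_trans with (1 := Cmod_le_add _). simpl.
  assert (B1 := period_int_Re_bound G K HG B).
  assert (B2 : (Rabs (period_int_Re (fun t => - Ci * G t)%C) <= 2 * PI * K)%R).
  { apply period_int_Re_bound; [apply cont_on_reals_scal, HG|]. intros t Ht.
    rewrite Cmod_mult, Cmod_opp, Cmod_Ci, Rmult_1_l. apply B, Ht. }
  lra.
Qed.

(** Fundamental theorem of calculus: the end values of the primitive cancel. *)
Lemma period_int_Re_derive (F G : C -> C) :
  cont_on_reals G -> (forall t : R, Cderiv F (RtoC t) (G (RtoC t))) ->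
  F (RtoC (2 * PI)) = F 0 -> period_int_Re G = 0%R.
Proof.
  intros HG HF E.
  assert (H : is_RInt (fun t => Re (G (RtoC t))) 0 (2 * PI) (minus (Re (F (RtoC (2 * PI)))) (Re (F (RtoC 0))))).
  { apply (is_RInt_derive (V := R_CompleteNormedModule) (fun t => Re (F (RtoC t)))).
    - intros t _. apply Cderiv_is_derive_Re, HF.
    - intros t _. apply Ccont_continuous_Re, HG. }
  unfold period_int_Re. rewrite (is_RInt_unique _ _ _ _ H), E. apply Rminus_diag_eq. reflexivity.
Qed.

Lemma period_int_derive (F G : C -> C) :
  cont_on_reals G -> (forall t : R, Cderiv F (RtoC t) (G (RtoC t))) ->
  F (RtoC (2 * PI)) = F 0 -> period_int G = 0.
Proof.
  intros HG HF E. unfold period_int.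
  rewrite (period_int_Re_derive F G HG HF E).
  rewrite (period_int_Re_derive (fun t => - Ci * F t) (fun t => - Ci * G t)).
  - reflexivity.
  - apply cont_on_reals_scal, HG.
  - intros t. apply (Cderiv_eq _ _ (0 * F (RtoC t) + - Ci * G (RtoC t))); [ring|].
    apply (Cderiv_mult (fun _ => - Ci) F); [apply Cderiv_const|apply HF].
  - rewrite E. reflexivity.
Qed.

(** The parameter t is complex so that the complex differentiation rules apply; only real t run
    through the circle. *)
Definition circ (rho : R) (t : C) : C := RtoC rho * Cexp (Ci * t).

Lemma Csmooth_circ (rho : R) (t : C) : Csmooth (circ rho) (fun t => Ci * circ rho t) t.
Proof.
  refine (Csmooth_ext _ _ _ _ _ (fun w => eq_refl (circ rho w)) _
    (Csmooth_mult _ _ _ _ _ (Csmooth_const (RtoC rho) t)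
      (Csmooth_comp Cexp Cexp (fun t => Ci * t) (fun t => 0 * t + Ci * 1) t (Csmooth_Cexp _)
       (Csmooth_mult _ _ _ _ _ (Csmooth_const Ci t) (Csmooth_id t))))).
  intros w. unfold circ. ring.
Qed.

Lemma Ccont_circ (rho : R) (t : C) : Ccont (circ rho) t.
Proof. exact (Csmooth_cont _ _ _ (Csmooth_circ rho t)). Qed.

Lemma Cmod_circ (rho t : R) : (0 <= rho)%R -> Cmod (circ rho (RtoC t)) = rho.
Proof.
  intros H. unfold circ. rewrite Cmod_mult, Cmod_R, Rabs_pos_eq by exact H.
  replace (Cmod (Cexp (Ci * RtoC t))) with 1%R; [ring|].
  unfold Cexp. replace (Re (Ci * RtoC t)) with 0%R by (simpl; ring).
  replace (Im (Ci * RtoC t)) with t by (simpl; ring). rewrite exp_0, !Rmult_1_l.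
  unfold Cmod. simpl. replace (cos t * (cos t * 1) + sin t * (sin t * 1))%R with 1%R.
  - symmetry. apply sqrt_1.
  - assert (S := sin2_cos2 t). unfold Rsqr in S. lra.
Qed.

Lemma circ_period (rho : R) : circ rho (RtoC (2 * PI)) = circ rho 0.
Proof.
  unfold circ. f_equal. unfold Cexp.
  replace (Re (Ci * RtoC (2 * PI))) with 0%R by (simpl; ring).
  replace (Im (Ci * RtoC (2 * PI))) with (2 * PI)%R by (simpl; ring).
  replace (Re (Ci * 0)) with 0%R by (simpl; ring).
  replace (Im (Ci * 0)) with 0%R by (simpl; ring).
  rewrite cos_2PI, sin_2PI, cos_0, sin_0. reflexivity.
Qed.

Section Cauchy.
Variables (f f' : C -> C) (R0 rho : R) (z : C).
Hypothesis Hrho : (0 < rho < R0)%R.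
Hypothesis Hz : (Cmod z < rho)%R.
Hypothesis Hf : forall w, (Cmod w < R0)%R -> Csmooth f f' w.

(** Room for the homotopy parameter: differentiation at l in [0,1] needs an open interval around it,
    and (1 + 2 margin) rho = rho + (R0 - rho)/2 is still below R0. *)
Let margin : R := ((R0 - rho) / (4 * rho))%R.

Lemma circ_minus_neq_0 (t : R) : circ rho (RtoC t) - z <> 0.
Proof.
  apply Cminus_eq_contra. intros E. assert (M := Cmod_circ rho t ltac:(lra)). rewrite E in M. lra.
Qed.

Lemma circ_neq_0 (t : R) : circ rho (RtoC t) <> 0.
Proof. apply Cmod_gt_0. rewrite Cmod_circ; lra. Qed.

Lemma margin_pos : (0 < margin)%R.
Proof. apply Rdiv_lt_0_compat; lra. Qed.

Lemma homotopy_in_disc (l t : R) : (- margin < l < 1 + margin)%R ->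
  (Cmod (z + RtoC l * (circ rho (RtoC t) - z)) < R0)%R.
Proof.
  intros Hl. assert (Pm := margin_pos).
  replace (z + RtoC l * (circ rho (RtoC t) - z)) with (RtoC (1 - l) * z + RtoC l * circ rho (RtoC t))
    by (rewrite RtoC_minus; ring).
  apply Rle_lt_trans with (1 := Cmod_triangle _ _).
  rewrite !Cmod_mult, !Cmod_R, Cmod_circ by lra.
  assert (A : (Rabs (1 - l) + Rabs l <= 1 + 2 * margin)%R).
  { unfold Rabs. destruct (Rcase_abs (1 - l)), (Rcase_abs l); lra. }
  assert (B : (Rabs (1 - l) * Cmod z <= Rabs (1 - l) * rho)%R).
  { apply Rmult_le_compat_l; [apply Rabs_pos|lra]. }
  apply Rle_lt_trans with ((1 + 2 * margin) * rho)%R.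
  - nra.
  - replace ((1 + 2 * margin) * rho)%R with (rho + (R0 - rho) / 2)%R by (unfold margin; field; lra). lra.
Qed.

(** Up to a factor i, the Cauchy kernel d zeta / (zeta - z) in the parameter t. *)
Let kern (t : C) : C := circ rho t * / (circ rho t - z).

Lemma cont_kern : cont_on_reals kern.
Proof.
  intros t. apply Ccont_mult; [apply Ccont_circ|].
  apply (Ccont_inv (fun t => circ rho t - z)); [apply circ_minus_neq_0|].
  apply Ccont_plus; [apply Ccont_circ|apply Ccont_const].
Qed.

(** Contracts the values of f on the circle, at l = 1, to the constant f z, at l = 0. *)
Let hom (l : R) (t : C) : C := f (z + RtoC l * (circ rho t - z)).

Lemma cont_hom_gen (g : C -> C) (Hg : forall w, (Cmod w < R0)%R -> Ccont g w) (l : R) :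
  (- margin < l < 1 + margin)%R -> cont_on_reals (fun t => g (z + RtoC l * (circ rho t - z))).
Proof.
  intros Hl t. apply (Ccont_comp g (fun t => z + RtoC l * (circ rho t - z))).
  - apply Ccont_plus; [apply Ccont_const|]. apply Ccont_mult; [apply Ccont_const|].
    apply Ccont_plus; [apply Ccont_circ|apply Ccont_const].
  - apply Hg, homotopy_in_disc, Hl.
Qed.

Lemma Hf_cont (w : C) : (Cmod w < R0)%R -> Ccont f w.
Proof. intros H. exact (Csmooth_cont _ _ _ (Hf w H)). Qed.

Lemma Hf'_cont (w : C) : (Cmod w < R0)%R -> Ccont f' w.
Proof. intros H. exact (proj2 (Hf w H)). Qed.

(** For l <> 0 the integrand is the t-derivative of c f(z + l (circ - z)) / (i l), which is
    periodic. At l = 0 this primitive breaks down and c f'(z) circ / i takes its place. *)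
Lemma hom_deriv_int_zero (c : C) (l : R) : (- margin < l < 1 + margin)%R ->
  period_int_Re (fun t => c * (f' (z + RtoC l * (circ rho t - z)) * circ rho t)) = 0%R.
Proof.
  intros Hl.
  destruct (Req_dec l 0) as [->|Nl].
  - apply (period_int_Re_derive (fun t => c * (f' z * (/ Ci * circ rho t)))).
    + intros t. apply Ccont_mult; [apply Ccont_const|]. apply Ccont_mult; [|apply Ccont_circ].
      apply (cont_hom_gen f' Hf'_cont 0 Hl).
    + intros t. apply (Cderiv_eq _ _ (0 * (f' z * (/ Ci * circ rho (RtoC t))) + c * (0 * (/ Ci * circ rho (RtoC t))
          + f' z * (0 * circ rho (RtoC t) + / Ci * (Ci * circ rho (RtoC t)))))).
      * replace (z + 0 * (circ rho t - z)) with z by ring. field. apply Ci_nz.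
      * apply (Cderiv_mult (fun _ => c) (fun t => f' z * (/ Ci * circ rho t))); [apply Cderiv_const|].
        apply (Cderiv_mult (fun _ => f' z) (fun t => / Ci * circ rho t)); [apply Cderiv_const|].
        apply (Cderiv_mult (fun _ => / Ci) (circ rho)); [apply Cderiv_const|apply Csmooth_circ].
    + rewrite circ_period. reflexivity.
  - apply (period_int_Re_derive (fun t => c * / (Ci * RtoC l) * f (z + RtoC l * (circ rho t - z)))).
    + intros t. apply Ccont_mult; [apply Ccont_const|]. apply Ccont_mult; [|apply Ccont_circ].
      apply (cont_hom_gen f' Hf'_cont l Hl).
    + intros t. apply (Cderiv_eq _ _ (0 * f (z + RtoC l * (circ rho t - z)) + c * / (Ci * RtoC l) *
         ((0 + (0 * (circ rho t - z) + RtoC l * (Ci * circ rho t + 0))) * f' (z + RtoC l * (circ rho t - z))))).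
      * field. split; [intros X; apply RtoC_inj in X; contradiction|apply Ci_nz].
      * apply (Cderiv_mult (fun _ => c * / (Ci * RtoC l)) (fun t => f (z + RtoC l * (circ rho t - z)))); [apply Cderiv_const|].
        apply (Cderiv_comp f (fun t => z + RtoC l * (circ rho t - z))).
        -- apply Hf, homotopy_in_disc, Hl.
        -- apply (Cderiv_plus (fun _ => z) (fun t => RtoC l * (circ rho t - z))); [apply Cderiv_const|].
           apply (Cderiv_mult (fun _ => RtoC l) (fun t => circ rho t - z)); [apply Cderiv_const|].
           apply (Cderiv_plus (circ rho) (fun _ => - z)); [apply Csmooth_circ|apply Cderiv_const].
    + rewrite circ_period. reflexivity.
Qed.

(** The inner derivative circ - z cancels the denominator of [kern], so the kernel disappears from
    the differentiated integrand. *)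
Lemma hom_partial (c : C) (l t : R) : (- margin < l < 1 + margin)%R ->
  is_derive (fun u => Re (c * (f (z + RtoC u * (circ rho (RtoC t) - z)) * kern (RtoC t)))) l
    (Re (c * (f' (z + RtoC l * (circ rho (RtoC t) - z)) * circ rho (RtoC t)))).
Proof.
  intros Hl.
  apply (Cderiv_is_derive_Re (fun u => c * (f (z + u * (circ rho (RtoC t) - z)) * kern (RtoC t)))).
  set (w := circ rho (RtoC t) - z).
  apply (Cderiv_eq _ _ (0 * (f (z + RtoC l * w) * kern (RtoC t)) + c *
     ((0 + (1 * w + RtoC l * 0)) * f' (z + RtoC l * w) * kern (RtoC t) + f (z + RtoC l * w) * 0))).
  - unfold kern. fold w. field. apply circ_minus_neq_0.
  - apply (Cderiv_mult (fun _ => c) (fun u => f (z + u * w) * kern (RtoC t))); [apply Cderiv_const|].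
    apply (Cderiv_mult (fun u => f (z + u * w)) (fun _ => kern (RtoC t))); [|apply Cderiv_const].
    apply (Cderiv_comp f (fun u => z + u * w)).
    + apply Hf, homotopy_in_disc, Hl.
    + apply (Cderiv_plus (fun _ => z) (fun u => u * w)); [apply Cderiv_const|].
      apply (Cderiv_mult (fun u => u) (fun _ => w)); [apply Cderiv_id|apply Cderiv_const].
Qed.

(** Differentiation under the integral sign: the derivative in l vanishes by
    [hom_deriv_int_zero]. *)
Lemma hom_int_constant (c : C) :
  period_int_Re (fun t => c * (hom 0 t * kern t)) = period_int_Re (fun t => c * (hom 1 t * kern t)).
Proof.
  assert (Pm := margin_pos).
  apply (eq_is_derive (V := R_NormedModule) (fun l => period_int_Re (fun t => c * (hom l t * kern t)))); [|lra].
  intros l Hl.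
  assert (Near : locally l (fun u : R => (- margin < u < 1 + margin)%R)).
  { exists (mkposreal _ Pm). intros u Hu. unfold ball in Hu; simpl in Hu.
    unfold AbsRing_ball, abs, minus, plus, opp in Hu; simpl in Hu.
    apply Rabs_def2 in Hu. lra. }
  assert (D := is_derive_RInt_param
    (fun u t => Re (c * (f (z + RtoC u * (circ rho (RtoC t) - z)) * kern (RtoC t)))) 0 (2 * PI) l).
  replace (@zero R_NormedModule) with
    (RInt (fun t => Derive (fun u => Re (c * (f (z + RtoC u * (circ rho (RtoC t) - z)) * kern (RtoC t)))) l) 0 (2 * PI)).
  - apply D.
    + revert Near. apply filter_imp. intros u Hu t _. eexists. apply hom_partial, Hu.
    + intros t _.
      apply (continuity_2d_pt_ext_loc (fun u v => Re (c * (f' (z + RtoC u * (circ rho (RtoC v) - z)) * circ rho (RtoC v))))).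
      * destruct Near as [d Hd]. exists d. intros u v Hu _. symmetry. apply is_derive_unique, hom_partial.
        apply Hd. exact Hu.
      * apply (Ccont_continuity_2d_Re
          (fun w => c * (f' (z + RtoC (Re w) * (circ rho (RtoC (Im w)) - z)) * circ rho (RtoC (Im w))))).
        assert (CC : Ccont (fun w => circ rho (RtoC (Im w))) (l, t)).
        { apply (Ccont_comp (circ rho) (fun w => RtoC (Im w))); [apply Ccont_Im|apply Ccont_circ]. }
        apply Ccont_mult; [apply Ccont_const|]. apply Ccont_mult; [|exact CC].
        apply (Ccont_comp f' (fun w => z + RtoC (Re w) * (circ rho (RtoC (Im w)) - z))).
        -- apply Ccont_plus; [apply Ccont_const|]. apply Ccont_mult; [apply Ccont_Re|].
           apply Ccont_plus; [exact CC|apply Ccont_const].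
        -- apply Hf'_cont, homotopy_in_disc. simpl. lra.
    + revert Near. apply filter_imp. intros u Hu.
      apply (period_int_Re_ex (fun t => c * (f (z + RtoC u * (circ rho t - z)) * kern t))).
      intros t. apply Ccont_mult; [apply Ccont_const|]. apply Ccont_mult; [|apply cont_kern].
      apply (cont_hom_gen f Hf_cont u Hu).
  - etransitivity; [|exact (hom_deriv_int_zero c l ltac:(lra))]. apply RInt_ext. intros t _.
    apply is_derive_unique, hom_partial. lra.
Qed.

(** Compares the two ends of the homotopy; the free factor c covers both components. The integral of
    [kern] itself is evaluated only after the geometric expansion. *)
Lemma cauchy_kernel : period_int (fun t => f (circ rho t) * kern t) = f z * period_int kern.
Proof.
  rewrite <- period_int_scal by apply cont_kern.
  assert (E : forall c, period_int_Re (fun t => c * (f (circ rho t) * kern t)) = period_int_Re (fun t => c * (f z * kern t))).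
  { intros c.
    rewrite (period_int_Re_ext _ (fun t => c * (hom 1 t * kern t)))
      by (intros t; unfold hom; replace (z + 1 * (circ rho t - z)) with (circ rho t) by ring; reflexivity).
    rewrite <- hom_int_constant. apply period_int_Re_ext. intros t. unfold hom.
    replace (z + 0 * (circ rho t - z)) with z by ring. reflexivity. }
  unfold period_int. f_equal; [|apply E].
  rewrite (period_int_Re_ext _ (fun t => 1 * (f (circ rho t) * kern t))) by (intros t; ring).
  rewrite E. apply period_int_Re_ext. intros t. ring.
Qed.

(** Geometric expansion of zeta/(zeta - z) in powers of z/zeta, with its exact remainder kept under
    the integral. A general [phi] serves twice: phi = 1 evaluates the integral of [kern], and the
    values of f on the circle give the Taylor series. *)
Lemma kernel_geometric (phi : C -> C) : cont_on_reals phi ->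
  Cseries (fun n => period_int (fun t => phi t * / circ rho t ^ n) * z ^ n)
    (period_int (fun t => phi t * kern t)).
Proof.
  intros Hphi.
  assert (Cp : forall n, cont_on_reals (fun t => phi t * / circ rho t ^ n)).
  { intros n t. apply Ccont_mult; [apply Hphi|].
    apply (Ccont_inv (fun t => circ rho t ^ n)); [apply Cpow_nz, circ_neq_0|].
    exact (Csmooth_cont _ _ _ (Csmooth_pow _ _ _ n (Csmooth_circ rho _))). }
  assert (Cr : forall n, cont_on_reals (fun t => (phi t * / circ rho t ^ n) * kern t)).
  { intros n t. apply Ccont_mult; [apply Cp|apply cont_kern]. }
  assert (Rem : forall N, period_int (fun t => phi t * kern t)
     = sum_n (fun n => period_int (fun t => phi t * / circ rho t ^ n) * z ^ n) N
       + z ^ S N * period_int (fun t => (phi t * / circ rho t ^ S N) * kern t)).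
  { assert (St : forall n, period_int (fun t => (phi t * / circ rho t ^ n) * kern t)
       = period_int (fun t => phi t * / circ rho t ^ n) + z * period_int (fun t => (phi t * / circ rho t ^ S n) * kern t)).
    { intros n. rewrite <- period_int_scal by apply Cr.
      rewrite <- period_int_plus; [|apply Cp|apply cont_on_reals_scal, Cr].
      apply period_int_ext. intros t. unfold kern. simpl. field.
      split; [apply circ_minus_neq_0|split; [apply Cpow_nz|]; apply circ_neq_0]. }
    induction N as [|N IH].
    - rewrite sum_O. rewrite (period_int_ext (fun t => phi t * kern t) (fun t => (phi t * / circ rho t ^ 0) * kern t)).
      + rewrite St. simpl. ring.
      + intros t. simpl. field.
    - rewrite IH, sum_Sn, (St (S N)). unfold plus; simpl. ring. }
  destruct (continuity_ab_maj (fun t => Cmod (phi (RtoC t))) 0 (2 * PI)) as [tm [HM _]].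
  { apply Rlt_le, two_PI_pos. }
  { intros t _ eps He. destruct (proj1 (Ccont_eps _ _) (Hphi t) eps He) as [d [Hd K]].
    exists d. split; [exact Hd|]. intros s [_ Hs]. simpl in *. unfold Rdist in *.
    apply Rle_lt_trans with (Cmod (phi (RtoC s) - phi (RtoC t))).
    - apply Rabs_le. assert (T1 := Cmod_triangle (phi (RtoC s) - phi (RtoC t)) (phi (RtoC t))).
      assert (T2 := Cmod_triangle (phi (RtoC s)) (- (phi (RtoC s) - phi (RtoC t)))).
      rewrite Cmod_opp in T2.
      replace (phi (RtoC s) - phi (RtoC t) + phi (RtoC t)) with (phi (RtoC s)) in T1 by ring.
      replace (phi (RtoC s) + - (phi (RtoC s) - phi (RtoC t))) with (phi (RtoC t)) in T2 by ring. lra.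
    - apply K. rewrite <- RtoC_minus, Cmod_R. exact Hs. }
  set (M := Cmod (phi (RtoC tm))) in *.
  assert (PM : (0 <= M)%R) by apply Cmod_ge_0.
  assert (Pz := Cmod_ge_0 z). assert (PP := PI_RGT_0).
  (* [M] bounds |phi|, the kernel is at most rho/(rho - |z|) in modulus, and 4 PI comes from
     [period_int_bound]. *)
  set (L := (4 * PI * (M * (rho / (rho - Cmod z))))%R).
  assert (PL : (0 <= L)%R).
  { apply Rmult_le_pos; [lra|]. apply Rmult_le_pos; [lra|]. apply Rdiv_le_0_compat; lra. }
  assert (Bd : forall n, (Cmod (z ^ n * period_int (fun t => (phi t * / circ rho t ^ n) * kern t)%C) <= L * (Cmod z / rho) ^ n)%R).
  { intros n. rewrite Cmod_mult, Cmod_pow.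
    assert (B := period_int_bound _ (M * (rho / (rho - Cmod z)) / rho ^ n)%R (Cr n)).
    replace (L * (Cmod z / rho) ^ n)%R with (Cmod z ^ n * (4 * PI * (M * (rho / (rho - Cmod z)) / rho ^ n)))%R.
    - apply Rmult_le_compat_l; [apply pow_le, Pz|]. apply B. intros t Ht.
      unfold kern. rewrite !Cmod_mult, !Cmod_inv by (first [apply circ_minus_neq_0|apply Cpow_nz, circ_neq_0]).
      rewrite Cmod_pow, Cmod_circ by lra.
      assert (Q : (rho - Cmod z <= Cmod (circ rho (RtoC t) - z))%R).
      { assert (T := Cmod_triangle (circ rho (RtoC t) - z) z).
        replace (circ rho (RtoC t) - z + z) with (circ rho (RtoC t)) in T by ring.
        rewrite Cmod_circ in T by lra. lra. }
      replace (M * (rho / (rho - Cmod z)) / rho ^ n)%R with (M * / rho ^ n * (rho * / (rho - Cmod z)))%R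
        by (unfold Rdiv; ring).
      assert (0 < rho ^ n)%R by (apply pow_lt; lra).
      assert (0 < / rho ^ n)%R by (apply Rinv_0_lt_compat; assumption).
      assert (0 < / Cmod (circ rho (RtoC t) - z))%R by (apply Rinv_0_lt_compat; lra).
      apply Rmult_le_compat.
      + apply Rmult_le_pos; [apply Cmod_ge_0|lra].
      + apply Rmult_le_pos; lra.
      + apply Rmult_le_compat_r; [lra|apply HM, Ht].
      + apply Rmult_le_compat_l; [lra|]. apply Rinv_le_contravar; lra.
    - unfold L, Rdiv. rewrite Rpow_mult_distr, pow_inv. ring. }
  assert (Hq : (Rabs (Cmod z / rho) < 1)%R).
  { rewrite Rabs_pos_eq by (apply Rdiv_le_0_compat; lra).
    apply (Rmult_lt_reg_r rho); [lra|]. unfold Rdiv. rewrite Rmult_assoc, Rinv_l by lra. lra. }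
  apply Cseries_eps. intros eps He.
  destruct (pow_lt_1_zero _ Hq (eps / (L + 1))%R ltac:(apply Rdiv_lt_0_compat; lra)) as [N HN].
  exists N. intros n Hn.
  set (s := sum_n (fun n => period_int (fun t => phi t * / circ rho t ^ n) * z ^ n) n).
  replace (s - period_int (fun t => phi t * kern t))
    with (- (z ^ S n * period_int (fun t => phi t * / circ rho t ^ S n * kern t)))
    by (rewrite (Rem n); fold s; ring).
  rewrite Cmod_opp. apply Rle_lt_trans with (1 := Bd (S n)).
  specialize (HN (S n) ltac:(lia)). rewrite Rabs_pos_eq in HN by (apply pow_le, Rdiv_le_0_compat; lra).
  assert (0 <= (Cmod z / rho) ^ S n)%R by (apply pow_le, Rdiv_le_0_compat; lra).
  apply Rle_lt_trans with ((L + 1) * (Cmod z / rho) ^ S n)%R; [nra|].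
  apply (Rmult_lt_reg_l (/ (L + 1))); [apply Rinv_0_lt_compat; lra|].
  rewrite <- Rmult_assoc, Rinv_l, Rmult_1_l by lra.
  apply Rlt_le_trans with (1 := HN). right. unfold Rdiv. ring.
Qed.

(** Expansion with phi = 1: for n >= 1 the function zeta^(-n) has the periodic primitive
    -zeta^(-n)/(i n), so only the constant term remains. *)
Lemma period_int_kern : period_int kern = RtoC (2 * PI).
Proof.
  assert (HS := kernel_geometric (fun _ => 1) (fun t => Ccont_const 1 _)). cbv beta in HS.
  rewrite (period_int_ext (fun t => 1 * kern t) kern) in HS by (intros t; ring).
  apply (Cseries_unique _ _ _ HS). apply Cseries_first.
  - rewrite (period_int_ext _ (fun _ => 1)) by (intros t; simpl; field).
    rewrite period_int_const. simpl. ring.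
  - intros n. rewrite (period_int_derive (fun t => / (- (Ci * RtoC (INR (S n)))) * / circ rho t ^ S n)); [ring| | |].
    + intros t. apply Ccont_mult; [apply Ccont_const|].
      apply (Ccont_inv (fun t => circ rho t ^ S n)); [apply Cpow_nz, circ_neq_0|].
      exact (Csmooth_cont _ _ _ (Csmooth_pow _ _ _ (S n) (Csmooth_circ rho _))).
    + intros t.
      assert (X := Csmooth_mult _ _ _ _ _ (Csmooth_const (/ (- (Ci * RtoC (INR (S n))))) (RtoC t))
         (Csmooth_inv (fun t => circ rho t ^ S n) _ _ (Cpow_nz _ (S n) (circ_neq_0 t)) (Csmooth_pow _ _ _ (S n) (Csmooth_circ rho (RtoC t))))).
      destruct X as [X _]. revert X. apply Cderiv_eq. cbv beta.
      replace (S n - 1)%nat with n by lia. simpl Cpow.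
      assert (RtoC (INR (S n)) <> 0) by (intros E; apply RtoC_inj in E; apply (not_0_INR (S n)); [lia|exact E]).
      field. repeat split; first [assumption|apply Ci_nz|apply circ_neq_0|apply Cpow_nz, circ_neq_0].
    + rewrite circ_period. reflexivity.
Qed.

End Cauchy.

Lemma Csmooth_pser (f f' : C -> C) (R0 rho : R) :
  (0 < rho < R0)%R -> (forall w, (Cmod w < R0)%R -> Csmooth f f' w) ->
  exists c, pser c rho f.
Proof.
  intros Hrho Hf.
  exists (fun n => / RtoC (2 * PI) * period_int (fun t => f (circ rho t) * / circ rho t ^ n)).
  intros z Hz.
  assert (N : RtoC (2 * PI) <> 0) by (intros E; apply RtoC_inj in E; assert (P := PI_RGT_0); lra).
  assert (K := cauchy_kernel f f' R0 rho z Hrho Hz Hf). cbv beta in K.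
  assert (I := period_int_kern R0 rho z Hrho Hz). cbv beta in I.
  rewrite I in K.
  assert (CF : cont_on_reals (fun t => f (circ rho t))).
  { intros t. apply (Ccont_comp f (circ rho)); [apply Ccont_circ|].
    apply (Csmooth_cont _ f'), Hf. rewrite Cmod_circ; lra. }
  assert (S := Cseries_scal (/ RtoC (2 * PI)) _ _ (kernel_geometric R0 rho z Hrho Hz _ CF)). cbv beta in S.
  rewrite K in S. replace (/ RtoC (2 * PI) * (f z * RtoC (2 * PI))) with (f z) in S by (field; exact N).
  revert S. apply Cseries_ext. intros n. ring.
Qed.

(** * Continuation of 2F1(1, A; B; y) *)

Lemma INR_S_C (n : nat) : RtoC (INR (S n)) = RtoC (INR n) + 1.
Proof. rewrite S_INR, RtoC_plus. reflexivity. Qed.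

Lemma Csmooth_analytic_slit (F F' : C -> C) :
  (forall z, slit_plane z -> Csmooth F F' z) -> forall z, slit_plane z -> analytic_at F z.
Proof.
  intros H z Hz. apply analytic_at_pser.
  destruct (slit_open z Hz) as [d [Hd D]].
  destruct (Csmooth_pser (fun h => F (z + h)) (fun h => (0 + 1) * F' (z + h)) d (d / 2) ltac:(lra)) as [c Hc].
  - intros h Hh. apply (Csmooth_comp F F' (fun h => z + h) (fun _ => 0 + 1)).
    + apply H, D. replace (z + h - z) with h by ring. exact Hh.
    + apply Csmooth_plus; [apply Csmooth_const|apply Csmooth_id].
  - exists c, (d / 2)%R. split; [lra|exact Hc].
Qed.

(** [epsilon] meets its specification as soon as one continuation is exhibited, and two
    continuations agree because they have the same series in the unit disc. *)
Lemma pFq_slit_eq (A B : list C) (F : C -> C) :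
  length A = S (length B) -> pFq_continuation A B F ->
  forall z, slit_plane z -> pFq A B z = F z.
Proof.
  intros HL HF. unfold pFq. destruct (Nat.eq_dec _ _) as [_|N]; [|contradiction].
  assert (E := epsilon_spec (inhabits (fun _ : C => RtoC 0)) (pFq_continuation A B) (ex_intro _ F HF)).
  destruct E as [E1 E2], HF as [F1 F2].
  apply (analytic_slit_unique _ _ 1); [lra|exact E1|exact F1|].
  intros z Hz. exact (Cseries_unique _ _ _ (E2 z Hz) (F2 z Hz)).
Qed.

Lemma pFq_entire_eq (A B : list C) (z l : C) :
  length A <> S (length B) -> Cseries (pFq_term A B z) l -> pFq A B z = l.
Proof.
  intros HL HF. unfold pFq. destruct (Nat.eq_dec _ _) as [E|_]; [contradiction|].
  apply (iota_unique (V := C_CompleteNormedModule)); [|exact HF].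
  intros y Hy. exact (Cseries_unique _ _ _ Hy HF).
Qed.

(** Comparison with a geometric series of ratio |z|/rho. *)
Lemma pser_of_bound (c : nat -> C) (rho K : R) :
  (0 < rho)%R -> (forall n, (Cmod (c n) * rho ^ n <= K)%R) ->
  pser c rho (fun z => Csum (fun n => c n * z ^ n)).
Proof.
  intros Hr B z Hz. apply Csum_correct.
  destruct (Cseries_dominated (fun n => c n * z ^ n) (fun n => K * (Cmod z / rho) ^ n)%R) as [l [Hl _]].
  - intros n. rewrite Cmod_mult, Cmod_pow. unfold Rdiv. rewrite Rpow_mult_distr, pow_inv.
    replace (K * (Cmod z ^ n * / rho ^ n))%R with (K * / rho ^ n * Cmod z ^ n)%R by ring.
    apply Rmult_le_compat_r; [apply pow_le, Cmod_ge_0|].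
    apply (Rmult_le_reg_r (rho ^ n)); [apply pow_lt, Hr|].
    rewrite Rmult_assoc, Rinv_l, Rmult_1_r by (apply pow_nonzero; lra). apply B.
  - apply (ex_series_scal_l (V := R_NormedModule)). exists (/ (1 - Cmod z / rho))%R. apply is_series_geom.
    assert (P := Cmod_ge_0 z).
    rewrite Rabs_pos_eq by (apply Rdiv_le_0_compat; lra).
    apply (Rmult_lt_reg_r rho); [lra|]. unfold Rdiv. rewrite Rmult_assoc, Rinv_l by lra. lra.
  - exists l. exact Hl.
Qed.

Section Koebe.
Variables (A beta : C).
Hypothesis Hbeta : forall n : nat, beta + INR (S n) <> 0.

(* The Koebe map [y = 4 w / (1 + w)^2] turns [y (1 - y) G' + (beta - A y) G = beta] into an equation for [G = 1 + K]
   whose power series solution in [w] has coefficients [koebe]. *)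
Fixpoint koebe_pair (n : nat) : C * C :=
  match n with
  | O => (RtoC 0, 4 * A / (1 + beta))
  | S n => let (x, y) := koebe_pair n in
           (y, ((4 * A - 2 * beta) * y + (INR n - beta) * x) / (INR n + 2 + beta))
  end.

Definition koebe (n : nat) : C := fst (koebe_pair n).

Lemma koebe_pair_eq (n : nat) : koebe_pair n = (koebe n, koebe (S n)).
Proof. unfold koebe. simpl. destruct (koebe_pair n); reflexivity. Qed.

Lemma koebe_denominator (n : nat) : INR n + 2 + beta <> 0.
Proof.
  replace (INR n + 2 + beta) with (beta + INR (S (S n))); [apply Hbeta|].
  rewrite !INR_S_C. ring.
Qed.

Lemma koebe_rec (n : nat) :
  koebe (S (S n)) = ((4 * A - 2 * beta) * koebe (S n) + (INR n - beta) * koebe n) / (INR n + 2 + beta).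
Proof.
  unfold koebe at 1. cbn [koebe_pair]. fold koebe_pair.
  destruct n as [|n]; [reflexivity|].
  rewrite koebe_pair_eq. cbn -[INR]. reflexivity.
Qed.

(** The recurrence tends to x_(n+2) = x_n, so the larger of two neighbouring terms eventually grows
    by a factor at most q, for any q > 1. Hence convergence in the whole unit disc. *)
Lemma koebe_growth (q : R) : (1 < q)%R ->
  exists K, (0 <= K)%R /\ forall n, (Cmod (koebe n) <= K * q ^ n)%R.
Proof.
  intros Hq.
  set (D := Cmod (4 * A - 2 * beta)). set (b := Cmod beta).
  assert (PD : (0 <= D)%R) by apply Cmod_ge_0. assert (Pb : (0 <= b)%R) by apply Cmod_ge_0.
  (* Beyond this index D + n + b <= q (n - b), where D + n + b bounds the coefficients in the
     numerator and n - b bounds the denominator from below. *)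
  destruct (nfloor_ex ((D + (1 + q) * b) / (q - 1))) as [N0 HN0].
  { apply Rdiv_le_0_compat; [nra|lra]. }
  set (N := S N0).
  set (m := fun n => Rmax (Cmod (koebe n)) (Cmod (koebe (S n)))).
  assert (Step : forall n, (N <= n)%nat -> (m (S n) <= q * m n)%R).
  { intros n Hn.
    assert (Hn' : ((D + (1 + q) * b) / (q - 1) <= INR n)%R).
    { apply le_INR in Hn. unfold N in Hn. rewrite S_INR in Hn. lra. }
    apply (Rmult_le_compat_r (q - 1)) in Hn'; [|lra].
    unfold Rdiv in Hn'. rewrite Rmult_assoc, Rinv_l, Rmult_1_r in Hn' by lra.
    assert (M1 : (Cmod (koebe n) <= m n)%R) by apply Rmax_l.
    assert (M2 : (Cmod (koebe (S n)) <= m n)%R) by apply Rmax_r.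
    assert (P1 := Cmod_ge_0 (koebe n)). assert (P2 := Cmod_ge_0 (koebe (S n))).
    apply Rmax_lub; [nra|].
    rewrite koebe_rec, Cmod_div by apply koebe_denominator.
    assert (Pn := pos_INR n).
    assert (T1 : (INR n - b <= Cmod (INR n + 2 + beta))%R).
    { assert (T := Cmod_triangle (INR n + 2 + beta) (- beta)). rewrite Cmod_opp in T. fold b in T.
      replace (INR n + 2 + beta + - beta) with (RtoC (INR n + 2)) in T by (rewrite RtoC_plus; ring).
      rewrite Cmod_R, Rabs_pos_eq in T by lra. lra. }
    assert (T2 : (Cmod (INR n - beta) <= INR n + b)%R).
    { assert (T := Cmod_triangle (INR n) (- beta)). rewrite Cmod_opp, Cmod_R, Rabs_pos_eq in T by lra. exact T. }
    assert (Pden : (0 < Cmod (INR n + 2 + beta))%R) by (apply Cmod_gt_0, koebe_denominator).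
    apply (Rmult_le_reg_r (Cmod (INR n + 2 + beta))); [exact Pden|].
    unfold Rdiv. rewrite Rmult_assoc, Rinv_l, Rmult_1_r by lra.
    apply Rle_trans with (1 := Cmod_triangle _ _). rewrite !Cmod_mult. fold D.
    apply Rle_trans with ((D + (INR n + b)) * m n)%R.
    { rewrite Rmult_plus_distr_r. apply Rplus_le_compat.
      - apply Rmult_le_compat_l; lra.
      - apply Rmult_le_compat; [apply Cmod_ge_0|lra|exact T2|exact M1]. }
    apply Rle_trans with (q * (INR n - b) * m n)%R.
    { apply Rmult_le_compat_r; [lra|]. lra. }
    replace (q * m n * Cmod (INR n + 2 + beta))%R with (q * Cmod (INR n + 2 + beta) * m n)%R by ring.
    apply Rmult_le_compat_r; [lra|]. apply Rmult_le_compat_l; lra. }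
  destruct (finite_upper_bound m N) as [K [HK BK]].
  assert (Pq : forall n, (1 <= q ^ n)%R) by (intros n; apply pow_R1_Rle; lra).
  exists K. split; [exact HK|].
  assert (All : forall n, (m n <= K * q ^ n)%R).
  { intros n. destruct (Compare_dec.le_lt_dec n N) as [L|L].
    - apply Rle_trans with (1 := BK n L). specialize (Pq n). nra.
    - replace n with (N + (n - N))%nat by lia. generalize (n - N)%nat as j. clear L.
      induction j as [|j IH].
      + rewrite Nat.add_0_r. apply Rle_trans with (1 := BK N (Nat.le_refl N)). specialize (Pq N). nra.
      + rewrite Nat.add_succ_r. apply Rle_trans with (1 := Step _ (Nat.le_add_r N j)). rewrite <- tech_pow_Rmult.
        replace (K * (q * q ^ (N + j)))%R with (q * (K * q ^ (N + j)))%R by ring.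
        apply Rmult_le_compat_l; [lra|exact IH]. }
  intros j. apply Rle_trans with (2 := All j), Rmax_l.
Qed.

Definition koebe_sum (w : C) : C := Csum (fun n => koebe n * w ^ n).

Lemma koebe_pser : pser koebe 1 koebe_sum.
Proof.
  intros w Hw. assert (P := Cmod_ge_0 w).
  set (r := ((1 + Cmod w) / 2)%R). assert (Hr : (0 < r < 1 /\ Cmod w < r)%R) by (unfold r; lra).
  destruct (koebe_growth (/ r)) as [K [HK B]].
  { rewrite <- Rinv_1. apply Rinv_lt_contravar; lra. }
  apply (pser_of_bound koebe r K); [lra| |lra].
  intros n. assert (0 < r ^ n)%R by (apply pow_lt; lra).
  apply Rle_trans with (K * (/ r) ^ n * r ^ n)%R; [apply Rmult_le_compat_r; [lra|apply B]|].
  rewrite pow_inv, Rmult_assoc, Rinv_l by lra. lra.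
Qed.

(** Since y (1 - y) d/dy = w (1 - w)/(1 + w) d/dw, the equation for 1 + K, cleared by (1 + w)^2,
    takes this form. Its coefficient at w^(n+2) is the recurrence. *)
Lemma koebe_ode (w : C) : (Cmod w < 1)%R ->
  w * (1 - w * w) * dsum koebe w + (beta * ((1 + w) * (1 + w)) - 4 * A * w) * koebe_sum w = 4 * A * w.
Proof.
  intros Hw.
  assert (HK := koebe_pser).
  assert (HD := pser_mulX _ _ _ (pser_dsum _ _ _ HK)).
  assert (H1 := pser_mulX _ _ _ HK).
  assert (H2 := pser_mulX _ _ _ H1).
  assert (HD2 := pser_mulX _ _ _ (pser_mulX _ _ _ HD)).
  assert (HS := pser_plus _ _ _ _ _ HD (pser_plus _ _ _ _ _ (pser_scal (-1) _ _ _ HD2)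
     (pser_plus _ _ _ _ _ (pser_scal beta _ _ _ HK) (pser_plus _ _ _ _ _
       (pser_scal (2 * beta - 4 * A) _ _ _ H1) (pser_scal beta _ _ _ H2))))).
  specialize (HS w Hw). cbv beta in HS.
  transitivity (w * dsum koebe w + (-1 * (w * (w * (w * dsum koebe w)))
    + (beta * koebe_sum w + ((2 * beta - 4 * A) * (w * koebe_sum w) + beta * (w * (w * koebe_sum w)))))).
  { ring. }
  apply (Cseries_unique _ _ _ HS).
  apply Cseries_decr_1.
  match goal with |- is_series _ ?l => replace l with (4 * A * w) end.
  2:{ unfold koebe. simpl. ring. }
  apply Cseries_first.
  - assert (N1 : 1 + beta <> 0) by (replace (1 + beta) with (beta + INR 1) by (simpl; ring); apply Hbeta).
    unfold koebe, dcoef. simpl. field. exact N1.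
  - intros n. cbn [shift1]. rewrite shift1_dcoef. unfold dcoef. rewrite koebe_rec, !INR_S_C.
    assert (N := koebe_denominator n).
    field. exact N.
Qed.

Lemma koebe_sum_0 : koebe_sum 0 = 0.
Proof. rewrite (pser_at_0 _ _ _ koebe_pser) by lra. reflexivity. Qed.

Definition root1m (y : C) : C := Cpower (1 - y) (RtoC (/ 2)).

(** With s the principal root of 1 - y, the inverse of the Koebe map is w = (1 - s)/(1 + s). The
    result is the continuation of 2F1(1, A; beta + 1; y). *)
Definition gauss1 (y : C) : C := 1 + koebe_sum ((1 - root1m y) * / (1 + root1m y)).

Lemma root1m_sqr (y : C) : slit_plane y -> root1m y * root1m y = 1 - y.
Proof. intros H. apply sqrt_sqr, slit_off_cut, H. Qed.

Lemma root1m_Re (y : C) : slit_plane y -> (0 < Re (root1m y))%R.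
Proof. intros H. apply Re_sqrt_pos, slit_off_cut, H. Qed.

Lemma root1m_plus_neq_0 (y : C) : slit_plane y -> 1 + root1m y <> 0.
Proof.
  intros H E. assert (P := root1m_Re y H). apply (f_equal Re) in E. rewrite re_plus, !re_RtoC in E. lra.
Qed.

Lemma root1m_neq_0 (y : C) : root1m y <> 0.
Proof. apply Cpower_neq_0. Qed.

(** Cayley transform of the right half-plane: |1 + s|^2 - |1 - s|^2 = 4 Re s. *)
Lemma cayley_disc (s : C) : (0 < Re s)%R -> (Cmod ((1 - s) * / (1 + s)) < 1)%R.
Proof.
  intros H.
  assert (N : 1 + s <> 0).
  { intros E. apply (f_equal Re) in E. rewrite re_plus, !re_RtoC in E. lra. }
  assert (P : (0 < Cmod (1 + s))%R) by (apply Cmod_gt_0, N).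
  rewrite Cmod_mult, Cmod_inv by exact N.
  apply (Rmult_lt_reg_r (Cmod (1 + s))); [exact P|].
  rewrite Rmult_assoc, Rinv_l, Rmult_1_r, Rmult_1_l by lra.
  apply Rsqr_incrst_0; [|apply Cmod_ge_0|lra].
  unfold Rsqr. rewrite !Cmod_sqr. destruct s as [u v]. simpl in *. nra.
Qed.

Lemma Csmooth_root1m (y : C) : slit_plane y ->
  Csmooth root1m (fun y => - (1 * / 2) * / (1 - y) * root1m y) y.
Proof.
  intros H.
  refine (Csmooth_ext _ _ _ _ _ (fun y => eq_refl (root1m y)) _
    (Csmooth_comp _ _ (fun y => 1 - y) (fun _ => 0 + - RtoC 1) y
      (Csmooth_Cpower (1 - y) (RtoC (/ 2)) (slit_off_cut y H))
      (Csmooth_plus _ _ _ _ _ (Csmooth_const 1 y) (Csmooth_opp _ _ _ (Csmooth_id y))))).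
  intros v. unfold root1m. rewrite RtoC_inv by lra. ring.
Qed.

Lemma gauss1_ode : exists G', forall y, slit_plane y ->
  Csmooth gauss1 G' y /\ y * (1 - y) * G' y + (beta - A * y) * gauss1 y = beta.
Proof.
  set (w := fun y => (1 - root1m y) * / (1 + root1m y)).
  set (s' := fun y => - (1 * / 2) * / (1 - y) * root1m y).
  (* Written as the sum, product and inverse rules produce it; the closed form 1/(s (1 + s)^2) is
     [Ew']. *)
  set (w' := fun y => (0 + - s' y) * / (1 + root1m y)
      + (1 - root1m y) * ((0 + s' y) * - / ((1 + root1m y) * (1 + root1m y)))).
  exists (fun y => 0 + w' y * dsum koebe (w y)).
  intros y Hy.
  assert (N1 := root1m_plus_neq_0 y Hy). assert (N0 := root1m_neq_0 y).
  assert (Dw : (Cmod (w y) < 1)%R) by apply cayley_disc, root1m_Re, Hy.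
  split.
  - unfold gauss1. apply (Csmooth_plus (fun _ => 1) (fun _ => 0)); [apply Csmooth_const|].
    apply (Csmooth_comp koebe_sum (dsum koebe) w w').
    + exact (pser_Csmooth _ _ _ _ koebe_pser Dw).
    + assert (Hs := Csmooth_root1m y Hy).
      apply (Csmooth_mult (fun y => 1 - root1m y) (fun y => 0 + - s' y)).
      * exact (Csmooth_plus _ _ _ _ _ (Csmooth_const 1 y) (Csmooth_opp _ _ _ Hs)).
      * apply (Csmooth_inv (fun y => 1 + root1m y) (fun y => 0 + s' y)); [exact N1|].
        exact (Csmooth_plus _ _ _ _ _ (Csmooth_const 1 y) Hs).
  - assert (O := koebe_ode (w y) Dw).
    assert (E := root1m_sqr y Hy).
    change (gauss1 y) with (1 + koebe_sum (w y)).
    set (s := root1m y) in *. set (k := koebe_sum (w y)) in *. set (dk := dsum koebe (w y)) in *.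
    assert (Ey : y = 1 - s * s) by (rewrite E; ring).
    assert (Ew : w y = (1 - s) * / (1 + s)) by reflexivity.
    assert (Ew' : w' y = / (s * ((1 + s) * (1 + s)))).
    { unfold w', s'. fold s. rewrite <- E. field. repeat split; assumption. }
    rewrite Ew', Ey. rewrite Ew in O. clearbody s k dk.
    (* The factor (1 + s)^2 / 4 is (1 + w)^(-2), which undoes the clearing of denominators in
       [koebe_ode]. *)
    match type of O with ?l = ?r => transitivity (beta + (l - r) * ((1 + s) * (1 + s) * / 4)) end.
    + field. split; assumption.
    + rewrite O. ring.
Qed.

End Koebe.

(** * Binomial, Pfaff and Kummer series *)

Lemma INR_S_neq_0 (n : nat) : RtoC (INR (S n)) <> 0.
Proof. intros E. apply RtoC_inj in E. apply (not_0_INR (S n)); [lia|exact E]. Qed.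

Lemma INR_fact_neq_0_C (n : nat) : RtoC (INR (fact n)) <> 0.
Proof. intros E. apply RtoC_inj in E. exact (INR_fact_neq_0 n E). Qed.

Lemma fact_S_C (n : nat) : RtoC (INR (fact (S n))) = (INR n + 1) * INR (fact n).
Proof. rewrite fact_simpl, mult_INR, RtoC_mult, INR_S_C. reflexivity. Qed.

Lemma poch_neq_0 (z : C) (n : nat) : (forall k, (k < n)%nat -> z + INR k <> 0) -> poch z n <> 0.
Proof.
  induction n as [|n IH]; intros H.
  - apply C1_nz.
  - simpl. apply Cmult_neq_0; [apply IH; intros k Hk; apply H; lia|apply H; lia].
Qed.

Lemma poch_1 (n : nat) : poch 1 n = INR (fact n).
Proof.
  induction n as [|n IH]; [reflexivity|]. rewrite fact_S_C. simpl poch. rewrite IH. ring.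
Qed.

(** Cauchy's formula supplies an expansion on each smaller disc. The second premise, in practice a
    recurrence read off a differential equation, forces its coefficients, so one series serves on
    the whole disc. *)
Lemma pser_of_smooth (f f' : C -> C) (c : nat -> C) (R0 : R) :
  (forall z, (Cmod z < R0)%R -> Csmooth f f' z) ->
  (forall rho c', (0 < rho < R0)%R -> pser c' rho f -> pser (dcoef c') rho f' -> forall n, c' n = c n) ->
  pser c R0 f.
Proof.
  intros Hf H z Hz. assert (P := Cmod_ge_0 z).
  assert (Hr : (0 < (R0 + Cmod z) / 2 < R0)%R) by lra.
  destruct (Csmooth_pser f f' R0 _ Hr Hf) as [c' Hc].
  assert (E := H _ c' Hr Hc (pser_deriv _ _ _ _ Hc (fun w Hw => proj1 (Hf w ltac:(lra))))).
  apply (Cseries_ext (fun n => c' n * z ^ n)); [intros n; rewrite E; reflexivity|].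
  apply Hc. lra.
Qed.

Lemma Csmooth_binomial (al x : C) : slit_plane x ->
  Csmooth (fun x => Cpower (1 - x) (- al)) (fun x => al * / (1 - x) * Cpower (1 - x) (- al)) x.
Proof.
  intros H.
  refine (Csmooth_ext _ _ _ _ _ (fun y => eq_refl) _
    (Csmooth_comp _ _ (fun y => 1 - y) (fun _ => 0 + - RtoC 1) x
      (Csmooth_Cpower (1 - x) (- al) (slit_off_cut x H))
      (Csmooth_plus _ _ _ _ _ (Csmooth_const 1 x) (Csmooth_opp _ _ _ (Csmooth_id x))))).
  intros v. cbv beta. ring.
Qed.

(** The equation (1 - x) F' = al F gives (n + 1) c_(n+1) = (al + n) c_n. *)
Lemma binomial_pser (al : C) :
  pser (fun n => poch al n / INR (fact n)) 1 (fun x => Cpower (1 - x) (- al)).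
Proof.
  apply (pser_of_smooth _ (fun x => al * / (1 - x) * Cpower (1 - x) (- al))).
  { intros z Hz. apply Csmooth_binomial, disc_slit, Hz. }
  intros rho c Hr Hc Hd.
  assert (E := pser_unique (fun n => dcoef c n + -1 * shift1 (dcoef c) n) (fun n => al * c n) rho
     (fun x => al * Cpower (1 - x) (- al)) ltac:(lra)).
  assert (E' : forall n, dcoef c n + -1 * shift1 (dcoef c) n = al * c n).
  { apply E.
    - apply (pser_ext (fun n => dcoef c n + -1 * shift1 (dcoef c) n) _ rho
        (fun x => al * / (1 - x) * Cpower (1 - x) (- al) + -1 * (x * (al * / (1 - x) * Cpower (1 - x) (- al))))).
      + reflexivity.
      + intros z Hz. field. apply slit_neq_1, disc_slit. lra.
      + apply pser_plus; [exact Hd|]. apply pser_scal, pser_mulX, Hd.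
    - apply pser_scal, Hc. }
  induction n as [|n IH].
  - rewrite <- (pser_at_0 _ _ _ Hc) by lra. simpl.
    replace (1 - 0) with (RtoC 1) by ring. rewrite Cpower_one_base. field.
  - specialize (E' n). rewrite shift1_dcoef in E'. unfold dcoef in E'.
    rewrite fact_S_C. simpl poch. assert (N := INR_S_neq_0 n). rewrite INR_S_C in *.
    assert (NF := INR_fact_neq_0_C n).
    replace (c (S n)) with (((INR n + 1) * c (S n) + -1 * (INR n * c n) + INR n * c n) / (INR n + 1)) by (field; exact N).
    rewrite E', IH. field. split; assumption.
Qed.

Lemma exp_pser (R0 : R) : pser (fun n => / INR (fact n)) R0 Cexp.
Proof.
  apply (pser_of_smooth _ Cexp); [intros z _; apply Csmooth_Cexp|].
  intros rho c Hr Hc Hd.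
  assert (E := pser_unique (dcoef c) c rho Cexp ltac:(lra) Hd Hc).
  induction n as [|n IH].
  - rewrite <- (pser_at_0 _ _ _ Hc) by lra. rewrite Cexp_0. simpl. field.
  - specialize (E n). unfold dcoef in E. rewrite fact_S_C.
    assert (N := INR_S_neq_0 n). rewrite INR_S_C in *. assert (NF := INR_fact_neq_0_C n).
    replace (c (S n)) with ((INR n + 1) * c (S n) / (INR n + 1)) by (field; exact N).
    rewrite E, IH. field. split; assumption.
Qed.

(** On coefficients x d/dx + beta is multiplication by beta + n. This is the source of the factor
    beta/(beta + n), which is (beta)_n/(beta + 1)_n. *)
Lemma euler_ode_coef (W W' S : C -> C) (w s : nat -> C) (beta : C) (rho : R) :
  (0 < rho)%R -> pser w rho W -> pser (dcoef w) rho W' -> pser s rho S ->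
  (forall x, (Cmod x < rho)%R -> x * W' x + beta * W x = beta * S x) ->
  forall n, (beta + INR n) * w n = beta * s n.
Proof.
  intros Hr HW HW' HS E n.
  assert (X := pser_unique (fun n => shift1 (dcoef w) n + beta * w n) (fun n => beta * s n) rho
     (fun x => beta * S x) Hr).
  specialize (fun H => X H (pser_scal beta _ _ _ HS) n). cbv beta in X. rewrite shift1_dcoef in X.
  rewrite <- X; [ring|].
  apply (pser_ext (fun n => shift1 (dcoef w) n + beta * w n) _ rho (fun x => x * W' x + beta * W x));
    [reflexivity|exact E|].
  apply pser_plus; [apply pser_mulX, HW'|apply pser_scal, HW].
Qed.

Definition pfaff (x : C) : C := x * / (x - 1).

(** Because 1 - x/(x - 1) = 1/(1 - x), a value on the cut makes 1/(1 - x) a negative real, and then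
    x itself exceeds 1. *)
Lemma pfaff_slit (x : C) : slit_plane x -> slit_plane (pfaff x).
Proof.
  intros H [H1 H2]. assert (N := slit_neq_1 x H).
  assert (N' := slit_minus_1_neq_0 x H).
  set (r := (1 - Re (pfaff x))%R).
  assert (E : / (1 - x) = RtoC r).
  { replace (/ (1 - x)) with (1 - pfaff x) by (unfold pfaff; field; split; assumption).
    apply injective_projections.
    - exact (Re_minus 1 (pfaff x)).
    - apply (eq_trans (Im_minus 1 (pfaff x))). rewrite H1. simpl. ring. }
  assert (Nr : r <> 0%R).
  { intros X. rewrite X in E. apply C1_nz. replace (RtoC 1) with ((1 - x) * / (1 - x)) by (field; exact N).
    rewrite E. ring. }
  assert (Hr : (r < 0)%R) by (unfold r in *; lra).
  assert (X : x = RtoC (1 - / r)).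
  { rewrite RtoC_minus, RtoC_inv, <- E by exact Nr. field. exact N. }
  apply H. rewrite X, re_RtoC, im_RtoC. split; [reflexivity|].
  assert (/ r < 0)%R by (apply Rinv_lt_0_compat, Hr). lra.
Qed.

Section Gauss.
Variables (A beta : C).
Hypothesis Hbeta : forall n : nat, beta + INR n <> 0.

Lemma Hbeta_S (n : nat) : beta + INR (S n) <> 0.
Proof. apply Hbeta. Qed.

Lemma beta_poch_neq_0 (n : nat) : poch (beta + 1) n <> 0.
Proof.
  apply poch_neq_0. intros k _. replace (beta + 1 + INR k) with (beta + INR (S k)); [apply Hbeta|].
  rewrite INR_S_C. ring.
Qed.

Notation G := (gauss1 A beta).

Lemma gauss1_0 : G 0 = 1.
Proof.
  unfold gauss1, root1m. replace (1 - 0) with (RtoC 1) by ring. rewrite Cpower_one_base.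
  replace ((1 - 1) * / (1 + 1)) with (RtoC 0) by ring. rewrite koebe_sum_0 by apply Hbeta_S. ring.
Qed.

(** The equation turns into (beta + n + 1) c_(n+1) = (A + n) c_n; the hypergeometric factor (1)_n /
    n! is 1. *)
Lemma gauss1_pser : pser (fun n => poch A n / poch (beta + 1) n) 1 G.
Proof.
  destruct (gauss1_ode A beta Hbeta_S) as [G' HG].
  apply (pser_of_smooth _ G').
  { intros z Hz. apply HG, disc_slit, Hz. }
  intros rho c Hr Hc Hd.
  assert (E : forall n, shift1 (dcoef c) n + (-1 * shift1 (shift1 (dcoef c)) n + (beta * c n + - A * shift1 c n))
     = match n with O => beta | S _ => 0 end).
  { apply (pser_unique _ _ rho (fun _ => beta)); [lra| |apply pser_const].
    apply (pser_ext (fun n => shift1 (dcoef c) n + (-1 * shift1 (shift1 (dcoef c)) n + (beta * c n + - A * shift1 c n))) _ rho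
      (fun y => y * G' y + (-1 * (y * (y * G' y)) + (beta * G y + - A * (y * G y))))).
    - reflexivity.
    - intros y Hy. etransitivity; [|exact (proj2 (HG y (disc_slit y ltac:(lra))))]. ring.
    - apply pser_plus; [apply pser_mulX, Hd|]. apply pser_plus; [apply pser_scal, pser_mulX, pser_mulX, Hd|].
      apply pser_plus; [apply pser_scal, Hc|apply pser_scal, pser_mulX, Hc]. }
  induction n as [|n IH].
  - rewrite <- (pser_at_0 _ _ _ Hc) by lra. rewrite gauss1_0. simpl. field.
  - specialize (E (S n)). rewrite shift1_dcoef in E. cbn [shift1] in E. rewrite shift1_dcoef in E.
    simpl poch. assert (N := Hbeta (S n)). assert (NP := beta_poch_neq_0 n).
    replace (c (S n)) with ((INR (S n) * c (S n) + (-1 * (INR n * c n) + (beta * c (S n) + - A * c n)) + (A + INR n) * c n) / (beta + INR (S n)))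
      by (field; exact N).
    rewrite E, IH. rewrite INR_S_C in *. field. repeat split; try assumption.
    intros X. apply N. rewrite <- X. ring.
Qed.

Lemma gauss1_pFq (y : C) : slit_plane y -> pFq (RtoC 1 :: A :: nil) (beta + 1 :: nil) y = G y.
Proof.
  apply pFq_slit_eq; [reflexivity|].
  destruct (gauss1_ode A beta Hbeta_S) as [G' HG]. split.
  - apply (Csmooth_analytic_slit _ G'). intros z Hz. apply HG, Hz.
  - intros z Hz. apply (Cseries_ext (fun n => poch A n / poch (beta + 1) n * z ^ n)); [|apply gauss1_pser, Hz].
    intros n. unfold pFq_term. simpl. rewrite poch_1.
    field. split; [apply INR_fact_neq_0_C|apply beta_poch_neq_0].
Qed.

(** The Pfaff transform of 2F1(1, A; beta + 1; .); its expansion turns out to be that of 2F1(A,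
    beta; beta + 1; x). *)
Definition pfaff_gauss1 (x : C) : C := Cpower (1 - x) (- A) * G (x / (x - 1)).

Lemma pfaff_gauss1_ode : exists W', forall x, slit_plane x ->
  Csmooth pfaff_gauss1 W' x /\
  x * W' x + beta * pfaff_gauss1 x = beta * Cpower (1 - x) (- A).
Proof.
  destruct (gauss1_ode A beta Hbeta_S) as [G' HG].
  set (q := fun x => x * / (x - 1)).
  set (q' := fun x => 1 * / (x - 1) + x * ((1 + - 0) * - / ((x - 1) * (x - 1)))).
  set (P := fun x => Cpower (1 - x) (- A)).
  exists (fun x => A * / (1 - x) * P x * G (q x) + P x * (q' x * G' (q x))).
  intros x Hx. assert (N := slit_neq_1 x Hx).
  assert (N' := slit_minus_1_neq_0 x Hx).
  destruct (HG (q x) (pfaff_slit x Hx)) as [S1 O1].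
  split.
  - apply (Csmooth_mult P); [apply Csmooth_binomial, Hx|].
    apply (Csmooth_comp G G' q q'); [exact S1|].
    apply (Csmooth_mult (fun x => x) (fun _ => 1)); [apply Csmooth_id|].
    apply (Csmooth_inv (fun x => x - 1) (fun x => 1 + - 0)); [exact N'|].
    apply Csmooth_plus; [apply Csmooth_id|apply (Csmooth_opp (fun _ => 1)), Csmooth_const].
  - unfold pfaff_gauss1. change (x / (x - 1)) with (q x). change (Cpower (1 - x) (- A)) with (P x).
    (* With q = x/(x - 1) one has x q' = q (1 - q) and x A/(1 - x) = - A q, so the left-hand side is
       P times that of the equation for G at q. *)
    transitivity (P x * (q x * (1 - q x) * G' (q x) + (beta - A * q x) * G (q x))).
    + set (g := G (q x)). set (dg := G' (q x)). unfold q', q. field. split; assumption.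
    + rewrite O1. ring.
Qed.

Lemma pfaff_gauss1_pser : pser (fun n => poch A n / INR (fact n) * (beta / (beta + INR n))) 1 pfaff_gauss1.
Proof.
  destruct pfaff_gauss1_ode as [W' HW].
  apply (pser_of_smooth _ W').
  { intros z Hz. apply HW, disc_slit, Hz. }
  intros rho c Hr Hc Hd n.
  assert (E := euler_ode_coef pfaff_gauss1 W' (fun x => Cpower (1 - x) (- A)) c _ beta rho ltac:(lra) Hc Hd
     (pser_shrink _ 1 rho _ ltac:(lra) (binomial_pser A))
     (fun x Hx => proj2 (HW x (disc_slit x ltac:(lra)))) n).
  cbv beta in E.
  replace (c n) with ((beta + INR n) * c n / (beta + INR n)) by (field; apply Hbeta).
  rewrite E. field. split; [apply Hbeta|apply INR_fact_neq_0_C].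
Qed.

(** * Kummer's function 1F1(1; beta + 1; -x) *)

Definition kummer_coef (n : nat) : C := (-1) ^ n / poch (beta + 1) n.

Lemma kummer_coef_S (n : nat) : kummer_coef (S n) = - kummer_coef n / (beta + INR (S n)).
Proof.
  unfold kummer_coef. simpl Cpow. simpl poch. assert (N := Hbeta (S n)). rewrite INR_S_C in *.
  field. repeat split; first [exact N|apply beta_poch_neq_0|intros X; apply N; rewrite <- X; ring].
Qed.

(** The ratio of consecutive terms is rho/|beta + n + 1|, at most 1 once n + 1 exceeds rho + |beta|,
    so the maximum over the first terms is a bound throughout. *)
Lemma kummer_bound (rho : R) : (0 < rho)%R ->
  exists K, forall n, (Cmod (kummer_coef n) * rho ^ n <= K)%R.
Proof.
  intros Hr. destruct (nfloor_ex (rho + Cmod beta)) as [N HN].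
  { assert (P := Cmod_ge_0 beta). lra. }
  destruct (finite_upper_bound (fun n => Cmod (kummer_coef n) * rho ^ n)%R N) as [K [HK BK]].
  exists K. intros n. destruct (Compare_dec.le_lt_dec n N) as [L|L]; [exact (BK n L)|].
  replace n with (N + (n - N))%nat by lia. generalize (n - N)%nat as j. clear L.
  induction j as [|j IH]; [rewrite Nat.add_0_r; exact (BK N (Nat.le_refl N))|].
  apply Rle_trans with (2 := IH). rewrite Nat.add_succ_r, kummer_coef_S, Cmod_div by apply Hbeta.
  rewrite Cmod_opp, <- tech_pow_Rmult.
  assert (HB : (rho <= Cmod (beta + INR (S (N + j))))%R).
  { assert (T := Cmod_triangle (beta + INR (S (N + j))) (- beta)). rewrite Cmod_opp in T.
    replace (beta + INR (S (N + j)) + - beta) with (RtoC (INR (S (N + j)))) in T by ring.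
    rewrite Cmod_R, Rabs_pos_eq in T by apply pos_INR.
    assert (I := le_INR (S N) (S (N + j)) ltac:(lia)). rewrite S_INR in I. lra. }
  assert (P : (0 <= Cmod (kummer_coef (N + j)) * rho ^ (N + j))%R).
  { apply Rmult_le_pos; [apply Cmod_ge_0|apply pow_le; lra]. }
  apply (Rmult_le_reg_r (Cmod (beta + INR (S (N + j))))); [lra|].
  unfold Rdiv.
  replace (Cmod (kummer_coef (N + j)) * / Cmod (beta + INR (S (N + j))) * (rho * rho ^ (N + j)) * Cmod (beta + INR (S (N + j))))%R
    with (Cmod (kummer_coef (N + j)) * rho ^ (N + j) * rho)%R by (field; lra).
  apply Rmult_le_compat_l; assumption.
Qed.

Definition kummer1 (x : C) : C := Csum (fun n => kummer_coef n * x ^ n).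

Lemma kummer1_pser (rho : R) : pser kummer_coef rho kummer1.
Proof.
  intros x Hx. assert (P := Cmod_ge_0 x).
  destruct (kummer_bound rho) as [K HK]; [lra|].
  exact (pser_of_bound kummer_coef rho K ltac:(lra) HK x Hx).
Qed.

Lemma kummer1_pFq (x : C) : pFq (RtoC 1 :: nil) (beta + 1 :: nil) (- x) = kummer1 x.
Proof.
  apply pFq_entire_eq; [discriminate|].
  apply (Cseries_ext (fun n => kummer_coef n * x ^ n)).
  - intros n. unfold pFq_term, kummer_coef. simpl. rewrite poch_1.
    replace (- x) with (-1 * x) by ring. rewrite Cpow_mult_l.
    field. split; [apply INR_fact_neq_0_C|apply beta_poch_neq_0].
  - apply (kummer1_pser (Cmod x + 1)). lra.
Qed.

Lemma kummer1_ode (x : C) :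
  x * dsum kummer_coef x + (beta + x) * kummer1 x = beta.
Proof.
  assert (HK := kummer1_pser (Cmod x + 1)).
  assert (HS := pser_plus _ _ _ _ _ (pser_mulX _ _ _ (pser_dsum _ _ _ HK))
    (pser_plus _ _ _ _ _ (pser_scal beta _ _ _ HK) (pser_mulX _ _ _ HK)) x ltac:(lra)).
  cbv beta in HS.
  transitivity (x * dsum kummer_coef x + (beta * kummer1 x + x * kummer1 x)); [ring|].
  apply (Cseries_unique _ _ _ HS). apply Cseries_first.
  - unfold kummer_coef. simpl. field.
  - intros n. rewrite shift1_dcoef, kummer_coef_S. cbn [shift1]. field. apply Hbeta.
Qed.

Definition exp_kummer1 (x : C) : C := Cexp x * kummer1 x.

(** Multiplying the equation of [kummer1] by e^x gives x W' + beta W = beta e^x. This is Kummer's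
    transformation to 1F1(beta; beta + 1; x). *)
Lemma exp_kummer1_pser (R0 : R) : pser (fun n => / INR (fact n) * (beta / (beta + INR n))) R0 exp_kummer1.
Proof.
  assert (HS : forall x, Csmooth exp_kummer1 (fun x => Cexp x * kummer1 x + Cexp x * dsum kummer_coef x) x).
  { intros x. apply Csmooth_mult; [apply Csmooth_Cexp|].
    apply (pser_Csmooth _ (Cmod x + 1)); [apply kummer1_pser|lra]. }
  apply (pser_of_smooth _ (fun x => Cexp x * kummer1 x + Cexp x * dsum kummer_coef x)).
  { intros z _. apply HS. }
  intros rho c Hr Hc Hd n.
  assert (E := euler_ode_coef _ _ Cexp c _ beta rho ltac:(lra) Hc Hd (exp_pser rho)).
  replace (c n) with ((beta + INR n) * c n / (beta + INR n)) by (field; apply Hbeta).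
  rewrite E.
  - field. split; [apply Hbeta|apply INR_fact_neq_0_C].
  - intros x _. unfold exp_kummer1.
    transitivity (Cexp x * (x * dsum kummer_coef x + (beta + x) * kummer1 x)); [ring|].
    rewrite kummer1_ode. ring.
Qed.

End Gauss.

(** * Newton expansion of the parameter ratio *)

Lemma Csum_n_O (u : nat -> C) : sum_n u 0 = u O :> C.
Proof. apply sum_O. Qed.

Lemma Csum_n_S (u : nat -> C) (n : nat) : sum_n u (S n) = sum_n u n + u (S n) :> C.
Proof. rewrite sum_Sn. reflexivity. Qed.

Lemma Csum_n_ext (u v : nat -> C) (n : nat) :
  (forall k, (k <= n)%nat -> u k = v k) -> sum_n u n = sum_n v n :> C.
Proof. intros H. apply sum_n_ext_loc, H. Qed.

Lemma Csum_n_plus (u v : nat -> C) (n : nat) :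
  sum_n (fun k => u k + v k) n = sum_n u n + sum_n v n :> C.
Proof.
  induction n as [|n IH]; [rewrite !Csum_n_O; reflexivity|]. rewrite !Csum_n_S, IH. ring.
Qed.

Lemma Csum_n_scal (c : C) (u : nat -> C) (n : nat) :
  sum_n (fun k => c * u k) n = c * sum_n u n :> C.
Proof.
  induction n as [|n IH]; [rewrite !Csum_n_O; reflexivity|]. rewrite !Csum_n_S, IH. ring.
Qed.

Lemma Cpow_m1_sqr (k : nat) : (-1) ^ k * (-1) ^ k = 1.
Proof. rewrite <- Cpow_mult_l. replace (-1 * -1) with (RtoC 1) by ring. apply Cpow_1_l. Qed.

Fixpoint falling (x : C) (k : nat) : C :=
  match k with O => 1 | S k => falling x k * (x - INR k) end.

Lemma falling_opp (b : C) (k : nat) : (-1) ^ k * poch b k = falling (- b) k.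
Proof.
  induction k as [|k IH]; simpl; [ring|]. rewrite <- IH. ring.
Qed.

Lemma falling_succ (x : C) (j : nat) : falling (x + 1) (S j) = (x + 1) * falling x j.
Proof.
  induction j as [|j IH]; [simpl; ring|].
  change (falling (x + 1) (S (S j))) with (falling (x + 1) (S j) * (x + 1 - INR (S j))).
  rewrite IH, INR_S_C. simpl falling. ring.
Qed.

Lemma falling_eq_0 (n j : nat) : (n < j)%nat -> falling (INR n) j = 0.
Proof.
  induction j as [|j IH]; intros H; [lia|]. simpl.
  destruct (Nat.eq_dec n j) as [->|N]; [ring|]. rewrite IH by lia. ring.
Qed.

Lemma falling_fact (j l : nat) : falling (INR (j + l)) j * INR (fact l) = INR (fact (j + l)).
Proof.
  revert l. induction j as [|j IH]; intros l; [simpl; ring|].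
  specialize (IH (S l)). rewrite fact_S_C in IH.
  replace (S j + l)%nat with (j + S l)%nat by lia. rewrite <- IH. simpl falling.
  rewrite plus_INR, RtoC_plus, INR_S_C. ring.
Qed.

Lemma poch_add (z : C) (n k : nat) : poch z (n + k) = poch z n * poch (z + INR n) k.
Proof.
  induction k as [|k IH]; [rewrite Nat.add_0_r; simpl; ring|].
  rewrite Nat.add_succ_r. simpl poch. rewrite IH, plus_INR, RtoC_plus. ring.
Qed.

Lemma poch_left (z : C) (n : nat) : poch z (S n) = z * poch (z + 1) n.
Proof. transitivity (poch z (1 + n)); [reflexivity|]. rewrite poch_add. simpl. replace (z + 0) with z by ring. ring. Qed.

(* [(-1)^i] times a binomial coefficient, in the form in which it occurs in [Ccoef]. *)
Definition diff_coef (k i : nat) : C := poch (- RtoC (INR k)) i / INR (fact i).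

Lemma diff_coef_pascal (k i : nat) : diff_coef (S k) (S i) = diff_coef k (S i) - diff_coef k i.
Proof.
  unfold diff_coef. rewrite poch_left, fact_S_C. cbn [poch].
  replace (- RtoC (INR (S k)) + 1) with (- RtoC (INR k)) by (rewrite INR_S_C; ring).
  rewrite INR_S_C. assert (N := INR_S_neq_0 i). rewrite INR_S_C in N. assert (NF := INR_fact_neq_0_C i).
  field. split; assumption.
Qed.

Lemma diff_coef_0 (k i : nat) : (k < i)%nat -> diff_coef k i = 0.
Proof.
  intros H. unfold diff_coef. replace (poch (- RtoC (INR k)) i) with (RtoC 0).
  - unfold Cdiv. ring.
  - replace i with (S k + (i - S k))%nat by lia. rewrite poch_add. cbn [poch]. ring.
Qed.

(** This is (-1)^k times the k-th forward difference of Q at 0. *)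
Definition findiff (k : nat) (Q : nat -> C) : C := sum_n (fun i => diff_coef k i * Q i) k.

(** Pascal's rule and summation by parts; the boundary term vanishes because the coefficient of
    index k + 1 is 0. *)
Lemma findiff_S (k : nat) (Q : nat -> C) : findiff (S k) Q = findiff k (fun i => Q i - Q (S i)).
Proof.
  unfold findiff.
  assert (H : forall n, sum_n (fun i => diff_coef (S k) i * Q i) (S n)
    = sum_n (fun i => diff_coef k i * (Q i - Q (S i))) n + diff_coef k (S n) * Q (S n) :> C).
  { induction n as [|n IH].
    - rewrite Csum_n_S, !Csum_n_O, diff_coef_pascal. unfold diff_coef. simpl. field.
    - rewrite Csum_n_S, IH, (Csum_n_S _ n), diff_coef_pascal. ring. }
  rewrite H, (diff_coef_0 k (S k)) by lia. ring.
Qed.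

(** A forward difference lowers the order of a falling factorial from j + 1 to j with the factor j +
    1, and at 0 only order 0 survives. *)
Lemma findiff_falling (k : nat) : forall j,
  findiff k (fun i => falling (INR i) j) = if Nat.eq_dec j k then (-1) ^ k * INR (fact k) else 0.
Proof.
  induction k as [|k IH]; intros j.
  - unfold findiff. rewrite Csum_n_O. unfold diff_coef. simpl.
    destruct j as [|j]; simpl; [field|].
    change (INR 0) with 0%R. assert (E := falling_eq_0 0 (S j) ltac:(lia)). simpl in E. rewrite E. field.
  - rewrite findiff_S. destruct j as [|j].
    + destruct (Nat.eq_dec 0 (S k)) as [X|_]; [discriminate|].
      unfold findiff. rewrite (Csum_n_ext _ (fun i => 0 * 0)) by (intros i _; simpl; ring).
      rewrite Csum_n_scal. ring.
    + assert (E : findiff k (fun i => falling (INR i) (S j) - falling (INR (S i)) (S j))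
        = - (RtoC (INR j) + 1) * findiff k (fun i => falling (INR i) j)).
      { unfold findiff. rewrite <- Csum_n_scal. apply Csum_n_ext. intros i _.
        rewrite INR_S_C, falling_succ. simpl falling. ring. }
      rewrite E, IH. destruct (Nat.eq_dec j k) as [->|N]; destruct (Nat.eq_dec (S _) (S k)) as [E'|N'];
        try lia; [|ring].
      rewrite fact_S_C. simpl. ring.
Qed.

(** Coefficients beyond N are made to vanish so that [newton_coef] holds for every k and
    multiplication by a linear factor can refer to g (S N). *)
Definition newton (N : nat) (g : nat -> C) (Q : C -> C) : Prop :=
  (forall k, (N < k)%nat -> g k = 0) /\ forall x, Q x = sum_n (fun k => g k * falling x k) N.

Lemma newton_coef (N k : nat) (g : nat -> C) (Q : C -> C) :
  newton N g Q -> g k = (-1) ^ k / INR (fact k) * findiff k (fun i => Q (INR i)).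
Proof.
  intros [G0 GQ].
  assert (E : findiff k (fun i => Q (INR i)) = g k * ((-1) ^ k * INR (fact k))).
  { assert (H : forall n, findiff k (fun i => sum_n (fun j => g j * falling (INR i) j) n)
      = if Compare_dec.le_dec k n then g k * ((-1) ^ k * INR (fact k)) else 0).
    { assert (T : forall j, findiff k (fun i => g j * falling (INR i) j)
         = g j * if Nat.eq_dec j k then (-1) ^ k * INR (fact k) else 0).
      { intros j. rewrite <- findiff_falling. unfold findiff. rewrite <- Csum_n_scal.
        apply Csum_n_ext. intros i _. ring. }
      induction n as [|n IH].
      - transitivity (findiff k (fun i => g O * falling (INR i) O)).
        + apply Csum_n_ext. intros i _. rewrite Csum_n_O. reflexivity.
        + rewrite T. destruct (Nat.eq_dec 0 k), (Compare_dec.le_dec k 0); try lia; [subst; reflexivity|ring].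
      - transitivity (findiff k (fun i => sum_n (fun j => g j * falling (INR i) j) n)
            + findiff k (fun i => g (S n) * falling (INR i) (S n))).
        + unfold findiff. rewrite <- Csum_n_plus. apply Csum_n_ext. intros i _. rewrite Csum_n_S. ring.
        + rewrite IH, T. destruct (Nat.eq_dec (S n) k), (Compare_dec.le_dec k n), (Compare_dec.le_dec k (S n));
            try lia; subst; ring. }
    transitivity (findiff k (fun i => sum_n (fun j => g j * falling (INR i) j) N)).
    - apply Csum_n_ext. intros i _. rewrite GQ. reflexivity.
    - rewrite H. destruct (Compare_dec.le_dec k N) as [L|L]; [reflexivity|]. rewrite G0 by lia. ring. }
  rewrite E.
  transitivity (g k * ((-1) ^ k * (-1) ^ k)); [rewrite Cpow_m1_sqr; ring|].
  field. apply INR_fact_neq_0_C.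
Qed.

(** x times the falling factorial of order k is the one of order k + 1 plus k times the one of order
    k. *)
Lemma newton_linear_factor (N : nat) (g : nat -> C) (Q : C -> C) (e : C) :
  newton N g Q -> exists g', newton (S N) g' (fun x => Q x * (e + x)).
Proof.
  intros [G0 GQ]. exists (fun k => shift1 g k + (INR k + e) * g k). split.
  - intros k Hk. destruct k as [|k]; [lia|]. simpl shift1. rewrite !G0 by lia. ring.
  - intros x. rewrite GQ.
    assert (H : forall n, sum_n (fun k => g k * falling x k) n * (e + x)
       = sum_n (fun k => (shift1 g k + (INR k + e) * g k) * falling x k) n + g n * falling x (S n)).
    { induction n as [|n IH].
      - rewrite !Csum_n_O. simpl. ring.
      - rewrite !Csum_n_S, Cmult_plus_distr_r, IH. cbn [shift1 falling]. ring. }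
    rewrite H, Csum_n_S. cbn [shift1]. rewrite (G0 (S N)) by lia. ring.
Qed.

Lemma newton_poch (N m : nat) (g : nat -> C) (Q : C -> C) (e : C) :
  newton N g Q -> exists g', newton (m + N) g' (fun x => poch (e + x) m * Q x).
Proof.
  intros H. induction m as [|m [g' IH]].
  - exists g. destruct H as [G0 GQ]. split; [exact G0|]. intros x. rewrite <- GQ. simpl. ring.
  - destruct (newton_linear_factor _ _ _ (e + INR m) IH) as [g2 [H0 H2]].
    exists g2. split; [exact H0|]. intros x. simpl Nat.add. rewrite <- H2. simpl poch. ring.
Qed.

Lemma newton_poch_vec (r : nat) (m : nat -> nat) (f : nat -> C) :
  exists g, newton (total r m) g (fun x => poch_vec r f x m).
Proof.
  unfold total, poch_vec, params. induction (seq 0 r) as [|j l [g IH]].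
  - exists (fun k => match k with O => 1 | S _ => 0 end). split.
    + intros k Hk. destruct k as [|k]; [simpl in Hk; lia|reflexivity].
    + intros x. simpl list_sum. rewrite Csum_n_O. simpl. ring.
  - destruct (newton_poch _ (m j) _ _ (f j) IH) as [g' H]. exists g'. exact H.
Qed.

Section Coefficients.
Variables (r : nat) (m : nat -> nat) (f : nat -> C).
Hypothesis hf : forall j : nat, (j < r)%nat -> forall n : nat, f j <> - RtoC (INR n).

Lemma f_plus_neq_0 (j n : nat) : (j < r)%nat -> f j + INR n <> 0.
Proof.
  intros Hj E. apply (hf j Hj n). replace (f j) with (f j + INR n + - RtoC (INR n)) by ring. rewrite E. ring.
Qed.

Lemma Cprod_list_neq_0 (l : list C) : (forall z, In z l -> z <> 0) -> Cprod_list l <> 0.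
Proof.
  induction l as [|z l IH]; intros H; [apply C1_nz|]. simpl. apply Cmult_neq_0.
  - apply H. left. reflexivity.
  - apply IH. intros w Hw. apply H. right. exact Hw.
Qed.

Lemma params_poch_neq_0 (n : nat) : Cprod_list (map (fun z => poch z n) (params r f)) <> 0.
Proof.
  apply Cprod_list_neq_0. intros z Hz. apply in_map_iff in Hz. destruct Hz as [w [<- Hw]].
  apply in_map_iff in Hw. destruct Hw as [j [<- Hj]]. apply in_seq in Hj.
  apply poch_neq_0. intros k _. apply f_plus_neq_0. lia.
Qed.

Lemma poch_vec_0_neq_0 : poch_vec r f 0 m <> 0.
Proof.
  apply Cprod_list_neq_0. intros z Hz. apply in_map_iff in Hz. destruct Hz as [j [<- Hj]].
  apply in_seq in Hj. apply poch_neq_0. intros k _.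
  replace (f j + 0 + INR k) with (f j + INR k) by ring. apply f_plus_neq_0. lia.
Qed.

(** Factor by factor, (f + m)_n (f)_m = (f)_(n+m) = (f)_n (f + n)_m. The right-hand side is a
    polynomial in n, which can be continued to complex arguments. *)
Lemma shifted_ratio (n : nat) :
  Cprod_list (map (fun z => poch z n) (shifted r f m)) / Cprod_list (map (fun z => poch z n) (params r f))
  = poch_vec r f (INR n) m / poch_vec r f 0 m.
Proof.
  assert (E : Cprod_list (map (fun z => poch z n) (shifted r f m)) * poch_vec r f 0 m
     = Cprod_list (map (fun z => poch z n) (params r f)) * poch_vec r f (INR n) m).
  { unfold shifted, params, poch_vec, params. induction (seq 0 r) as [|j l IH]; [reflexivity|].
    simpl.
    replace (f j + 0) with (f j) by ring.
    assert (Ej : poch (f j + INR (m j)) n * poch (f j) (m j) = poch (f j) n * poch (f j + INR n) (m j)).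
    { rewrite <- (poch_add (f j) n), Nat.add_comm, poch_add. ring. }
    match type of IH with ?p * ?q = ?s * ?t =>
      transitivity (poch (f j + INR (m j)) n * poch (f j) (m j) * (p * q)); [ring|]; rewrite IH, Ej; ring end. }
  assert (N1 := params_poch_neq_0 n). assert (N2 := poch_vec_0_neq_0).
  match type of E with ?p * ?q = ?s * ?t => transitivity (p * q / (s * q)); [field; split; assumption|] end.
  rewrite E. field. split; assumption.
Qed.

Lemma Ccoef_findiff (k : nat) :
  Ccoef r f m k = (-1) ^ k / INR (fact k) * findiff k (fun i => poch_vec r f (INR i) m / poch_vec r f 0 m).
Proof.
  unfold Ccoef, findiff. f_equal. apply Csum_n_ext. intros i _.
  rewrite <- shifted_ratio. unfold pFq_term, diff_coef. simpl. rewrite Cpow_1_l. field.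
  split; [apply params_poch_neq_0|apply INR_fact_neq_0_C].
Qed.

(** [Ccoef] samples the polynomial only at integers, yet the expansion holds at every complex x,
    which gives access to x = -b. *)
Lemma poch_vec_newton (x : C) :
  poch_vec r f x m / poch_vec r f 0 m = sum_n (fun k => Ccoef r f m k * falling x k) (total r m).
Proof.
  destruct (newton_poch_vec r m f) as [g H].
  assert (G := fun k => newton_coef _ k _ _ H). destruct H as [_ H]. rewrite H.
  unfold Cdiv at 1. rewrite Cmult_comm, <- Csum_n_scal. apply Csum_n_ext. intros k _.
  rewrite Ccoef_findiff, G. unfold findiff.
  rewrite (Csum_n_ext (fun i => diff_coef k i * (poch_vec r f (INR i) m / poch_vec r f 0 m))
     (fun i => / poch_vec r f 0 m * (diff_coef k i * poch_vec r f (INR i) m))) by (intros i _; unfold Cdiv; ring).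
  rewrite Csum_n_scal. unfold Cdiv. ring.
Qed.

(** * Telescoping of the inner sums *)

Variable b : C.
Hypothesis hb : forall n : nat, b + 1 <> - RtoC (INR n).
Hypothesis hM : (1 <= total r m)%nat.

Definition partial_coef_sum (j : nat) : C := sum_n (fun k => (-1) ^ k * poch b k * Ccoef r f m k) j.

Lemma b_plus_S_neq_0 (n : nat) : b + INR (S n) <> 0.
Proof.
  intros E. apply (hb n). replace (b + 1) with (b + INR (S n) + - RtoC (INR n)) by (rewrite INR_S_C; ring).
  rewrite E. ring.
Qed.

Lemma b_poch_neq_0 (n : nat) : poch (b + 1) n <> 0.
Proof.
  apply poch_neq_0. intros k _. replace (b + 1 + INR k) with (b + INR (S k)) by (rewrite INR_S_C; ring).
  apply b_plus_S_neq_0.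
Qed.

Definition newton_quot (j : nat) : C := partial_coef_sum j / poch (b + 1) j.

(** Since (b)_(j+1) = b (b + 1)_j, the new summand loses its Pochhammer symbol upon division and
    keeps the factor b. *)
Lemma newton_quot_rec (j : nat) :
  (b + INR (S j)) * newton_quot (S j) = newton_quot j + (-1) ^ S j * b * Ccoef r f m (S j).
Proof.
  unfold newton_quot, partial_coef_sum. rewrite Csum_n_S, poch_left.
  assert (N := b_plus_S_neq_0 j). assert (NP := b_poch_neq_0 j).
  simpl poch. rewrite INR_S_C in *. field. repeat split; try assumption.
  intros X. apply N. rewrite <- X. ring.
Qed.

(** With (b + x) F_j = F_(j+1) + (b + j) F_j for the falling factorials F_j of x, the recurrence for
    [newton_quot] cancels everything but the Newton sum and the last term. *)
Lemma newton_quot_telescope (x : C) (n : nat) :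
  (b + x) * sum_n (fun j => (-1) ^ j * newton_quot j * falling x j) n
  = b * sum_n (fun k => Ccoef r f m k * falling x k) n + (-1) ^ n * newton_quot n * falling x (S n).
Proof.
  induction n as [|n IH].
  - rewrite !Csum_n_O. unfold newton_quot, partial_coef_sum. rewrite Csum_n_O. simpl. field.
  - rewrite !Csum_n_S, Cmult_plus_distr_l, IH.
    change (falling x (S (S n))) with (falling x (S n) * (x - INR (S n))).
    transitivity (b * sum_n (fun k => Ccoef r f m k * falling x k) n + (-1) ^ n * newton_quot n * falling x (S n)
      + (-1) ^ S n * falling x (S n) * ((b + INR (S n)) * newton_quot (S n))
      + (-1) ^ S n * newton_quot (S n) * (falling x (S n) * (x - INR (S n)))); [ring|].
    rewrite newton_quot_rec.
    transitivity (b * sum_n (fun k => Ccoef r f m k * falling x k) n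
      + ((-1) ^ S n * (-1) ^ S n) * (b * Ccoef r f m (S n) * falling x (S n))
      + (-1) ^ S n * newton_quot (S n) * (falling x (S n) * (x - INR (S n)))); [simpl Cpow; ring|].
    rewrite Cpow_m1_sqr. ring.
Qed.

(** As (-1)^k (b)_k is a falling factorial of -b, the full sum is the Newton expansion at x = -b. *)
Lemma partial_coef_sum_total : partial_coef_sum (total r m) = poch_vec r f (- b) m / poch_vec r f 0 m.
Proof.
  rewrite poch_vec_newton. apply Csum_n_ext. intros k _. rewrite <- falling_opp. ring.
Qed.

Lemma coefficient_identity (n : nat) :
  sum_n (fun j => (-1) ^ j * newton_quot j * falling (INR n) j) (total r m - 1)
  + (-1) ^ total r m * newton_quot (total r m) * (falling (INR n) (total r m) * ((b + INR (total r m)) / (b + INR n)))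
  = poch b n / poch (b + 1) n * (poch_vec r f (INR n) m / poch_vec r f 0 m).
Proof.
  assert (T := newton_quot_telescope (INR n) (total r m - 1)).
  rewrite (poch_vec_newton (INR n)).
  destruct (total r m) as [|M]; [lia|]. replace (S M - 1)%nat with M in * by lia.
  destruct n as [|n].
  - rewrite (falling_eq_0 0 (S M)) by lia. simpl poch. rewrite Csum_n_S, (falling_eq_0 0 (S M)) by lia.
    assert (Z : forall u : nat -> C, sum_n (fun j => u j * falling (INR 0) j) M = u O :> C).
    { intros u. generalize M as N. induction N as [|N IH].
      - rewrite Csum_n_O. simpl. ring.
      - rewrite Csum_n_S, IH, (falling_eq_0 0 (S N)) by lia. ring. }
    rewrite (Z (fun j => (-1) ^ j * newton_quot j)), (Z (Ccoef r f m)).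
    rewrite Cmult_0_l, Cmult_0_r. unfold newton_quot, partial_coef_sum. rewrite Csum_n_O. simpl. field.
  - assert (N := b_plus_S_neq_0 n). assert (NP := b_poch_neq_0 n).
    set (x := RtoC (INR (S n))) in *.
    assert (E1 : poch b (S n) / poch (b + 1) (S n) = b / (b + x)).
    { rewrite poch_left. simpl poch. replace (b + 1 + INR n) with (b + x) by (unfold x; rewrite INR_S_C; ring).
      field. split; assumption. }
    rewrite E1, Csum_n_S.
    set (s := sum_n (fun j => (-1) ^ j * newton_quot j * falling x j) M) in *.
    transitivity (((b + x) * s + (-1) ^ S M * falling x (S M) * ((b + INR (S M)) * newton_quot (S M))) / (b + x)).
    { field. exact N. }
    rewrite T, newton_quot_rec.
    transitivity ((b * sum_n (fun k => Ccoef r f m k * falling x k) M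
      + ((-1) ^ S M * (-1) ^ S M) * (b * Ccoef r f m (S M) * falling x (S M))) / (b + x)).
    { simpl Cpow. field. exact N. }
    rewrite Cpow_m1_sqr. field. exact N.
Qed.

End Coefficients.

(** * Comparison of coefficients *)

Definition shiftn (j : nat) (c : nat -> C) : nat -> C := Nat.iter j shift1 c.

Lemma pser_mulXn (j : nat) (c : nat -> C) (rho : R) (F : C -> C) :
  pser c rho F -> pser (shiftn j c) rho (fun z => z ^ j * F z).
Proof.
  intros H. induction j as [|j IH].
  - apply (pser_ext c _ rho F); [reflexivity| |exact H]. intros z _. simpl. ring.
  - apply (pser_ext (shift1 (shiftn j c)) _ rho (fun z => z * (z ^ j * F z))); [reflexivity| |].
    + intros z _. simpl. ring.
    + apply pser_mulX, IH.
Qed.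

Lemma shiftn_lt (j : nat) (c : nat -> C) : forall n, (n < j)%nat -> shiftn j c n = 0.
Proof.
  induction j as [|j IH]; intros n Hn; [lia|]. destruct n as [|n]; [reflexivity|].
  apply IH. lia.
Qed.

Lemma shiftn_add (j : nat) (c : nat -> C) (l : nat) : shiftn j c (j + l) = c l.
Proof. induction j as [|j IH]; [reflexivity|exact IH]. Qed.

(** Multiplication by x^j shifts coefficients by j; the falling factorial vanishes for n < j, so one
    formula covers all n. *)
Lemma shiftn_falling (j : nat) (k : C) (c X : nat -> C) (n : nat) :
  (forall l, k * c l = falling (INR (j + l)) j * X (j + l)%nat) ->
  k * shiftn j c n = falling (INR n) j * X n.
Proof.
  intros H. destruct (Compare_dec.le_lt_dec j n) as [L|L].
  - replace n with (j + (n - j))%nat by lia. rewrite shiftn_add. apply H.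
  - rewrite shiftn_lt, falling_eq_0 by exact L. ring.
Qed.

Lemma inv_fact_falling (j l : nat) : / INR (fact l) = falling (INR (j + l)) j * / INR (fact (j + l)).
Proof.
  rewrite <- falling_fact. assert (N := INR_fact_neq_0_C (j + l)). rewrite <- falling_fact in N.
  assert (N1 : falling (INR (j + l)) j <> 0) by (intros E; apply N; rewrite E; ring).
  field. split; [apply INR_fact_neq_0_C|exact N1].
Qed.

Lemma pser_sum_n (c : nat -> nat -> C) (F : nat -> C -> C) (rho : R) (N : nat) :
  (forall j, (j <= N)%nat -> pser (c j) rho (F j)) ->
  pser (fun n => sum_n (fun j => c j n) N) rho (fun z => sum_n (fun j => F j z) N).
Proof.
  induction N as [|N IH]; intros H.
  - apply (pser_ext (c O) _ rho (F O)); [| |apply H; lia]; intros; rewrite Csum_n_O; reflexivity.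
  - apply (pser_ext (fun n => sum_n (fun j => c j n) N + c (S N) n) _ rho
      (fun z => sum_n (fun j => F j z) N + F (S N) z)).
    + intros n. rewrite Csum_n_S. reflexivity.
    + intros z _. rewrite Csum_n_S. reflexivity.
    + apply (pser_plus (fun n => sum_n (fun j => c j n) N)); [apply IH; intros j Hj|]; apply H; lia.
Qed.

Lemma Csmooth_sum_n (F F' : nat -> C -> C) (z : C) (N : nat) :
  (forall j, Csmooth (F j) (F' j) z) ->
  Csmooth (fun z => sum_n (fun j => F j z) N) (fun z => sum_n (fun j => F' j z) N) z.
Proof.
  intros H. induction N as [|N IH].
  - apply (Csmooth_ext (F O) (F' O)); [intros w; rewrite Csum_n_O; reflexivity..|apply H].
  - apply (Csmooth_ext (fun z => sum_n (fun j => F j z) N + F (S N) z)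
       (fun z => sum_n (fun j => F' j z) N + F' (S N) z));
      [intros w; rewrite Csum_n_S; reflexivity..|].
    apply (Csmooth_plus (fun z => sum_n (fun j => F j z) N) (fun z => sum_n (fun j => F' j z) N)); [exact IH|apply H].
Qed.

Lemma total_pos (r : nat) (m : nat -> nat) :
  (1 <= r)%nat -> (forall j : nat, (j < r)%nat -> (1 <= m j)%nat) -> (1 <= total r m)%nat.
Proof.
  intros hr hm. destruct r as [|r]; [lia|]. unfold total, params. simpl.
  specialize (hm O ltac:(lia)). lia.
Qed.

(** * Explicit forms of both left-hand sides *)

Section Main.
Variables (a b : C) (r : nat) (m : nat -> nat) (f : nat -> C).
Hypothesis hf : forall j : nat, (j < r)%nat -> forall n : nat, f j <> - RtoC (INR n).
Hypothesis hb : forall n : nat, b + 1 <> - RtoC (INR n).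
Hypothesis hM : (1 <= total r m)%nat.

Notation M := (total r m).
Notation quot := (newton_quot r m f b).
Notation rat n := (poch b n / poch (b + 1) n * (poch_vec r f (INR n) m / poch_vec r f 0 m)).

(** As M >= 1, this is b plus a positive integer. The parameter beta = b + M of the tail is thus
    nonzero even when b = 0. *)
Lemma bM_neq_0 (n : nat) : b + INR M + INR n <> 0.
Proof.
  replace (b + INR M + INR n) with (b + INR (S (M - 1 + n))); [apply b_plus_S_neq_0, hb|].
  replace (S (M - 1 + n)) with (M + n)%nat by lia. rewrite plus_INR, RtoC_plus. ring.
Qed.

Lemma quot_M : quot M = poch_vec r f (- b) m / poch_vec r f 0 m / poch (b + 1) M.
Proof. unfold newton_quot. rewrite partial_coef_sum_total by assumption. reflexivity. Qed.

(** The right-hand side divided by (1-x)^a: the factor (x/(x-1))^j becomes (-1)^j x^j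
    (1-x)^(-(a+j)), and the last 2F1 becomes its Pfaff transform with parameters a + M and b + M. *)
Definition gauss_sum (x : C) : C :=
  sum_n (fun j => (-1) ^ j * quot j * poch a j * (x ^ j * Cpower (1 - x) (- (a + INR j)))) (M - 1)
  + (-1) ^ M * quot M * poch a M * (x ^ M * pfaff_gauss1 (a + INR M) (b + INR M) x).

Lemma gauss_sum_smooth : exists F', forall x, slit_plane x -> Csmooth gauss_sum F' x.
Proof.
  destruct (pfaff_gauss1_ode (a + INR M) (b + INR M) bM_neq_0) as [W' HW].
  eexists. intros x Hx. unfold gauss_sum.
  apply Csmooth_plus.
  - apply Csmooth_sum_n. intros j.
    apply Csmooth_mult; [apply Csmooth_const|]. apply Csmooth_mult; [apply (Csmooth_pow (fun x => x)), Csmooth_id|].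
    apply Csmooth_binomial, Hx.
  - apply Csmooth_mult; [apply Csmooth_const|]. apply Csmooth_mult; [apply (Csmooth_pow (fun x => x)), Csmooth_id|].
    apply HW, Hx.
Qed.

Lemma tail_weight (l : nat) :
  (b + INR M) / (b + INR M + INR l) = (b + INR M) / (b + INR (M + l)).
Proof. rewrite plus_INR, RtoC_plus, Cplus_assoc. reflexivity. Qed.

(** Because (a)_j (a + j)_(n-j) = (a)_n, the term of index j contributes (a)_n/n! times a falling
    factorial of n; what remains is [coefficient_identity]. *)
Lemma gauss_sum_pser : pser (fun n => poch a n / INR (fact n) * rat n) 1 gauss_sum.
Proof.
  assert (H := pser_plus _ _ _ _ _
    (pser_sum_n _ _ 1 (M - 1) (fun j _ => pser_scal ((-1) ^ j * quot j * poch a j) _ _ _ (pser_mulXn j _ _ _ (binomial_pser (a + INR j)))))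
    (pser_scal ((-1) ^ M * quot M * poch a M) _ _ _ (pser_mulXn M _ _ _ (pfaff_gauss1_pser (a + INR M) (b + INR M) bM_neq_0)))).
  revert H. apply pser_ext; [|reflexivity]. intros n.
  rewrite <- (coefficient_identity r m f hf b hb hM).
  rewrite Cmult_plus_distr_l, <- Csum_n_scal.
  f_equal.
  - apply Csum_n_ext. intros j _.
    assert (E := shiftn_falling j (poch a j) (fun l => poch (a + INR j) l / INR (fact l))
      (fun n => poch a n / INR (fact n)) n).
    cbv beta in E. rewrite <- Cmult_assoc, E.
    + ring.
    + intros l. unfold Cdiv. rewrite (inv_fact_falling j l), poch_add. ring.
  - assert (E := shiftn_falling M (poch a M)
      (fun l => poch (a + INR M) l / INR (fact l) * ((b + INR M) / (b + INR M + INR l)))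
      (fun n => poch a n / INR (fact n) * ((b + INR M) / (b + INR n))) n).
    cbv beta in E. rewrite <- Cmult_assoc, E.
    + ring.
    + intros l. rewrite tail_weight. unfold Cdiv. rewrite (inv_fact_falling M l), poch_add. ring.
Qed.

Lemma gauss_sum_pFq (x : C) : slit_plane x ->
  pFq (a :: b :: shifted r f m) (b + 1 :: params r f) x = gauss_sum x.
Proof.
  apply pFq_slit_eq.
  { unfold shifted, params. simpl. rewrite !length_map. reflexivity. }
  destruct gauss_sum_smooth as [F' HF]. split.
  - apply (Csmooth_analytic_slit _ F'), HF.
  - intros z Hz. apply (Cseries_ext (fun n => poch a n / INR (fact n) * rat n * z ^ n)); [|apply gauss_sum_pser, Hz].
    intros n. rewrite <- shifted_ratio by exact hf. unfold pFq_term. simpl.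
    field. repeat split; first [apply INR_fact_neq_0_C|apply b_poch_neq_0, hb|apply params_poch_neq_0, hf].
Qed.

Lemma gauss_sum_eq (x : C) : slit_plane x ->
  Cpower (1 - x) a * gauss_sum x
  = sum_n (fun j => poch a j / poch (b + 1) j * (x / (x - 1)) ^ j * partial_coef_sum r m f b j) (M - 1)
    + x ^ M * poch a M * poch_vec r f (- b) m / ((x - 1) ^ M * poch (b + 1) M * poch_vec r f 0 m)
      * gauss1 (a + INR M) (b + INR M) (x / (x - 1)).
Proof.
  intros Hx. assert (N := slit_neq_1 x Hx).
  assert (N' := slit_minus_1_neq_0 x Hx).
  assert (NP := b_poch_neq_0 b hb). assert (N0 := poch_vec_0_neq_0 r m f hf).
  (* The powers of 1 - x combine to (1-x)^(-j), and the sign turns this into a power of x - 1. *)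
  assert (K : forall j, (-1) ^ j * Cpower (1 - x) a * Cpower (1 - x) (- (a + INR j)) = / (x - 1) ^ j).
  { intros j.
    assert (P1 : Cpower (1 - x) a * Cpower (1 - x) (- (a + INR j)) * (1 - x) ^ j = 1).
    { rewrite <- (Cpower_INR (1 - x) j) by (apply slit_off_cut, Hx).
      rewrite <- !Cpower_add. transitivity (Cpower (1 - x) 0); [f_equal; ring|apply Cpower_0]. }
    assert (P2 : (x - 1) ^ j = (-1) ^ j * (1 - x) ^ j).
    { rewrite <- Cpow_mult_l. f_equal. ring. }
    assert (Nj := Cpow_nz _ j N').
    transitivity ((-1) ^ j * Cpower (1 - x) a * Cpower (1 - x) (- (a + INR j)) * (x - 1) ^ j * / (x - 1) ^ j).
    { field. exact Nj. }
    rewrite P2 at 1.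
    transitivity (((-1) ^ j * (-1) ^ j) * (Cpower (1 - x) a * Cpower (1 - x) (- (a + INR j)) * (1 - x) ^ j) * / (x - 1) ^ j); [ring|].
    rewrite P1, Cpow_m1_sqr. ring. }
  unfold gauss_sum. rewrite Cmult_plus_distr_l. f_equal.
  - rewrite <- Csum_n_scal. apply Csum_n_ext. intros j _.
    transitivity (quot j * poch a j * x ^ j * ((-1) ^ j * Cpower (1 - x) a * Cpower (1 - x) (- (a + INR j)))); [ring|].
    rewrite K. unfold newton_quot, Cdiv. rewrite Cpow_mult_l, Cpow_inv by exact N'. ring.
  - unfold pfaff_gauss1.
    transitivity (quot M * poch a M * x ^ M * ((-1) ^ M * Cpower (1 - x) a * Cpower (1 - x) (- (a + INR M)))
      * gauss1 (a + INR M) (b + INR M) (x / (x - 1))); [ring|].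
    rewrite K, quot_M. field. repeat split; first [assumption|apply NP|apply Cpow_nz, N'].
Qed.

(** The analogue of [gauss_sum], with e^x for each power of 1 - x and Kummer's transform in the
    tail. *)
Definition kummer_sum (x : C) : C :=
  sum_n (fun j => (-1) ^ j * quot j * (x ^ j * Cexp x)) (M - 1)
  + (-1) ^ M * quot M * (x ^ M * exp_kummer1 (b + INR M) x).

Lemma kummer_sum_pser (rho : R) : pser (fun n => / INR (fact n) * rat n) rho kummer_sum.
Proof.
  assert (H := pser_plus _ _ _ _ _
    (pser_sum_n _ _ rho (M - 1) (fun j _ => pser_scal ((-1) ^ j * quot j) _ _ _ (pser_mulXn j _ _ _ (exp_pser rho))))
    (pser_scal ((-1) ^ M * quot M) _ _ _ (pser_mulXn M _ _ _ (exp_kummer1_pser (b + INR M) bM_neq_0 rho)))).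
  revert H. apply pser_ext; [|reflexivity]. intros n.
  rewrite <- (coefficient_identity r m f hf b hb hM).
  rewrite Cmult_plus_distr_l, <- Csum_n_scal. f_equal.
  - apply Csum_n_ext. intros j _.
    assert (E := shiftn_falling j 1 (fun l => / INR (fact l)) (fun n => / INR (fact n)) n).
    rewrite Cmult_1_l in E. rewrite E.
    + ring.
    + intros l. rewrite Cmult_1_l. apply inv_fact_falling.
  - assert (E := shiftn_falling M 1
      (fun l => / INR (fact l) * ((b + INR M) / (b + INR M + INR l)))
      (fun n => / INR (fact n) * ((b + INR M) / (b + INR n))) n).
    rewrite Cmult_1_l in E. rewrite E.
    + ring.
    + intros l. rewrite tail_weight, (inv_fact_falling M l). ring.
Qed.

Lemma kummer_sum_pFq (x : C) : pFq (b :: shifted r f m) (b + 1 :: params r f) x = kummer_sum x.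
Proof.
  apply pFq_entire_eq.
  { unfold shifted, params. simpl. rewrite !length_map. lia. }
  apply (Cseries_ext (fun n => / INR (fact n) * rat n * x ^ n)); [|apply (kummer_sum_pser (Cmod x + 1)); lra].
  intros n. rewrite <- shifted_ratio by exact hf. unfold pFq_term. simpl.
  field. repeat split; first [apply INR_fact_neq_0_C|apply b_poch_neq_0, hb|apply params_poch_neq_0, hf].
Qed.

Lemma kummer_sum_eq (x : C) :
  Cexp (- x) * kummer_sum x
  = sum_n (fun j => (- x) ^ j / poch (b + 1) j * partial_coef_sum r m f b j) (M - 1)
    + (- x) ^ M * poch_vec r f (- b) m / (poch (b + 1) M * poch_vec r f 0 m) * kummer1 (b + INR M) x.
Proof.
  assert (NP := b_poch_neq_0 b hb). assert (N0 := poch_vec_0_neq_0 r m f hf).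
  assert (K : Cexp (- x) * Cexp x = 1).
  { rewrite <- Cexp_add, <- Cexp_0. f_equal. ring. }
  assert (X : forall j, (- x) ^ j = (-1) ^ j * x ^ j).
  { intros j. rewrite <- Cpow_mult_l. f_equal. ring. }
  unfold kummer_sum. rewrite Cmult_plus_distr_l. f_equal.
  - rewrite <- Csum_n_scal. apply Csum_n_ext. intros j _. rewrite X.
    transitivity ((-1) ^ j * quot j * x ^ j * (Cexp (- x) * Cexp x)); [ring|].
    rewrite K. unfold newton_quot, Cdiv. ring.
  - unfold exp_kummer1. rewrite X.
    transitivity ((-1) ^ M * quot M * x ^ M * kummer1 (b + INR M) x * (Cexp (- x) * Cexp x)); [ring|].
    rewrite K, quot_M. field. split; [exact N0|apply NP].
Qed.

End Main.

Theorem corollary3 (a b : C) (r : nat) (m : nat -> nat) (f : nat -> C)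
  (hr : (1 <= r)%nat)
  (hm : forall j : nat, (j < r)%nat -> (1 <= m j)%nat)
  (hf : forall j : nat, (j < r)%nat -> forall n : nat, f j <> - RtoC (INR n))
  (hb : forall n : nat, b + 1 <> - RtoC (INR n))
  (hfb : forall j : nat, (j < r)%nat ->
           forall i : nat, (i < m j)%nat -> f j - b <> - RtoC (INR i)) :
  let M := total r m in
  (forall x : C, slit_plane x ->
     Cpower (1 - x) a * pFq (a :: b :: shifted r f m) (b + 1 :: params r f) x
     = sum_n (fun j : nat =>
         poch a j / poch (b + 1) j * (x / (x - 1)) ^ j
         * sum_n (fun k : nat => (-1) ^ k * poch b k * Ccoef r f m k) j) (M - 1)
       + x ^ M * poch a M * poch_vec r f (- b) m
         / ((x - 1) ^ M * poch (b + 1) M * poch_vec r f 0 m)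
         * pFq (RtoC 1 :: a + INR M :: nil) (b + INR M + 1 :: nil) (x / (x - 1)))
  /\
  (forall x : C,
     Cexp (- x) * pFq (b :: shifted r f m) (b + 1 :: params r f) x
     = sum_n (fun j : nat =>
         (- x) ^ j / poch (b + 1) j
         * sum_n (fun k : nat => (-1) ^ k * poch b k * Ccoef r f m k) j) (M - 1)
       + (- x) ^ M * poch_vec r f (- b) m
         / (poch (b + 1) M * poch_vec r f 0 m)
         * pFq (RtoC 1 :: nil) (b + INR M + 1 :: nil) (- x)).
Proof.
  intros M. assert (hM := total_pos r m hr hm). split; intros x.
  - intros Hx. rewrite gauss_sum_pFq by assumption.
    rewrite (gauss1_pFq (a + INR M) (b + INR M) (bM_neq_0 b r m hb hM)) by (apply pfaff_slit, Hx).
    exact (gauss_sum_eq a b r m f hf hb x Hx).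
  - rewrite kummer_sum_pFq by assumption.
    rewrite (kummer1_pFq (b + INR M) (bM_neq_0 b r m hb hM)).
    exact (kummer_sum_eq b r m f hf hb x).
Qed.
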